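(* Let $n\ge1$, let $s_*\in(0,1)$, let $\mu$ be a probability measure on $[s_*,1]$ with $s_*=\max\{s : \operatorname{supp}\mu\subset[s,1]\}$ and $\mu(\{1\})=0$, and let $Lu=\int_{[s_*,1]}(-\Delta)^s u\,d\mu(s)$. Let $W\in C^3(\mathbb{R})$ satisfy $W(\pm1)=0$ and $W(t)>0$ for $t\neq\pm1$. Let $u$ be a layer solution of $Lu+W'(u)=0$ in $\mathbb{R}^n$, i.e. a solution satisfying $u_{x_n}\ge0$ in $\mathbb{R}^n$ and $\lim_{x_n\to\pm\infty}u(x',x_n)=\pm1$ for all $x'\in\mathbb{R}^{n-1}$. Then, for all $R\ge2$, $$\mathcal{E}(u,B_R)\le C\,\Phi_{n,s_*}(R),$$ where $C$ depends only on $n$, $s_*$ and $W$.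
   Context: $B_R=\{x\in\mathbb{R}^n: |x|<R\}$. For $0<s<1$, $(-\Delta)^s u(x)=c_n(s)\,\mathrm{PV}\int_{\mathbb{R}^n}\frac{u(x)-u(y)}{|x-y|^{n+2s}}\,dy$ with $c_n(s)=\pi^{-n/2}2^{2s}\frac{\Gamma((n+2s)/2)}{\Gamma(2-s)}s(1-s)$ (Fourier symbol $|\xi|^{2s}$). A solution of $Lu+W'(u)=0$ in $\mathbb{R}^n$ is understood in the sense of distributions: $\int_{\mathbb{R}^n}u\,L\xi\,dx+\int_{\mathbb{R}^n}W'(u)\,\xi\,dx=0$ for every $\xi\in C_c^\infty(\mathbb{R}^n)$. (Layer solutions take values in $[-1,1]$; such solutions are of class $C^{2,\gamma}(\mathbb{R}^n)$ for some $\gamma>0$ and satisfy the equation pointwise.) Energy: for $\Omega\subset\mathbb{R}^n$ and $\mathcal{C}\Omega=\mathbb{R}^n\setminus\Omega$, $\mathcal{E}(u,\Omega)=\mathcal{K}(u,\Omega)+\int_\Omega W(u)\,dx$, where $\mathcal{K}(u,\Omega)=\int\mathcal{K}^s(u,\Omega)\,d\mu(s)$ and, for $0<s<1$, $$\mathcal{K}^s(u,\Omega)=\frac{c_n(s)}{4}\iint_{(\mathbb{R}^n\times\mathbb{R}^n)\setminus(\mathcal{C}\Omega\times\mathcal{C}\Omega)}\frac{(u(x)-u(y))^2}{|x-y|^{n+2s}}\,dx\,dy.$$ $\Phi_{n,s}(R)=R^{n-1}(R^{1-2s}-1)(1-2s)^{-1}$ if $s\ne1/2$, and $\Phi_{n,1/2}(R)=R^{n-1}\log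 R$. *)

(* Defs.v *)
From HB Require Import structures.
From mathcomp Require Import all_boot all_order all_algebra.
From mathcomp Require Import all_classical all_reals all_analysis.

Set Implicit Arguments.
Unset Strict Implicit.
Unset Printing Implicit Defensive.

Import Order.TTheory GRing.Theory Num.Theory.
Import numFieldNormedType.Exports.

Local Open Scope classical_set_scope.
Local Open Scope ring_scope.

(* The product sigma-algebra on 'rV[R]_n, which is the Borel one. *)
Definition measure_rV_display : measure_display.
Proof. exact: default_measure_display. Qed.

Section measurable_rV.
Context {R : realType} (n : nat).

Definition rV_coord (i : 'I_n) (x : 'rV[R]_n) : R := x ord0 i.

Let rV_set0 : g_sigma_preimage rV_coord set0.
Proof. exact: sigma_algebra0. Qed.

Let rV_setC A : g_sigma_preimage rV_coord A -> g_sigma_preimage rV_coord (~` A).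
Proof. exact: sigma_algebraC. Qed.

Let rV_bigcup (F : _^nat) : (forall i, g_sigma_preimage rV_coord (F i)) ->
  g_sigma_preimage rV_coord (\bigcup_i (F i)).
Proof. exact: sigma_algebra_bigcup. Qed.

HB.instance Definition _ := @isMeasurable.Build measure_rV_display
  'rV[R]_n (g_sigma_preimage rV_coord) rV_set0 rV_setC rV_bigcup.

Lemma measurable_rV_coord i : measurable_fun [set: 'rV[R]_n] (rV_coord i).
Proof.
move=> _ Y mY; rewrite setTI; apply: sub_sigma_algebra => /=.
rewrite -bigcup_seq/=; exists i => /=; first by rewrite mem_index_enum.
by exists Y => //; rewrite setTI.
Qed.

Lemma measurable_fun_rVP d (T : measurableType d) (f : T -> 'rV[R]_n) :
  (forall i, measurable_fun [set: T] (rV_coord i \o f)) ->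
  measurable_fun [set: T] f.
Proof.
move=> mf; have mS : g_sigma_preimage (fun i => rV_coord i \o f) `<=` measurable.
  apply: smallest_sub; first exact: sigma_algebra_measurable.
  rewrite -bigcup_seq/=; apply: bigcup_sub => i _.
  by move=> A [B mB <-]; exact: mf.
move: mS; rewrite g_sigma_preimage_comp => mS _ A mA.
by apply: mS; exists A.
Qed.
End measurable_rV.

Section lebesgue_rV.
Context {R : realType}.

(* (x', t) |-> the vector of R^(n+1) with last coordinate t *)
Definition rV_snoc n (p : 'rV[R]_n * R) : 'rV[R]_n.+1 :=
  \row_i oapp (fun j => p.1 ord0 j) p.2 (unlift ord_max i).

Lemma measurable_rV_snoc n : measurable_fun setT (@rV_snoc n).
Proof.
apply: measurable_fun_rVP => i; rewrite /rV_coord /rV_snoc.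
case: (unliftP ord_max i) => [j|] ->.
  rewrite (_ : _ \o _ = rV_coord j \o fst).
    by apply: measurableT_comp => //; exact: measurable_rV_coord.
  by apply/funext => p /=; rewrite mxE liftK.
rewrite (_ : _ \o _ = snd)//.
by apply/funext => p /=; rewrite mxE unlift_none.
Qed.


Definition rV_unsnoc n (x : 'rV[R]_n.+1) : 'rV[R]_n * R :=
  (\row_j x ord0 (lift ord_max j), x ord0 ord_max).

Lemma rV_snocK n : cancel (@rV_snoc n) (@rV_unsnoc n).
Proof.
move=> [x t]; rewrite /rV_unsnoc /rV_snoc mxE unlift_none; congr pair.
by apply/rowP => j; rewrite !mxE liftK.
Qed.

Lemma measurable_rV_unsnoc n : measurable_fun setT (@rV_unsnoc n).
Proof.
apply: measurable_fun_pair; last exact: measurable_rV_coord.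
apply: measurable_fun_rVP => j.
rewrite (_ : _ \o _ = rV_coord (lift ord_max j)); first exact: measurable_rV_coord.
by apply/funext => x; rewrite /rV_coord /= mxE.
Qed.

Section lebesgue_rV_step.
Variables (n : nat) (m : {sigma_finite_measure set 'rV[R]_n -> \bar R}).

Definition lebesgue_rV_step : set 'rV[R]_n.+1 -> \bar R :=
  pushforward (m \x (@lebesgue_measure R))%E (@rV_snoc n).

Let step0 : lebesgue_rV_step set0 = 0%E.
Proof. by rewrite /lebesgue_rV_step /pushforward preimage_set0 measure0. Qed.

Let step_ge0 A : (0 <= lebesgue_rV_step A)%E.
Proof. exact: integral_ge0. Qed.

Let step_sigma_additive : semi_sigma_additive lebesgue_rV_step.
Proof.
pose p := [the measure _ _ of (m \x (@lebesgue_measure R))%E].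
apply: (@measure_semi_sigma_additive _ _ _ (pushforward p (@rV_snoc n))).
exact: measurable_rV_snoc.
Qed.

HB.instance Definition _ := isMeasure.Build _ _ _ lebesgue_rV_step
  step0 step_ge0 step_sigma_additive.

Let step_sigma_finite : sigma_finite setT lebesgue_rV_step.
Proof.
have /sigma_finiteP[F [FT ndF Foo]] := sigma_finiteT m.
have /sigma_finiteP[G [GT ndG Goo]] := sigma_finiteT (@lebesgue_measure R).
exists (fun k => @rV_unsnoc n @^-1` (F k `*` G k)).
  rewrite -preimage_bigcup -(@preimage_setT _ _ (@rV_unsnoc n)); congr preimage.
  rewrite -setXTT FT GT; apply/seteqP; split=> -[x t] /=.
    move=> [[i _ Fix] [j _ Gjt]]; exists (maxn i j) => //; split.
      by move: x Fix; exact/subsetPset/ndF/leq_maxl.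
    by move: t Gjt; exact/subsetPset/ndG/leq_maxr.
  by move=> [i _ [/= Fix Git]]; split; exists i.
move=> k; have [mF Fk] := Foo k; have [mG Gk] := Goo k; split.
  rewrite -[X in measurable X]setTI; apply: measurable_rV_unsnoc => //.
  exact: measurableX.
rewrite /lebesgue_rV_step /pushforward -comp_preimage.
rewrite (_ : _ \o _ = id); last by apply/funext => x; exact: rV_snocK.
by rewrite preimage_id product_measure1E// lte_mul_pinfty// ge0_fin_numE.
Qed.

HB.instance Definition _ := Measure_isSigmaFinite.Build _ _ _ lebesgue_rV_step
  step_sigma_finite.

End lebesgue_rV_step.

Fixpoint lebesgue_rV n : {sigma_finite_measure set 'rV[R]_n -> \bar R} :=
  match n return {sigma_finite_measure set 'rV[R]_n -> \bar R} with
  | 0 => \d_(0 : 'rV[R]_0)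
  | n'.+1 => lebesgue_rV_step (lebesgue_rV n')
  end.

Lemma lebesgue_rV_box n (D : 'I_n -> set R) : (forall i, measurable (D i)) ->
  lebesgue_rV n [set x | forall i, D i (x ord0 i)] =
  (\prod_(i < n) lebesgue_measure (D i))%E.
Proof.
elim: n D => [|n IHn] D mD.
  by rewrite big_ord0 /= diracE mem_set// => -[].
rewrite /= /lebesgue_rV_step /pushforward /=.
pose D' (i : 'I_n) := D (lift ord_max i).
have -> : @rV_snoc n @^-1` [set x | forall i, D i (x ord0 i)] =
    [set x : 'rV[R]_n | forall i, D' i (x ord0 i)] `*` D ord_max.
  apply/seteqP; split=> -[x t] /=.
    move=> xD; split=> [i|]; last by have := xD ord_max; rewrite mxE unlift_none.
    by have := xD (lift ord_max i); rewrite mxE liftK.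
  by move=> [xD tD] i; case: (unliftP ord_max i) => [j|] ->;
    rewrite mxE ?liftK ?unlift_none//=; exact: xD.
have mD' : measurable [set x : 'rV[R]_n | forall i, D' i (x ord0 i)].
  have -> : [set x : 'rV[R]_n | forall i, D' i (x ord0 i)] =
      \bigcap_(i in [set: 'I_n]) (rV_coord i @^-1` D' i).
    by apply/seteqP; split=> x //= xD i; [move=> _|]; exact: xD.
  apply: fin_bigcap_measurable => // i _.
  by rewrite -[X in measurable X]setTI; apply: measurable_rV_coord => //; exact: mD.
rewrite product_measure1E//; last exact: mD.
have DE i : D (widen_ord (leqnSn n) i) = D' i.
  by congr D; apply/val_inj; rewrite /= /bump leqNgt ltn_ord.
rewrite big_ord_recr /=; congr (_ * _)%E.
under eq_bigr do rewrite DE.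
by apply: IHn => i; exact: mD.
Qed.

End lebesgue_rV.

Section smoothness.
Context {R : realType}.

Definition is_Ck (k : nat) (f : R -> R) : Prop :=
  (forall j, (j < k)%N -> forall x, derivable (derive1n j f) x 1) /\
  continuous (derive1n k f).

(* C^k through continuity of all iterated partial derivatives up to order k *)
Fixpoint is_Ck_rV n (k : nat) (f : 'rV[R]_n -> R) : Prop :=
  continuous f /\
  if k is k'.+1 then
    forall i : 'I_n, (forall x, derivable f x (delta_mx ord0 i)) /\
      is_Ck_rV k' (fun x => 'D_(delta_mx ord0 i) f x)
  else True.

Definition test_function n (xi : 'rV[R]_n -> R) : Prop :=
  (forall k, is_Ck_rV k xi) /\ compact (closure [set x | xi x != 0]).

End smoothness.

Section sum_of_fractional_laplacians.
Context {R : realType}.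

(* the norm of the normed module 'rV[R]_n is the sup norm *)
Definition enorm n (x : 'rV[R]_n) : R := Num.sqrt (\sum_i x ord0 i ^+ 2).

Definition eball n (r : R) : set 'rV[R]_n := [set x | enorm x < r].

Definition Gamma (a : R) : R :=
  \int[lebesgue_measure]_(t in `]0, +oo[) (t `^ (a - 1) * expR (- t)).

Definition frac_const (n : nat) (s : R) : R :=
  pi `^ (- (n%:R / 2)) * 2 `^ (2 * s) *
  (Gamma ((n%:R + 2 * s) / 2) / Gamma (2 - s)) * (s * (1 - s)).

Definition frac_laplacian n (s : R) (u : 'rV[R]_n -> R) (x : 'rV[R]_n) : R :=
  frac_const n s *
  lim ((\int[lebesgue_rV n]_(y in [set y | eps <= enorm (x - y)])
          ((u x - u y) / enorm (x - y) `^ (n%:R + 2 * s))) @[eps --> 0^'+]).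

Definition measure_support (mu : set R -> \bar R) : set R :=
  [set x | forall U : set R, open U -> U x -> (0 < mu U)%E].

Variable mu : probability (measurableTypeR R) R.

(* The formula defining frac_laplacian is only meant for 0 < s < 1; the operator
   and the energy below are only used with mu [set 1] = 0, so that their
   integrands at s = 1 are irrelevant. *)
Definition sum_frac_laplacian n (s0 : R) (u : 'rV[R]_n -> R) (x : 'rV[R]_n) : R :=
  \int[mu]_(s in `[s0, 1]) frac_laplacian s u x.

(* For a bounded measurable u both integrands are integrable, so that Rintegral
   never takes its default value. *)
Definition distributional_solution n (s0 : R) (W : R -> R) (u : 'rV[R]_n -> R) :=
  forall xi : 'rV[R]_n -> R, test_function xi ->
    \int[lebesgue_rV n]_x (u x * sum_frac_laplacian s0 xi x) +
    \int[lebesgue_rV n]_x (derive1 W (u x) * xi x) = 0.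

(* Boundedness (by 1) follows from the monotonicity and the limits. *)
Definition layer_solution n (s0 : R) (W : R -> R) (u : 'rV[R]_n.+1 -> R) : Prop :=
  let e_last : 'rV[R]_n.+1 := delta_mx ord0 ord_max in
  [/\ measurable_fun setT u,
      distributional_solution s0 W u,
      forall x, derivable u x e_last /\ 0 <= 'D_e_last u x &
      forall x' : 'rV[R]_n,
        u (rV_snoc (x', t)) @[t --> +oo] --> (1 : R) /\
        u (rV_snoc (x', t)) @[t --> -oo] --> (-1 : R)].

Local Open Scope ereal_scope.

Definition frac_kinetic n (s : R) (u : 'rV[R]_n -> R) (Om : set 'rV[R]_n) : \bar R :=
  (frac_const n s / 4)%:E *
  \int[lebesgue_rV n \x lebesgue_rV n]_(z in ~` (~` Om `*` ~` Om))
    ((u z.1 - u z.2) ^+ 2 / enorm (z.1 - z.2) `^ (n%:R + 2 * s))%:E.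

Definition kinetic n (s0 : R) (u : 'rV[R]_n -> R) (Om : set 'rV[R]_n) : \bar R :=
  \int[mu]_(s in `[s0, 1%R]) frac_kinetic s u Om.

Definition energy n (s0 : R) (W : R -> R) (u : 'rV[R]_n -> R) (Om : set 'rV[R]_n)
    : \bar R :=
  kinetic s0 u Om + \int[lebesgue_rV n]_(x in Om) (W (u x))%:E.

End sum_of_fractional_laplacians.

Definition Phi {R : realType} (n : nat) (s r : R) : R :=
  r ^+ n.-1 *
  (if s == 1 / 2 then ln r else (r `^ (1 - 2 * s) - 1) / (1 - 2 * s)).

(* Main.v *)
(* The kinetic energy is the quadratic form of the kernel k(h), the mu-average of
   c(s) / (4 |h|^(n+1+2s)), in the coordinates (x, x + h). Let phi be the Lipschitz
   cutoff equal to 1 on B_(r+1) and to -1 outside B_(r+2), and v = max(u, phi). The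
   layer u is a minimizer because it is monotone: its translates u(. + t e_n) increase
   from u to 1, so that min(v, u(. + t e_n)) deforms u into v, and where the deformation
   moves it coincides with the translate, which solves the equation. Testing the
   equation of each translate with the increment of the deformation and summing gives
   that the energy of u in B_(r+1) is at most the energy of phi plus a boundary term,
   which avoids any regularity theory for u.
   As u is only a bounded distributional solution, this is done for mollifications of u
   and passed to the limit, first in the mollification (L^1_loc convergence, with the
   kernel truncated), then in the step and the length of the deformation.
   What remains is the interaction of B_(r+2) with the complement of B_(r+1): at
   distance h it has volume at most C r^n min(1 + |h|, r + 2), and a dyadic decomposition
   of the kernel bounds its energy by C r^n sum_(j < m) 2^(j(1 - 2 s_0)), where
   2^m <= r < 2^(m+1); this sum is comparable to Phi. *)
Require Import Defs.
From HB Require Import structures.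
From mathcomp Require Import all_boot all_order all_algebra.
From mathcomp Require Import all_classical all_reals all_analysis.
From mathcomp Require Import measurable_realfun ring lra.
Set Implicit Arguments.
Unset Strict Implicit.
Unset Printing Implicit Defensive.
Import Order.TTheory GRing.Theory Num.Theory.
Import numFieldNormedType.Exports.
Local Open Scope classical_set_scope.
Local Open Scope ring_scope.

(** * Integration on R^(n+1) *)

(** The layer and its competitor may both have infinite energy on the whole space, so energies are
    never subtracted: the comparison is proved for each pair of points, before integration. For a
    pair it is the convexity of the square, summed over the steps of the deformation; what remains
    on the right is the square for the cutoff function and pairings with the increments, which have
    compact support, so that everything is integrable against the kernel. The mollification of $u$
    solves a linear equation whose right-hand side is the mollification of $W'(u)$, not $W'$ of the
    mollification. Hence the comparison is stated for a pair [f], [g] with $Lf = -g$, and $W$ enters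
    only after the mollification is removed, when the sum over the steps becomes a Riemann sum of
    $W'$. The constant is uniform in $\mu$ because the factor $1-s$ in the constant of each
    fractional Laplacian cancels the $1/(1-s)$ produced by its kernel near the diagonal, while far
    from it the worst exponent is $s_0$. *)

Section curried_tonelli.
Context d1 d2 (T1 : measurableType d1) (T2 : measurableType d2) (R : realType).
Variable m1 : {sigma_finite_measure set T1 -> \bar R}.
Variable m2 : {sigma_finite_measure set T2 -> \bar R}.
Variable f : T1 -> T2 -> \bar R.
Hypothesis mf : measurable_fun setT (fun p : T1 * T2 => f p.1 p.2).
Hypothesis f0 : forall x y, (0 <= f x y)%E.

Lemma measurable_integralr : measurable_fun setT (fun x => \int[m2]_y f x y)%E.
Proof. exact: (measurable_fun_fubini_tonelli_F (fun p => f p.1 p.2)). Qed.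

Lemma measurable_integrall : measurable_fun setT (fun y => \int[m1]_x f x y)%E.
Proof. exact: (measurable_fun_fubini_tonelli_G (fun p => f p.1 p.2)). Qed.

Lemma integral_prodE :
  (\int[m1 \x m2]_p f p.1 p.2 = \int[m1]_x \int[m2]_y f x y)%E.
Proof. exact: (fubini_tonelli1 (fun p => f p.1 p.2)). Qed.

Lemma integral_exchange :
  (\int[m1]_x \int[m2]_y f x y = \int[m2]_y \int[m1]_x f x y)%E.
Proof. exact: (fubini_tonelli (fun p => f p.1 p.2)). Qed.

End curried_tonelli.

Section affine_line.
Context {R : realType}.
Implicit Types (a c : R).

Lemma measurable_affine a c :
  measurable_fun setT (fun t => a + c * t : measurableTypeR R).
Proof.
by apply: measurable_funD => //; exact: measurable_funM.
Qed.

(** By uniqueness of Lebesgue measure it suffices to compare half-open intervals. A negative slope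
    exchanges the open and the closed end, which does not affect the length. *)
Lemma lebesgue_measure_affine a c (A : set R) : c != 0 -> measurable A ->
  (`|c|%:E * lebesgue_measure ((fun t => (a + c * t)%R) @^-1` A) =
   lebesgue_measure A)%E.
Proof.
move=> c0 mA.
pose phi : measurableTypeR R -> measurableTypeR R := fun t => a + c * t.
apply/esym; apply: (@lebesgue_measure_unique _
  (mscale (NngNum (normr_ge0 c)) (pushforward (@lebesgue_measure R) phi))) => //.
  exact: measurable_affine.
move=> mphi _ [[x y] _ <-]; change (lebesgue_measure `]x, y]%classic =
  `|c|%:E * lebesgue_measure (phi @^-1` `]x, y]%classic))%E.
have [c_gt0|c_le0] := ltP 0 c.
  rewrite (_ : _ @^-1` _ = `](x - a) / c, (y - a) / c]%classic); last first.
    apply/seteqP; split => t; rewrite /phi /= !in_itv/= ltr_pdivrMr// ler_pdivlMr//.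
      by move=> /andP[]; lra.
    by move=> /andP[]; lra.
  rewrite !lebesgue_measure_itv/= !lte_fin ltr_pM2r ?invr_gt0// ltrD2r.
  case: ifPn => _; last by rewrite mule0.
  by rewrite -!EFinB -EFinM gtr0_norm//; congr EFin; field.
have c_lt0 : c < 0 by rewrite lt_neqAle c0.
rewrite (_ : _ @^-1` _ = `[(y - a) / c, (x - a) / c[%classic); last first.
  apply/seteqP; split => t; rewrite /phi /= !in_itv/= ltr_ndivlMr// ler_ndivrMr//.
    by move=> /andP[]; lra.
  by move=> /andP[]; lra.
rewrite !lebesgue_measure_itv/= !lte_fin ltr_nM2r ?invr_lt0// ltrD2r.
case: ifPn => _; last by rewrite mule0.
by rewrite -!EFinB -EFinM ltr0_norm//; congr EFin; field.
Qed.

Lemma ge0_integral_line_affine a c (F : R -> \bar R) : c != 0 ->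
  measurable_fun setT F -> (forall t, 0 <= F t)%E ->
  (`|c|%:E * \int[@lebesgue_measure R]_t F (a + c * t)%R =
   \int[@lebesgue_measure R]_t F t)%E.
Proof.
move=> c0 mF F0.
pose phi : measurableTypeR R -> measurableTypeR R := fun t => a + c * t.
have mphi : measurable_fun setT phi by exact: measurable_affine.
pose nu := mscale (NngNum (normr_ge0 c)) (pushforward (@lebesgue_measure R) phi).
rewrite (@eq_measure_integral _ _ _ setT (nu mphi) _ F) => [|A mA _]; last first.
  exact/esym/(lebesgue_measure_affine a c0 mA).
rewrite ge0_integral_mscale//; congr (_ * _)%E.
by rewrite ge0_integral_pushforward.
Qed.

End affine_line.

Section integral_rV.
Context {R : realType}.

Lemma measurable_rV_snocE n (x : 'rV[R]_n) :
  measurable_fun setT (fun t : measurableTypeR R => rV_snoc (x, t)).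
Proof. by apply: (measurableT_comp (@measurable_rV_snoc R n)). Qed.

Lemma integral_rVS n (F : 'rV[R]_n.+1 -> \bar R) : measurable_fun setT F ->
  (forall x, 0 <= F x)%E ->
  (\int[lebesgue_rV n.+1]_x F x =
   \int[lebesgue_rV n]_x \int[@lebesgue_measure R]_t F (rV_snoc (x, t)))%E.
Proof.
move=> mF F0.
pose nu := pushforward (lebesgue_rV n \x @lebesgue_measure R)%E (@rV_snoc R n).
rewrite -[LHS]/(\int[nu]_x F x)%E.
rewrite ge0_integral_pushforward//; last exact: measurable_rV_snoc.
rewrite preimage_setT.
apply: (@fubini_tonelli1 _ _ _ _ R (lebesgue_rV n) (@lebesgue_measure R) (F \o @rV_snoc R n)) => //.
  by apply: measurableT_comp => //; exact: measurable_rV_snoc.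
by move=> x; exact: F0.
Qed.

Lemma measurable_rVD d (T : measurableType d) n (f g : T -> 'rV[R]_n) :
  measurable_fun setT f -> measurable_fun setT g ->
  measurable_fun setT (fun t => f t + g t).
Proof.
move=> mf mg; apply: measurable_fun_rVP => i.
rewrite (_ : _ \o _ = (rV_coord i \o f) \+ (rV_coord i \o g)); last first.
  by apply/funext => t; rewrite /rV_coord /= mxE.
by apply: measurable_funD; apply: measurableT_comp => //; exact: measurable_rV_coord.
Qed.

Lemma measurable_rVZ d (T : measurableType d) n (a : R) (f : T -> 'rV[R]_n) :
  measurable_fun setT f -> measurable_fun setT (fun t => a *: f t).
Proof.
move=> mf; apply: measurable_fun_rVP => i.
rewrite (_ : _ \o _ = fun t => a * (rV_coord i \o f) t); last first.
  by apply/funext => t; rewrite /rV_coord /= mxE.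
by apply: measurable_funM => //; apply: measurableT_comp => //; exact: measurable_rV_coord.
Qed.

Lemma measurable_rVN d (T : measurableType d) n (f : T -> 'rV[R]_n) :
  measurable_fun setT f -> measurable_fun setT (fun t => - f t).
Proof.
by move=> mf; under eq_fun do rewrite -scaleN1r; exact: measurable_rVZ.
Qed.

Lemma measurable_rVB d (T : measurableType d) n (f g : T -> 'rV[R]_n) :
  measurable_fun setT f -> measurable_fun setT g ->
  measurable_fun setT (fun t => f t - g t).
Proof. by move=> mf mg; apply: measurable_rVD => //; exact: measurable_rVN. Qed.

Lemma measurable_enorm d (T : measurableType d) n (f : T -> 'rV[R]_n) :
  measurable_fun setT f -> measurable_fun setT (fun t => enorm (f t)).
Proof.
move=> mf; rewrite /enorm.
have msqrt : measurable_fun setT (@Num.sqrt R).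
  apply: continuous_measurable_fun => x; exact: sqrt_continuous.
apply: (measurableT_comp msqrt).
apply: measurable_sum => i; apply: measurable_funX.
by apply: (measurableT_comp (measurable_rV_coord i)).
Qed.

Lemma rV_snoc_affine n (c : R) (a : 'rV[R]_n.+1) (x : 'rV[R]_n) (t : R) :
  a + c *: rV_snoc (x, t) =
  rV_snoc ((rV_unsnoc a).1 + c *: x, (rV_unsnoc a).2 + c * t).
Proof.
apply/rowP => i; rewrite !mxE; case: (unliftP ord_max i) => [j|] -> /=.
  by rewrite ?liftK/= ?mxE.
by rewrite ?unlift_none/=.
Qed.

(** The measure is built one coordinate at a time, so the change of variables is an induction on the
    dimension with the one-dimensional case in the last coordinate. Translations, reflections and
    dilations are all instances. *)
Lemma ge0_integral_rV_affine n (c : R) (a : 'rV[R]_n) (F : 'rV[R]_n -> \bar R) :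
  c != 0 -> measurable_fun setT F -> (forall x, 0 <= F x)%E ->
  ((`|c| ^+ n)%:E * \int[lebesgue_rV n]_x F (a + c *: x)%R =
   \int[lebesgue_rV n]_x F x)%E.
Proof.
move=> c0; elim: n a F => [|n IHn] a F mF F0.
  have -> : (fun x => F (a + c *: x)) = F.
    by apply/funext => x; congr F; apply/rowP => -[].
  by rewrite expr0 mul1e.
have mFa : measurable_fun setT (fun x : 'rV[R]_n.+1 => F (a + c *: x)).
  apply: measurableT_comp => //; apply: measurable_rVD => //.
  exact: measurable_rVZ.
rewrite !integral_rVS//.
under eq_integral do under eq_integral do rewrite rV_snoc_affine.
set b := rV_unsnoc a.
pose G x := (\int[@lebesgue_measure R]_t F (rV_snoc (x, t)))%E.
have mG : measurable_fun setT G.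
  apply: (@measurable_fun_fubini_tonelli_F _ _ _ _ _ (@lebesgue_measure R) (F \o @rV_snoc R n)) => //.
    apply: measurableT_comp => //; exact: measurable_rV_snoc.
  by move=> x /=.
have G0 x : (0 <= G x)%E by exact: integral_ge0.
rewrite -[RHS](IHn b.1 G mG G0) exprSr EFinM -muleA; congr (_ * _)%E.
rewrite -ge0_integralZl_EFin//; last 2 first.
- by move=> x _; exact: integral_ge0.
- apply: (@measurable_integralr _ _ _ _ _ (@lebesgue_measure R)
    (fun (x : 'rV[R]_n) (t : measurableTypeR R) =>
      F (rV_snoc (b.1 + c *: x, b.2 + c * t)))) => //.
  apply: measurableT_comp => //; apply: (measurableT_comp (@measurable_rV_snoc R n)).
  apply: measurable_fun_pair.
    by apply: measurable_rVD => //; exact: measurable_rVZ.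
  by apply: measurable_funD => //; exact: measurable_funM.
apply: eq_integral => x _.
rewrite (@ge0_integral_line_affine _ _ _ (fun t => F (rV_snoc (b.1 + c *: x, t))))//.
by apply: measurableT_comp => //; exact: measurable_rV_snocE.
Qed.

End integral_rV.

Arguments lebesgue_rV {R} n : simpl never.
#[global] Opaque lebesgue_rV.

Section euclidean_norm.
Context {R : realType} {n : nat}.
Implicit Types x y : 'rV[R]_n.

Lemma sum_sqr_ge0 x : 0 <= \sum_i x ord0 i ^+ 2.
Proof. by apply: sumr_ge0 => i _; exact: sqr_ge0. Qed.

Lemma enorm_ge0 x : 0 <= enorm x.
Proof. exact: sqrtr_ge0. Qed.

Lemma sqr_enorm x : enorm x ^+ 2 = \sum_i x ord0 i ^+ 2.
Proof. by rewrite sqr_sqrtr// sum_sqr_ge0. Qed.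

Lemma enorm0 : enorm (0 : 'rV[R]_n) = 0.
Proof. by rewrite /enorm big1 ?sqrtr0// => i _; rewrite mxE expr0n. Qed.

Lemma enormZ (c : R) x : enorm (c *: x) = `|c| * enorm x.
Proof.
rewrite /enorm -sqrtr_sqr -sqrtrM ?sqr_ge0// mulr_sumr; congr Num.sqrt.
by apply: eq_bigr => i _; rewrite mxE exprMn.
Qed.

Lemma enormN x : enorm (- x) = enorm x.
Proof. by rewrite -scaleN1r enormZ normrN1 mul1r. Qed.

Lemma enormB x y : enorm (x - y) = enorm (y - x).
Proof. by rewrite -enormN opprB. Qed.

Lemma coord_le_enorm x i : `|x ord0 i| <= enorm x.
Proof.
rewrite -sqrtr_sqr ler_sqrt ?sum_sqr_ge0//.
rewrite (bigD1 i)//= lerDl; apply: sumr_ge0 => j _; exact: sqr_ge0.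
Qed.

Lemma enorm_eq0 x : (enorm x == 0) = (x == 0).
Proof.
apply/idP/eqP => [/eqP x0|->]; last by rewrite enorm0.
apply/rowP => i; rewrite mxE; apply/eqP; rewrite -normr_le0 -x0.
exact: coord_le_enorm.
Qed.

Lemma enorm_gt0 x : (0 < enorm x) = (x != 0).
Proof. by rewrite lt_neqAle enorm_ge0 andbT eq_sym enorm_eq0. Qed.

Lemma cauchy_schwarz_enorm x y : \sum_i x ord0 i * y ord0 i <= enorm x * enorm y.
Proof.
have [->|x0] := eqVneq x 0.
  by rewrite enorm0 mul0r big1// => i _; rewrite mxE mul0r.
have [->|y0] := eqVneq y 0.
  by rewrite enorm0 mulr0 big1// => i _; rewrite mxE mulr0.
have X0 : 0 < enorm x by rewrite enorm_gt0.
have Y0 : 0 < enorm y by rewrite enorm_gt0.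
rewrite -(ler_pM2l (mulr_gt0 X0 Y0)).
have -> : enorm x * enorm y * (enorm x * enorm y) =
    (\sum_i (enorm y ^+ 2 * x ord0 i ^+ 2 + enorm x ^+ 2 * y ord0 i ^+ 2)) / 2.
  by rewrite big_split/= -!mulr_sumr -!sqr_enorm; field.
rewrite mulr_sumr mulr_suml; apply: ler_sum => i _.
have := sqr_ge0 (enorm y * x ord0 i - enorm x * y ord0 i); nra.
Qed.

Lemma enormD x y : enorm (x + y) <= enorm x + enorm y.
Proof.
rewrite -(@ler_pXn2r _ 2)// ?nnegrE ?addr_ge0 ?enorm_ge0//.
rewrite sqr_enorm sqrrD !sqr_enorm.
under eq_bigr do rewrite mxE sqrrD.
rewrite !big_split/= lerD2r lerD2l.
have /(ler_wMn2r 2) := cauchy_schwarz_enorm x y.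
by rewrite mulr2n.
Qed.

Lemma ler_enorm_sum x : enorm x <= \sum_i `|x ord0 i|.
Proof.
have S0 : 0 <= \sum_i `|x ord0 i| by apply: sumr_ge0.
rewrite -(@ler_pXn2r _ 2)// ?nnegrE ?enorm_ge0//.
rewrite sqr_enorm expr2 mulr_suml; apply: ler_sum => i _.
rewrite -real_normK ?num_real// expr2 ler_wpM2l//.
rewrite (bigD1 i)//= lerDl; exact: sumr_ge0.
Qed.

Lemma ler_dist_enorm x y : `|enorm x - enorm y| <= enorm (x - y).
Proof.
rewrite ler_norml; apply/andP; split.
  by have := enormD (y - x) x; rewrite subrK enormB; lra.
by have := enormD (x - y) y; rewrite subrK; lra.
Qed.

End euclidean_norm.

Section integral_rV_shift.
Context {R : realType} {n : nat}.
Implicit Types (F : 'rV[R]_n -> \bar R) (a : 'rV[R]_n).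

Lemma ge0_integral_shift a F : measurable_fun setT F -> (forall x, 0 <= F x)%E ->
  (\int[lebesgue_rV n]_x F (x + a)%R = \int[lebesgue_rV n]_x F x)%E.
Proof.
move=> mF F0; rewrite -[RHS](ge0_integral_rV_affine a (oner_neq0 R) mF F0).
rewrite normr1 expr1n mul1e; apply: eq_integral => x _.
by rewrite scale1r addrC.
Qed.

Lemma ge0_integral_reflect a F : measurable_fun setT F -> (forall x, 0 <= F x)%E ->
  (\int[lebesgue_rV n]_x F (a - x)%R = \int[lebesgue_rV n]_x F x)%E.
Proof.
move=> mF F0; have N10 : (-1 : R) != 0 by rewrite oppr_eq0 oner_eq0.
rewrite -[RHS](ge0_integral_rV_affine a N10 mF F0).
rewrite normrN1 expr1n mul1e; apply: eq_integral => x _.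
by rewrite scaleN1r.
Qed.

Lemma integral_shift a F : measurable_fun setT F ->
  (\int[lebesgue_rV n]_x F (x + a)%R = \int[lebesgue_rV n]_x F x)%E.
Proof.
move=> mF; rewrite -[LHS]/(\int[lebesgue_rV n]_x (F \o (fun y => (y + a)%R)) x)%E.
rewrite integralE [RHS]integralE funepos_comp funeneg_comp; congr (_ - _)%E.
  exact: (ge0_integral_shift a (measurable_funepos mF) (funepos_ge0 _)).
exact: (ge0_integral_shift a (measurable_funeneg mF) (funeneg_ge0 _)).
Qed.

Lemma integral_reflect a F : measurable_fun setT F ->
  (\int[lebesgue_rV n]_x F (a - x)%R = \int[lebesgue_rV n]_x F x)%E.
Proof.
move=> mF; rewrite -[LHS]/(\int[lebesgue_rV n]_x (F \o (fun y => (a - y)%R)) x)%E.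
rewrite integralE [RHS]integralE funepos_comp funeneg_comp; congr (_ - _)%E.
  exact: (ge0_integral_reflect a (measurable_funepos mF) (funepos_ge0 _)).
exact: (ge0_integral_reflect a (measurable_funeneg mF) (funeneg_ge0 _)).
Qed.

Lemma Rintegral_shift a (f : 'rV[R]_n -> R) : measurable_fun setT f ->
  \int[lebesgue_rV n]_x f (x + a) = \int[lebesgue_rV n]_x f x.
Proof.
move=> mf; apply: (congr1 fine).
by apply: (integral_shift a (F := EFin \o f)); exact/measurable_EFinP.
Qed.

Lemma Rintegral_reflect a (f : 'rV[R]_n -> R) : measurable_fun setT f ->
  \int[lebesgue_rV n]_x f (a - x) = \int[lebesgue_rV n]_x f x.
Proof.
move=> mf; apply: (congr1 fine).
by apply: (integral_reflect a (F := EFin \o f)); exact/measurable_EFinP.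
Qed.

End integral_rV_shift.

Section balls.
Context {R : realType}.

Lemma measurable_eball n (r : R) : measurable (@eball R n r).
Proof.
rewrite (_ : eball r = (@enorm R n) @^-1` `]-oo, r[).
  rewrite -[X in measurable X]setTI.
  by apply: (measurable_enorm (@measurable_id _ _ setT)).
by apply/seteqP; split => x; rewrite /eball /= in_itv.
Qed.

Lemma eball_eq0 n (r : R) : r <= 0 -> @eball R n r = set0.
Proof.
move=> r0; apply/seteqP; split => x //=; rewrite /eball /= => xr.
by have := enorm_ge0 x; rewrite leNgt (lt_le_trans xr r0).
Qed.

Lemma measurable_box n (D : 'I_n -> set R) : (forall i, measurable (D i)) ->
  measurable [set x : 'rV[R]_n | forall i, D i (x ord0 i)].
Proof.
move=> mD; rewrite (_ : mkset _ = \bigcap_(i in [set: 'I_n]) (rV_coord i @^-1` D i)).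
  apply: fin_bigcap_measurable => // i _.
  by rewrite -[X in measurable X]setTI; apply: measurable_rV_coord => //; exact: mD.
by apply/seteqP; split=> x //= xD i; [move=> _|]; exact: xD.
Qed.

Lemma lebesgue_eball_le n (r : R) : 0 < r ->
  (lebesgue_rV n (eball r) <= ((2 * r) ^+ n)%:E)%E.
Proof.
move=> r0; apply: (@le_trans _ _
  (lebesgue_rV n [set x | forall i, `]-r, r[%classic (x ord0 i)])); last first.
  rewrite (@lebesgue_rV_box _ n (fun=> `]-r, r[%classic)) //.
  rewrite lebesgue_measure_itv/= lte_fin gtrN// -EFinB opprK -mulr2n -[r *+ 2]mulr_natl.
  rewrite prodEFin lee_fin big_const_ord iter_mulr_1.
  by [].
apply: le_measure; rewrite ?inE.
- exact: measurable_eball.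
- by apply: (@measurable_box n (fun=> `]-r, r[%classic)).
- move=> x /= xr i; rewrite in_itv/= -ltr_norml.
  exact: le_lt_trans (coord_le_enorm x i) xr.
Qed.

Lemma lebesgue_eball_fin n (r : R) : (lebesgue_rV n (eball r) < +oo)%E.
Proof.
have [r0|r0] := leP r 0; first by rewrite eball_eq0// measure0.
exact: le_lt_trans (lebesgue_eball_le n r0) (ltry _).
Qed.

(** The volume of the unit ball stays an unknown constant: scaling alone turns the volume of an
    annulus into a difference of powers of its radii. *)
Lemma lebesgue_eball n (r : R) : 0 < r ->
  (lebesgue_rV n (eball r) = (r ^+ n)%:E * lebesgue_rV n (eball 1))%E.
Proof.
move=> r0; have mB := @measurable_eball n.
have -> : lebesgue_rV n (eball (1 : R)) = (\int[lebesgue_rV n]_x (\1_(eball 1) x)%:E)%E.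
  by rewrite integral_indic// setIT.
rewrite -(@ge0_integral_rV_affine R n r^-1 0 (fun x => (\1_(eball 1) x)%:E))//; last 2 first.
- by rewrite invr_eq0 gt_eqF.
- by apply/measurable_EFinP; exact: measurable_indic.
rewrite (eq_integral (fun x => (\1_(eball r) x)%:E)); last first.
  move=> x _; congr EFin; rewrite !indicE; congr ((nat_of_bool _)%:R).
  apply/idP/idP; rewrite !inE /eball /= add0r enormZ gtr0_norm ?invr_gt0//;
    by rewrite mulrC ltr_pdivrMr// mul1r.
rewrite integral_indic// setIT muleA -EFinM gtr0_norm ?invr_gt0//.
by rewrite -exprMn divff ?gt_eqF// expr1n mul1e.
Qed.

Lemma ler_exprB n (a b : R) : 0 <= a -> a <= b ->
  b ^+ n.+1 - a ^+ n.+1 <= n.+1%:R * b ^+ n * (b - a).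
Proof.
move=> a0 ab; have b0 := le_trans a0 ab.
rewrite subrXX mulrC ler_wpM2r ?subr_ge0//.
rewrite (le_trans (_ : _ <= \sum_(i < n.+1) b ^+ n))//; last first.
  by rewrite sumr_const card_ord mulr_natl.
apply: ler_sum => i _ /=.
have -> : b ^+ n = b ^+ (n - i) * b ^+ i by rewrite -exprD subnK// -ltnS.
by apply: ler_wpM2l; rewrite ?exprn_ge0// lerXn2r ?nnegrE.
Qed.

(** What matters is that the bound is linear in the thickness. For [a <= 0] the annulus is the whole
    ball, and its radius [b] is at most [b - a]. *)
Lemma lebesgue_annulus_le n (a b : R) : 0 < b -> a <= b ->
  (lebesgue_rV n.+1 (eball b `\` eball a) <=
   (2 ^+ n.+1 * n.+1%:R * b ^+ n * (b - a))%:E)%E.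
Proof.
move=> b0 ab; have mB := @measurable_eball n.+1.
have [a0|a0] := leP a 0.
  rewrite (eball_eq0 _ a0) setD0; apply: (le_trans (lebesgue_eball_le n.+1 b0)).
  rewrite lee_fin exprMn exprS -!mulrA ler_wpM2l ?exprn_ge0//.
  rewrite ler_wpM2l ?exprn_ge0// exprSr [leRHS]mulrCA ler_wpM2l ?exprn_ge0 ?(ltW b0)//.
  have bb : b <= b - a by lra.
  by apply: (le_trans bb); rewrite ler_peMl ?ler1n//; exact: le_trans (ltW b0) bb.
have [K [K0 KE]] : exists K : R, 0 <= K /\ lebesgue_rV n.+1 (eball 1) = K%:E.
  exists (fine (lebesgue_rV n.+1 (eball 1))); split; first exact/fine_ge0/measure_ge0.
  by rewrite fineK// ge0_fin_numE// lebesgue_eball_fin.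
have K2 : K <= 2 ^+ n.+1.
  have := @lebesgue_eball_le n.+1 1 ltr01.
  by rewrite KE lee_fin mulr1.
have Eb := lebesgue_eball n.+1 b0; have Ea := lebesgue_eball n.+1 a0.
have H : (lebesgue_rV n.+1 (eball b) - lebesgue_rV n.+1 (eball a) <=
    (2 ^+ n.+1 * n.+1%:R * b ^+ n * (b - a))%:E)%E.
  rewrite Eb Ea KE -!EFinM -EFinB lee_fin.
  rewrite -mulrBl mulrC -!mulrA ler_pM//.
    by rewrite subr_ge0 lerXn2r ?nnegrE// ltW.
  by rewrite !mulrA ler_exprB// ltW.
rewrite measureD//; last exact: lebesgue_eball_fin.
rewrite setIidr; last by move=> x; rewrite /eball/= => /lt_le_trans; exact.
exact: H.
Qed.

End balls.

(** * The kernel of the operator *)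

Section dyadic.
Context {R : realType}.

(** The sets [A k] may overlap, so a dyadic decomposition can use whole balls, with their crude
    volume bound, in place of annuli. Points where [F] vanishes need not be covered, which disposes
    of the origin and of the complement of a domain of integration. *)
Lemma ge0_integral_cover_le d (T : measurableType d)
    (mu : {measure set T -> \bar R}) (F : T -> \bar R) (A : nat -> set T)
    (c : nat -> R) (B : R) :
  measurable_fun setT F -> (forall x, 0 <= F x)%E ->
  (forall k, measurable (A k)) -> (forall k, 0 <= c k) ->
  (forall x, F x = 0%E \/ exists k, A k x /\ (F x <= (c k)%:E)%E) ->
  (forall m, \sum_(k < m) (c k)%:E * mu (A k) <= B%:E)%E ->
  (\int[mu]_x F x <= B%:E)%E.
Proof.
move=> mF F0 mA c0 FA sB.
pose G k x := ((c k * \1_(A k) x)%:E).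
have G0 k x : (0 <= G k x)%E by rewrite lee_fin mulr_ge0.
have mG k : measurable_fun setT (G k).
  by apply/measurable_EFinP; apply: measurable_funM => //; exact: measurable_indic.
apply: (@le_trans _ _ (\int[mu]_x (\sum_(k <oo) G k x))%E).
  apply: ge0_le_integral => //.
  - by apply: ge0_emeasurable_sum => k x *; [exact: G0|exact: mG].
  - move=> x _; have [->|[k [Akx Fx]]] := FA x.
      by apply: nneseries_ge0 => k _ _; exact: G0.
    apply: le_trans (@nneseries_lim_ge _ _ xpredT 0 k.+1 _); last by [].
    rewrite big_nat_recr//= (le_trans Fx)// /G indicE mem_set// mulr1.
    rewrite -[X in (X <= _)%E]add0e; apply: leeD => //.
    by apply: sume_ge0 => i _; exact: (G0 i x).
rewrite integral_nneseries//.
apply: lime_le.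
  by apply: is_cvg_nneseries => k _ _; apply: integral_ge0 => x _; exact: G0.
apply: nearW => m; rewrite big_mkord; apply: le_trans (sB m).
apply: lee_sum => k _; rewrite /G.
under eq_integral do rewrite EFinM.
rewrite ge0_integralZl_EFin//; last first.
  by apply/measurable_EFinP; exact: measurable_indic.
by rewrite integral_indic// setIT.
Qed.

Lemma geometric_sumE (p : R) (m : nat) :
  (1 - p) * \sum_(k < m) p ^+ k = 1 - p ^+ m.
Proof.
rewrite -[X in X - p ^+ m](expr1n _ m) subrXX; congr (_ * _).
by apply: eq_bigr => i _; rewrite expr1n mul1r.
Qed.

Lemma sum_geometric_le (p : R) (m : nat) : 0 <= p -> p < 1 ->
  \sum_(k < m) p ^+ k <= (1 - p)^-1.
Proof.
move=> p0 p1; have q0 : 0 < 1 - p by rewrite subr_gt0.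
rewrite -[leRHS]mul1r ler_pdivlMr// mulrC.
rewrite geometric_sumE.
by rewrite lerBlDr lerDl exprn_ge0.
Qed.

(** The conditional inside the sum avoids comparing [k] with [m] in the partial sums of a series. *)
Lemma sum_geometric_tail_le (p : R) (m k : nat) : 0 <= p -> p < 1 ->
  \sum_(j < k) (if (m <= j)%N then p ^+ j else 0) <= p ^+ m / (1 - p).
Proof.
move=> p0 p1; elim: m k => [|m IHm] [|k].
- by rewrite big_ord0 expr0 mul1r invr_ge0 subr_ge0 ltW.
- by rewrite expr0 mul1r; exact: sum_geometric_le.
- by rewrite big_ord0 divr_ge0 ?exprn_ge0// subr_ge0 ltW.
rewrite big_ord_recl/= add0r exprS -mulrA; apply: le_trans (ler_wpM2l p0 (IHm k)).
rewrite mulr_sumr; apply: ler_sum => j _ /=.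
by rewrite /bump /= add1n ltnS; case: ifP => _; rewrite ?mulr0// exprS.
Qed.

Lemma exists_dyadic_ge1 (t : R) : 1 <= t -> exists j, 2 ^+ j <= t < 2 ^+ j.+1.
Proof.
move=> t1; have [N tN] : exists N, t < 2 ^+ N.
  exists (Num.trunc t).+1; apply: (lt_le_trans (truncnS_gt t)).
  by rewrite -natrX ler_nat ltnW// ltn_expl.
elim: N tN => [|N IHN] tN; first by rewrite expr0 ltNge t1 in tN.
have [/IHN//|tN'] := ltP t (2 ^+ N).
by exists N; rewrite tN' tN.
Qed.

Lemma exists_dyadic_lt1 (t : R) : 0 < t -> t < 1 ->
  exists j, 2^-1 ^+ j.+1 <= t < 2^-1 ^+ j.
Proof.
move=> t0 t1; have [] := @exists_dyadic_ge1 t^-1.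
  by rewrite invf_ge1// ltW.
move=> [|j] /andP[a b].
  exists 0%N; rewrite expr1 expr0 t1 andbT.
  by rewrite -[leRHS]invrK lef_pV2 ?posrE ?invr_gt0// ltW.
(* Inversion exchanges the closed and the open end of a dyadic interval, so an exact power of two
   moves to the neighbouring one. *)
have [e|ne] := eqVneq t^-1 (2 ^+ j.+1).
  exists j; rewrite -[t]invrK e exprVn lexx/= exprVn ltf_pV2 ?posrE ?exprn_gt0//.
  by rewrite ltr_eXn2l// ltr1n.
exists j.+1; rewrite !exprVn -[t]invrK lef_pV2 ?ltf_pV2 ?posrE ?exprn_gt0 ?invr_gt0//.
by rewrite (ltW b) /= lt_neqAle eq_sym ne.
Qed.

Lemma powRVn (a : R) (j : nat) (x : R) : 0 <= a -> (a ^+ j) `^ x = (a `^ x) ^+ j.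
Proof.
by move=> a0; rewrite -powR_mulrn// -powRrM mulrC powRrM powR_mulrn// powR_ge0.
Qed.

End dyadic.

(** * Dyadic estimates for a single power kernel *)

Section power_kernel.
Context {R : realType} (n : nat).
Let N := n.+1.
Implicit Types (h : 'rV[R]_n.+1) (s : R).

Lemma powRD_pos (t a b : R) : 0 < t -> t `^ (a + b) = t `^ a * t `^ b.
Proof. by move=> t0; apply: powRD; apply/implyP => _; rewrite gt_eqF. Qed.

Lemma measurable_power_kernel (a : R) :
  measurable_fun setT (fun h => (enorm h `^ a)^-1).
Proof.
rewrite (_ : (fun _ => _) = fun h => enorm h `^ (- a)); last first.
  by apply/funext => h; rewrite powRN.
apply: (measurableT_comp (measurable_powR _)).
exact: measurable_enorm.
Qed.

(** From $2^{-x} \le 1/(1 + x\ln 2)$, a form of $e^y \ge 1 + y$. With $x = 2 - 2s$ it shows that the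
    dyadic series near the origin blows up no faster than $1/(1-s)$. *)
Lemma powR_half_gap : exists2 C : R, 0 < C &
  forall x : R, 0 < x -> x <= 2 -> (1 - 2^-1 `^ x)^-1 <= C / x.
Proof.
have l2 : 0 < ln (2 : R) by rewrite ln_gt0// ltr1n.
exists ((1 + 2 * ln 2) / ln 2); first by rewrite divr_gt0// addr_gt0// mulr_gt0.
move=> x x0 x2; have xl : 0 < x * ln 2 by rewrite mulr_gt0.
have e : 2^-1 `^ x <= (1 + x * ln 2)^-1.
  rewrite -powR_inv1// -powRrM mulN1r powRN lef_pV2 ?posrE ?powR_gt0 ?addr_gt0//.
  by rewrite /powR gt_eqF// expR_ge1Dx.
have e2 : 1 - (1 + x * ln 2)^-1 = x * ln 2 / (1 + x * ln 2).
  by field; rewrite gt_eqF// addr_gt0.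
have gap : x * ln 2 / (1 + 2 * ln 2) <= 1 - 2^-1 `^ x.
  apply: (@le_trans _ _ (1 - (1 + x * ln 2)^-1)); last by rewrite lerD2l lerN2.
  rewrite e2 ler_pM2l// lef_pV2 ?posrE ?addr_gt0 ?mulr_gt0//.
  by rewrite lerD2l ler_pM2r.
have g0 : 0 < x * ln 2 / (1 + 2 * ln 2) by rewrite divr_gt0// addr_gt0// mulr_gt0.
rewrite (_ : _ / x = (x * ln 2 / (1 + 2 * ln 2))^-1).
  by rewrite lef_pV2 ?posrE// (lt_le_trans g0).
by field; rewrite !gt_eqF ?addr_gt0 ?mulr_gt0.
Qed.

(** On the shell $|h| \sim 2^{-k}$ the integrand is of order $2^{k(n+1)}2^{-k(2-2s)}$ and the volume
    of order $2^{-k(n+1)}$, which leaves a geometric series of ratio [q]. The explicit $1/(1-s)$ is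
    what the constant of the fractional Laplacian will compensate. *)
Lemma integral_kernel_near0 : exists2 C : R, 0 < C & forall s, 0 < s -> s < 1 ->
  (\int[lebesgue_rV n.+1]_(h in eball 1)
     (enorm h ^+ 2 / enorm h `^ (n.+1%:R + 2 * s))%:E <= (C / (1 - s))%:E)%E.
Proof.
have [C0 C00 gap] := powR_half_gap.
exists (4 ^+ N * C0 / 2); first by rewrite divr_gt0// mulr_gt0// exprn_gt0.
move=> s s0 s1; rewrite integral_mkcond.
pose q : R := 2^-1 `^ (2 - 2 * s).
have e0 : 0 < 2 - 2 * s by lra.
have q0 : 0 < q by rewrite powR_gt0.
have q1 : q < 1.
  by rewrite /q -powR_inv1// -powRrM mulN1r /powR gt_eqF// expR_lt1; rewrite mulNr oppr_lt0 mulr_gt0// ln_gt0// ltr1n.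
have sC : (1 - q)^-1 <= C0 / 2 / (1 - s).
  have := gap _ e0; rewrite (_ : C0 / (2 - 2 * s) = C0 / 2 / (1 - s)); last first.
    by field; rewrite (_ : 2 - 2 * s = 2 * (1 - s)) ?mulf_neq0 ?gt_eqF; lra.
  by apply; lra.
apply: (@ge0_integral_cover_le R _ _ (lebesgue_rV N) _ (fun k => @eball R N (2^-1 ^+ k))
   (fun k => 2 ^+ N * (2 ^+ N) ^+ k * q ^+ k)).
- apply/(measurable_restrictT _ _).1 => //; first exact: measurable_eball.
  apply: measurable_funTS; apply/measurable_EFinP; apply: measurable_funM.
    by apply: measurable_funX; exact: measurable_enorm.
  exact: measurable_power_kernel.
- by move=> h; apply: erestrict_ge0 => *; rewrite lee_fin divr_ge0 ?powR_ge0// sqr_ge0.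
- by move=> k; exact: measurable_eball.
- by move=> k; rewrite !mulr_ge0 ?exprn_ge0// ltW.
- move=> h; rewrite patchE; case: ifPn => [|_]; last by left.
  rewrite inE /eball/= => h1.
  have [->|hn0] := eqVneq h 0; first by left; rewrite enorm0 expr0n mul0r.
  have h0 : 0 < enorm h by rewrite enorm_gt0.
  right; have [j /andP[hj1 hj2]] := exists_dyadic_lt1 h0 h1.
  exists j; split => //; rewrite lee_fin.
  have -> : enorm h ^+ 2 / enorm h `^ (n.+1%:R + 2 * s) =
      enorm h `^ (2 - 2 * s) * (enorm h ^+ N)^-1.
    rewrite -!powR_mulrn ?enorm_ge0// -!powRN -!powRD_pos//; congr (_ `^ _).
    by rewrite /N; ring.
  rewrite mulrC; apply: ler_pM; rewrite ?powR_ge0 ?invr_ge0 ?exprn_ge0 ?enorm_ge0//.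
    rewrite -exprM mulnC exprM -exprMn -exprS -exprVn.
    by rewrite lerXn2r ?nnegrE ?invr_ge0 ?exprn_ge0 ?enorm_ge0// -[leRHS]invrK lef_pV2 ?posrE ?invr_gt0 ?exprn_gt0// -exprVn.
  rewrite /q -powRVn ?invr_ge0//; apply: ge0_ler_powR; rewrite ?nnegrE ?enorm_ge0 ?exprn_ge0 ?(ltW e0)//.
  exact: ltW.
- move=> m; apply: (@le_trans _ _ (\sum_(k < m) (4 ^+ N * q ^+ k)%:E)%E).
    apply: lee_sum => k _.
    have r0 : 0 < (2^-1 : R) ^+ k by rewrite exprn_gt0.
    apply: (le_trans (lee_wpmul2l _ (lebesgue_eball_le N r0))).
      by rewrite lee_fin !mulr_ge0 ?exprn_ge0// ltW.
    rewrite -EFinM lee_fin le_eqVlt; apply/orP; left; apply/eqP.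
    rewrite [(2 * _) ^+ _]exprMn -[(2^-1 ^+ k) ^+ N]exprM mulnC exprM exprVn.
    rewrite (_ : (4 : R) = 2 * 2); last by ring.
    rewrite exprMn [(2 ^- N) ^+ k]exprVn; set X : R := 2 ^+ N.
    have X0 : X ^+ k != 0 by rewrite !expf_neq0 ?pnatr_eq0.
    by field.
  rewrite sumEFin lee_fin -mulr_sumr -!mulrA ler_wpM2l ?exprn_ge0//.
  by rewrite mulrA; apply: le_trans sC; apply: sum_geometric_le => //; exact: ltW.
Qed.

(** On the shell $|h| \sim 2^j$ integrand times volume is of order $\min(2^j, 2^m)\,2^{-2 s_0 j}$,
    that is [q ^+ j] for [j < m]. Beyond, the cap leaves a series of ratio [p < 1], whose tail is of
    the order of [q ^+ m.-1], the last term of the sum; this requires [m] to be positive. *)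
Lemma integral_kernel_far (s0 : R) : 0 < s0 -> exists2 C : R, 0 < C &
  forall m : nat, (0 < m)%N ->
  (\int[lebesgue_rV n.+1]_(h in ~` eball 1)
     (Num.min (enorm h) (4 * 2 ^+ m) / enorm h `^ (n.+1%:R + 2 * s0))%:E <=
   (C * \sum_(j < m) (2 `^ (1 - 2 * s0)) ^+ j)%:E)%E.
Proof.
move=> s00; pose p : R := 2^-1 `^ (2 * s0); pose q : R := 2 `^ (1 - 2 * s0).
have p0 : 0 < p by rewrite powR_gt0.
have p1 : p < 1.
  by rewrite /p -powR_inv1// -powRrM mulN1r /powR gt_eqF// expR_lt1 mulNr oppr_lt0 !mulr_gt0// ln_gt0// ltr1n.
have qp : q = 2 * p.
  by rewrite /q /p powRD_pos// powRr1// -powR_inv1// -powRrM mulN1r.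
have q0 : 0 < q by rewrite qp mulr_gt0.
exists (4 ^+ N * (2 + 4 * q / (1 - p))).
  by rewrite mulr_gt0 ?exprn_gt0// addr_gt0// divr_gt0 ?mulr_gt0// subr_gt0.
move=> m m0; rewrite integral_mkcond.
pose b j : R := Num.min (2 ^+ j.+1) (4 * 2 ^+ m).
have b0 j : 0 <= b j by rewrite le_min !mulr_ge0 ?exprn_ge0.
apply: (@ge0_integral_cover_le R _ _ (lebesgue_rV N) _ (fun k => @eball R N (2 ^+ k.+1))
   (fun k => b k * ((2 ^+ N) ^+ k)^-1 * p ^+ k)).
- apply/(measurable_restrictT _ _).1 => //.
    by apply: measurableC; exact: measurable_eball.
  apply: measurable_funTS; apply/measurable_EFinP; apply: measurable_funM.
    by apply: measurable_minr => //; exact: measurable_enorm.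
  exact: measurable_power_kernel.
- move=> h; apply: erestrict_ge0 => *; rewrite lee_fin divr_ge0 ?powR_ge0//.
  by rewrite le_min enorm_ge0 mulr_ge0// exprn_ge0.
- by move=> k; exact: measurable_eball.
- by move=> k; rewrite !mulr_ge0 ?invr_ge0 ?exprn_ge0// ltW.
- move=> h; rewrite patchE; case: ifPn => [|_]; last by left.
  rewrite inE /eball/= => /negP; rewrite -leNgt => h1.
  have h0 : 0 < enorm h by exact: lt_le_trans h1.
  right; have [j /andP[hj1 hj2]] := exists_dyadic_ge1 h1.
  exists j; split => //; rewrite lee_fin -mulrA; apply: ler_pM.
  + by rewrite le_min enorm_ge0 mulr_ge0// exprn_ge0.
  + by rewrite invr_ge0 powR_ge0.
  + by rewrite le_min !ge_min (ltW hj2)/= lexx orbT.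
  + rewrite powRD_pos// invfM powR_mulrn ?enorm_ge0//.
    apply: ler_pM; rewrite ?invr_ge0 ?powR_ge0 ?exprn_ge0 ?enorm_ge0//.
      by rewrite -exprM mulnC exprM lef_pV2 ?posrE ?exprn_gt0// lerXn2r ?nnegrE ?exprn_ge0 ?enorm_ge0.
    rewrite -powRVn ?invr_ge0// -powRN -[2^-1 ^+ j]invrK -exprVn invrK.
    rewrite -[(2 ^+ j)^-1]powR_inv1 ?exprn_ge0// -powRrM mulN1r !powRN.
    rewrite lef_pV2 ?posrE ?powR_gt0 ?exprn_gt0//.
    by apply: ge0_ler_powR; rewrite ?nnegrE ?enorm_ge0 ?exprn_ge0 ?mulr_ge0// ltW.
- move=> k; apply: (@le_trans _ _ (\sum_(j < k) (4 ^+ N * (b j * p ^+ j))%:E)%E).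
    apply: lee_sum => j _.
    have r0 : 0 < (2 : R) ^+ j.+1 by rewrite exprn_gt0.
    apply: (le_trans (lee_wpmul2l _ (lebesgue_eball_le N r0))).
      by rewrite lee_fin !mulr_ge0 ?invr_ge0 ?exprn_ge0// ltW.
    rewrite -EFinM lee_fin le_eqVlt; apply/orP; left; apply/eqP.
    rewrite exprS !exprMn -[(2 ^+ j) ^+ N]exprM mulnC exprM.
    rewrite (_ : (4 : R) = 2 * 2); last by ring.
    rewrite exprMn; set X : R := 2 ^+ N.
    have X0 : X ^+ j != 0 by rewrite !expf_neq0 ?pnatr_eq0.
    by field.
  rewrite sumEFin lee_fin -mulr_sumr -!mulrA ler_wpM2l ?exprn_ge0//.
  apply: (@le_trans _ _ (\sum_(j < k) ((if (j < m)%N then 2 * q ^+ j else 0) +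
      4 * 2 ^+ m * (if (m <= j)%N then p ^+ j else 0)))).
    apply: ler_sum => j _; have [jm|mj] := ltnP j m.
      rewrite mulr0 addr0 qp exprMn mulrA ler_wpM2r ?exprn_ge0 ?(ltW p0)//.
      by rewrite -exprS ge_min lexx.
    by rewrite add0r ler_wpM2r ?exprn_ge0 ?(ltW p0)// ge_min lexx orbT.
  rewrite big_split/= [leRHS]mulrDl; apply: lerD.
    rewrite mulr_sumr; elim: k => [|k IHk].
      by rewrite big_ord0 sumr_ge0// => i _; rewrite mulr_ge0// exprn_ge0// ltW.
    have [km|mk] := ltnP k m; last by rewrite big_ord_recr/= ltnNge mk addr0.
    rewrite (eq_bigr (fun j : 'I_k.+1 => 2 * q ^+ j)); last first.
      by move=> j _; rewrite (leq_trans (ltn_ord j)).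
    rewrite -(subnKC km) big_split_ord/= lerDl.
    by apply: sumr_ge0 => i _; rewrite mulr_ge0// exprn_ge0// powR_ge0.
  rewrite -mulr_sumr.
  apply: (le_trans (ler_wpM2l _ (sum_geometric_tail_le m k (ltW p0) p1))).
    by rewrite mulr_ge0// exprn_ge0.
  have -> : 4 * 2 ^+ m * (p ^+ m / (1 - p)) = 4 * q / (1 - p) * q ^+ m.-1.
    have -> : 4 * q / (1 - p) * q ^+ m.-1 = 4 * q ^+ m / (1 - p).
      by rewrite -[in RHS](prednK m0) exprS; ring.
    by rewrite qp exprMn; ring.
  rewrite -[4 * q / _]mulrA; apply: ler_wpM2l.
    by rewrite mulr_ge0// divr_ge0 ?subr_ge0 ?ltW.
  by rewrite -(prednK m0) big_ord_recr/= lerDr sumr_ge0// => i _; rewrite exprn_ge0// ltW.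
Qed.

(** With [a = 1 - 2 * s0] the sum is $(q^m - 1)/(q - 1)$. The factor [a / (q - 1)] is positive for
    either sign of [a], and $(t^a - 1)/a$ increases in $t$, so [2 ^+ m] may be replaced by [r]. At
    $s_0 = 1/2$ the sum is [m], at most $\ln r/\ln 2$. *)
Lemma geometric_sum_Phi_le (s0 : R) : 0 < s0 -> exists2 C : R, 0 < C &
  forall (m : nat) (r : R), 2 ^+ m <= r ->
  r ^+ n * \sum_(j < m) (2 `^ (1 - 2 * s0)) ^+ j <= C * Phi n.+1 s0 r.
Proof.
move=> s00; rewrite /Phi /=.
have l2 : 0 < ln (2 : R) by rewrite ln_gt0// ltr1n.
have [->|s12] := eqVneq s0 (1 / 2).
  exists (ln 2)^-1; first by rewrite invr_gt0.
  move=> m r mr; have r1 : 1 <= r by rewrite (le_trans _ mr)// exprn_ege1// ler1n.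
  rewrite [leRHS]mulrCA; apply: ler_wpM2l; first by rewrite exprn_ge0// (le_trans _ r1).
  rewrite (_ : 1 - 2 * (1 / 2) = 0); last by field.
  rewrite powRr0; under eq_bigr do rewrite expr1n.
  rewrite sumr_const card_ord ler_pdivlMl// mulr_natr -lnXn//.
  by rewrite ler_ln ?posrE ?exprn_gt0// (lt_le_trans ltr01).
pose a := 1 - 2 * s0; pose q : R := 2 `^ a.
have a0 : a != 0.
  by apply: contra s12 => /eqP; rewrite /a => aE; apply/eqP; lra.
have q1 : q - 1 != 0.
  apply/negP => /eqP qE; have : q = 1 by lra.
  rewrite /q /powR gt_eqF// => /eqP; rewrite -[X in _ == X]expR0 => /eqP/expR_inj.
  by move/eqP; rewrite mulf_eq0 (negPf a0) gt_eqF.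
have aq : 0 < a / (q - 1).
  have [a_gt0|a_le0] := ltP 0 a.
    rewrite divr_gt0// subr_gt0 /q /powR gt_eqF// expR_gt1 mulr_gt0//.
  have a_lt0 : a < 0 by rewrite lt_neqAle a0.
  rewrite -mulrNN mulr_gt0 ?oppr_gt0// invr_lt0 subr_lt0.
  by rewrite /q /powR gt_eqF// expR_lt1 nmulr_rlt0.
exists (a / (q - 1)) => // m r mr.
have r1 : 1 <= r by rewrite (le_trans _ mr)// exprn_ege1// ler1n.
have r0 : 0 < r by exact: lt_le_trans r1.
rewrite [leRHS]mulrCA; apply: ler_wpM2l; first by rewrite exprn_ge0// ltW.
rewrite -/a -/q.
have -> : \sum_(j < m) q ^+ j = (q ^+ m - 1) / (q - 1).
  by apply: (mulfI q1); rewrite mulrCA divff// mulr1 -[q - 1]opprB mulNr geometric_sumE opprB.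
rewrite (_ : (q ^+ m - 1) / (q - 1) = a / (q - 1) * ((q ^+ m - 1) / a)); last first.
  by field; rewrite a0.
apply: ler_wpM2l; first exact: ltW.
rewrite /q -powRVn//.
have [a_gt0|a_le0] := ltP 0 a.
  rewrite ler_wpM2r ?invr_ge0 ?(ltW a_gt0)// lerD2r.
  by apply: ge0_ler_powR; rewrite ?nnegrE ?exprn_ge0 ?(ltW a_gt0) ?(ltW r0).
have a_lt0 : a < 0 by rewrite lt_neqAle a0.
rewrite ler_nM2r ?invr_lt0// lerD2r -[a]opprK (powRN (2 ^+ m) (- a)) (powRN r (- a)).
rewrite lef_pV2 ?posrE ?powR_gt0 ?exprn_gt0//.
by apply: ge0_ler_powR; rewrite ?nnegrE ?exprn_ge0 ?oppr_ge0 ?(ltW r0).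
Qed.

End power_kernel.

(** * The Gamma function and the constant of the fractional Laplacian *)

Section gamma_function.
Context {R : realType}.
Implicit Types a b t s : R.
Local Notation lam := (@lebesgue_measure R).

Definition gamma_integrand a : R -> \bar R :=
  (fun t => (t `^ (a - 1) * expR (- t))%:E) \_ `]0, +oo[%classic.

Lemma gamma_integrand_ge0 a t : (0 <= gamma_integrand a t)%E.
Proof.
by apply: erestrict_ge0 => x _; rewrite lee_fin mulr_ge0 ?powR_ge0 ?expR_ge0.
Qed.

Lemma GammaE a : Gamma a = fine (\int[lam]_t gamma_integrand a t)%E.
Proof. by rewrite /Gamma /Rintegral integral_mkcond. Qed.

(** Joint measurability in the exponent and the variable, by writing the power with [expR] and [ln].
    It makes [Gamma], and then [frac_const], measurable in $s$, as Tonelli with [mu] requires. *)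
Lemma measurable_gamma_integrand d (T : measurableType d) (f g : T -> R) :
  measurable_fun setT f -> measurable_fun setT g ->
  measurable_fun setT (fun x => gamma_integrand (f x) (g x)).
Proof.
move=> mf mg.
rewrite (_ : (fun x => _) = (fun x => ((\1_(`]0, +oo[%classic : set R) \o g) x *
    (expR ((f x - 1) * ln (g x)) * expR (- g x)))%:E)); last first.
  apply/funext => x; rewrite /gamma_integrand patchE /= indicE.
  case: ifPn => [|_]; last by rewrite mul0r.
  by rewrite inE /= in_itv/= andbT => g0; rewrite mul1r /powR gt_eqF.
apply/measurable_EFinP; apply: measurable_funM.
  by apply: measurableT_comp => //; exact: measurable_indic.
apply: measurable_funM.
  apply: (measurableT_comp (@measurable_expR R)); apply: measurable_funM.
    exact: measurable_funB.
  exact: (measurableT_comp (@measurable_ln R)).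
by apply: (measurableT_comp (@measurable_expR R)); exact: measurableT_comp.
Qed.

Lemma measurable_Gamma : measurable_fun setT (@Gamma R).
Proof.
rewrite (_ : Gamma = fine \o (fun a => \int[lam]_t gamma_integrand a t)%E); last first.
  by apply/funext => a; rewrite GammaE.
apply: (measurableT_comp (@fine_measurable R setT measurableT)).
apply: (@measurable_integralr _ _ (measurableTypeR R) (measurableTypeR R) R lam) => /=.
  exact: measurable_gamma_integrand.
by move=> x y; exact: gamma_integrand_ge0.
Qed.

Lemma expRN_le_pow (M : nat) t : 0 < t -> expR (- t) <= M.+1%:R ^+ M.+1 / t ^+ M.+1.
Proof.
move=> t0; rewrite expRN -[leRHS]invrK lef_pV2 ?posrE ?expR_gt0 ?invr_gt0 ?divr_gt0 ?exprn_gt0//.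
rewrite invfM invrK mulrC -expr_div_n.
have -> : expR t = expR (t / M.+1%:R) ^+ M.+1.
  by rewrite -expRM_natl mulrC divfK// pnatr_eq0.
rewrite lerXn2r ?nnegrE ?expR_ge0 ?divr_ge0 ?(ltW t0)//.
by apply: le_trans (expR_ge1Dx _); rewrite lerDr.
Qed.

(** The bound is uniform in the exponent. Below 1 the power is dominated by the one with the
    smallest exponent [a]; above 1 it is at most $t^M$ with an integer $M \ge b$, and $e^{-t} \le K
    t^{-M-2}$. Both halves then become dyadic series. *)
Lemma gamma_integral_le a b : 0 < a -> exists2 C : R, 0 < C &
  forall x, a <= x <= b -> (\int[lam]_t gamma_integrand x t <= C%:E)%E.
Proof.
move=> a0.
have [M bM] : exists M : nat, b <= M%:R.
  exists (Num.trunc `|b|).+1; apply: (le_trans (ler_norm b)).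
  by rewrite ltW// truncnS_gt.
pose p : R := 2^-1 `^ a.
have p0 : 0 < p by rewrite powR_gt0.
have p1 : p < 1.
  by rewrite /p -powR_inv1// -powRrM mulN1r /powR gt_eqF// expR_lt1 mulNr oppr_lt0 !mulr_gt0// ln_gt0// ltr1n.
pose K : R := M.+2%:R ^+ M.+2.
have K0 : 0 < K by rewrite exprn_gt0.
exists (2 / (1 - p) + K * 2).
  have q0 : 0 < 1 - p by rewrite subr_gt0.
  apply: addr_gt0; first exact: divr_gt0.
  exact: mulr_gt0.
move=> x /andP[ax xb].
have mx : measurable_fun setT (gamma_integrand x) by exact: measurable_gamma_integrand.
pose D : set R := `]-oo, 1[%classic.
have mD : measurable D by exact: measurable_itv.
rewrite -[X in (\int[lam]_(t in X) _)%E](setUv D) ge0_integral_setU//; last 4 first.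
- exact: measurableC.
- exact: measurable_funTS.
- by move=> *; exact: gamma_integrand_ge0.
- by apply/disj_set2P; rewrite setICr.
rewrite EFinD; apply: leeD; rewrite integral_mkcond.
- apply: (@ge0_integral_cover_le R _ _ lam _ (fun k => `]0, 2^-1 ^+ k[%classic)
     (fun k => 2 ^+ k.+1 * p ^+ k)).
  + apply/(measurable_restrictT _ _).1 => //; exact: measurable_funTS.
  + by move=> t; apply: erestrict_ge0 => *; exact: gamma_integrand_ge0.
  + by move=> k; exact: measurable_itv.
  + by move=> k; rewrite mulr_ge0 ?exprn_ge0// ltW.
  + move=> t; rewrite /gamma_integrand !patchE; case: ifPn => [|_]; last by left.
    rewrite /D inE/= in_itv/= => t1; case: ifPn => [|_]; last by left.
    rewrite inE/= in_itv/= andbT => t0; right.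
    have [j /andP[hj1 hj2]] := exists_dyadic_lt1 t0 t1.
    exists j; split; first by rewrite /= in_itv/= t0.
    rewrite lee_fin addrC powRD_pos// powR_inv1 ?(ltW t0)//.
    rewrite -mulrA; apply: ler_pM.
    * by rewrite invr_ge0 ltW.
    * by rewrite mulr_ge0 ?powR_ge0 ?expR_ge0.
    * by rewrite -[leRHS]invrK lef_pV2 ?posrE ?invr_gt0 ?exprn_gt0// -exprVn.
    * apply: (@le_trans _ _ (t `^ x)).
        by rewrite ler_piMr ?powR_ge0// -[leRHS]expR0 ler_expR oppr_le0 ltW.
      apply: (@le_trans _ _ (t `^ a)).
        by apply: ger_powR => //; rewrite t0/= ltW.
      rewrite /p -powRVn ?invr_ge0//; apply: ge0_ler_powR; rewrite ?nnegrE ?exprn_ge0 ?(ltW t0) ?(ltW a0)//.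
      exact: ltW.
  + move=> m; apply: (@le_trans _ _ (\sum_(k < m) (2 * p ^+ k)%:E)%E).
      apply: lee_sum => k _; rewrite [X in (_ * X)%E](_ : _ = (2^-1 ^+ k)%:E); last first.
        by apply: etrans (lebesgue_measure_itv _) _; rewrite /= lte_fin exprn_gt0// -EFinB subr0.
      rewrite -EFinM lee_fin exprS -!mulrA ler_wpM2l// mulrCA.
      by rewrite -exprMn divff ?pnatr_eq0// expr1n mulr1.
    by rewrite sumEFin lee_fin -mulr_sumr ler_wpM2l// sum_geometric_le// ltW.
- apply: (@ge0_integral_cover_le R _ _ lam _ (fun k => `[2 ^+ k, 2 ^+ k.+1[%classic)
     (fun k => K * (2 ^+ k * 2 ^+ k)^-1)).
  + apply/(measurable_restrictT _ _).1; first exact: measurableC.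
    exact: measurable_funTS.
  + by move=> t; apply: erestrict_ge0 => *; exact: gamma_integrand_ge0.
  + by move=> k; exact: measurable_itv.
  + by move=> k; rewrite mulr_ge0 ?(ltW K0)// invr_ge0 mulr_ge0 ?exprn_ge0.
  + move=> t; rewrite /gamma_integrand !patchE; case: ifPn => [|_]; last by left.
    rewrite inE /D/= in_itv/= => /negP; rewrite -leNgt => t1.
    have t0 : 0 < t by exact: lt_le_trans t1.
    rewrite ifT; last by rewrite inE/= in_itv/= andbT.
    right; have [j /andP[hj1 hj2]] := exists_dyadic_ge1 t1.
    exists j; split; first by rewrite /= in_itv/= hj1.
    rewrite lee_fin.
    apply: (@le_trans _ _ (t ^+ M * (K / t ^+ M.+2))).
      apply: ler_pM; rewrite ?powR_ge0 ?expR_ge0//; last exact: expRN_le_pow.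
      rewrite -powR_mulrn ?(ltW t0)//; apply: ler_powR => //.
      by rewrite (le_trans _ bM)// (le_trans _ xb)// lerBlDr lerDl.
    have -> : t ^+ M * (K / t ^+ M.+2) = K * (t * t)^-1.
      by rewrite !exprS; field; rewrite expf_neq0 gt_eqF.
    rewrite ler_wpM2l ?(ltW K0)// lef_pV2 ?posrE ?mulr_gt0 ?exprn_gt0//.
    by rewrite ler_pM ?exprn_ge0.
  + move=> m; apply: (@le_trans _ _ (\sum_(k < m) (K * 2^-1 ^+ k)%:E)%E).
      apply: lee_sum => k _.
      rewrite [X in (_ * X)%E](_ : _ = (2 ^+ k.+1 - 2 ^+ k)%:E); last first.
        apply: etrans (lebesgue_measure_itv _) _.
        by rewrite /= lte_fin ltr_eXn2l ?ltr1n// ltnSn -EFinB.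
      rewrite -EFinM lee_fin.
      rewrite le_eqVlt; apply/orP; left; apply/eqP.
      by rewrite exprS exprVn; field; rewrite expf_neq0 ?pnatr_eq0.
    rewrite sumEFin lee_fin -mulr_sumr; apply: ler_wpM2l; first exact: ltW.
    have h1 : (2^-1 : R) < 1 by rewrite invf_lt1 ?ltr1n.
    apply: (le_trans (sum_geometric_le m _ h1)); first by rewrite invr_ge0.
    by rewrite le_eqVlt; apply/orP; left; apply/eqP; field.
Qed.

Lemma Gamma_le a b : 0 < a -> exists2 C : R, 0 < C &
  forall x, a <= x <= b -> 0 <= Gamma x <= C.
Proof.
move=> a0; have [C C0 HC] := gamma_integral_le b a0.
exists C => // x xab; have I0 : (0 <= \int[lam]_t gamma_integrand x t)%E.
  by apply: integral_ge0 => t _; exact: gamma_integrand_ge0.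
rewrite GammaE fine_ge0//= -lee_fin fineK ?HC//.
by rewrite ge0_fin_numE// (le_lt_trans (HC x xab)) ?ltry.
Qed.

(** The integral is restricted to $1 \le t \le 2$, where $t^{x-1} \ge 1$ and $e^{-t} \ge e^{-2}$. *)
Lemma Gamma_ge : exists2 c : R, 0 < c & forall x, 1 <= x <= 2 -> c <= Gamma x.
Proof.
exists (expR (-2)); first exact: expR_gt0.
move=> x /andP[x1 x2]; have [C C0 HC] := gamma_integral_le 2 (@ltr01 R).
have mx : measurable_fun setT (gamma_integrand x) by exact: measurable_gamma_integrand.
have I0 : (0 <= \int[lam]_t gamma_integrand x t)%E.
  by apply: integral_ge0 => t _; exact: gamma_integrand_ge0.
rewrite GammaE -lee_fin fineK; last first.
  by rewrite ge0_fin_numE// (le_lt_trans (HC x _)) ?ltry// x1.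
apply: (@le_trans _ _ (\int[lam]_(t in `[1%R, 2%R]) (expR (-2))%:E)%E).
  have E : lam `[1%R, 2%R]%classic = 1%E.
    rewrite lebesgue_measure_itv/= lte_fin ltr1n -EFinB; congr EFin; ring.
  rewrite integral_cst//; apply: (@le_trans _ _ ((expR (-2))%:E * lam `[1%R, 2%R]%classic)%E) => //.
  by rewrite E mule1.
apply: (@le_trans _ _ (\int[lam]_(t in `[1%R, 2%R]) gamma_integrand x t)%E).
  apply: ge0_le_integral => //.
  - exact: measurable_funTS.
  - move=> t /=; rewrite in_itv/= => /andP[t1 t2].
    have t0 : 0 < t by exact: lt_le_trans t1.
    rewrite /gamma_integrand patchE ifT; last by rewrite inE/= in_itv/= andbT.
    rewrite lee_fin -[leLHS]mul1r ler_pM ?expR_ge0// ?ler_expR ?lerN2//.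
    by rewrite -[leLHS](powRr0 t) ler_powR// subr_ge0.
apply: ge0_subset_integral => //.
by move=> *; exact: gamma_integrand_ge0.
Qed.

Lemma measurable_frac_const n : measurable_fun setT (@frac_const R n).
Proof.
rewrite /frac_const.
have maff (a b : R) : measurable_fun setT (fun s => a + b * s) by exact: measurable_affine.
apply: measurable_funM; last first.
  by apply: measurable_funM => //; exact: measurable_funB.
apply: measurable_funM.
  apply: measurable_funM => //; apply: (measurableT_comp (measurable_powRr _)).
  exact: measurable_funM.
have mG (f : R -> R) : measurable_fun setT f -> measurable_fun setT (fun s => Gamma (f s)).
  by move=> mf; exact: (measurableT_comp measurable_Gamma).
apply: measurable_funM.
  by apply: mG; apply: measurable_funM => //; exact: maff.
rewrite (_ : (fun s => _) = fun s => Gamma (2 - s) `^ (-1)); last first.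
  apply/funext => s; rewrite powR_inv1// GammaE fine_ge0//.
  by apply: integral_ge0 => t _; exact: gamma_integrand_ge0.
apply: (measurableT_comp (measurable_powR _)); apply: mG.
exact: measurable_funB.
Qed.

(** [Gamma] is bounded above at $(n+2s)/2 \in [s_0, n+1]$ and below at $2-s \in [1,2]$. The factor
    [1 - s] is kept in the bound: it compensates the integral of the kernel near the diagonal and
    makes everything vanish at [s = 1]. *)
Lemma frac_const_bounds n (s0 : R) : 0 < s0 -> exists2 K : R, 0 < K &
  forall s, s0 <= s <= 1 -> 0 <= frac_const n s <= K * (1 - s).
Proof.
move=> s00.
have [C C0 HC] := @Gamma_le s0 (n%:R + 1) s00.
have [c c0 Hc] := Gamma_ge.
pose P : R := pi `^ (- (n%:R / 2)).
have P0 : 0 < P by rewrite powR_gt0// pi_gt0.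
exists (P * 4 * (C / c)); first by rewrite !mulr_gt0 ?invr_gt0.
move=> s /andP[s0s s1]; have s_gt0 : 0 < s by exact: lt_le_trans s0s.
have /andP[G0 GC] : 0 <= Gamma ((n%:R + 2 * s) / 2) <= C.
  apply: HC; have n0 : 0 <= n%:R :> R by [].
  by apply/andP; split; lra.
have cG : c <= Gamma (2 - s) by apply: Hc; apply/andP; split; lra.
have G20 : 0 < Gamma (2 - s) by exact: lt_le_trans cG.
have s1' : 0 <= 1 - s by rewrite subr_ge0.
rewrite /frac_const -/P.
move: (Gamma _) (Gamma _) G0 GC cG G20 => g1 g2 G0 GC cG G20; apply/andP; split.
  by rewrite !mulr_ge0 ?powR_ge0 ?invr_ge0 ?(ltW P0) ?(ltW s_gt0) ?(ltW G20).
rewrite [leRHS](_ : _ = P * 4 * (C / c) * (1 * (1 - s))); last by rewrite mul1r.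
apply: ler_pM.
- by rewrite !mulr_ge0 ?powR_ge0 ?invr_ge0 ?(ltW P0) ?(ltW G20).
- by rewrite mulr_ge0// ltW.
- apply: ler_pM.
  + by rewrite mulr_ge0 ?powR_ge0 ?(ltW P0).
  + by rewrite divr_ge0// ltW.
  + rewrite ler_wpM2l ?(ltW P0)//.
    rewrite (_ : 4 = 2 `^ 2); last by rewrite powR_mulrn// expr2; ring.
    by rewrite ler_powR ?ler1n//; lra.
  + by rewrite ler_pM ?invr_ge0 ?(ltW G20)// lef_pV2 ?posrE.
- by rewrite ler_wpM2r.
Qed.

End gamma_function.

(** * The kernel averaged over the exponents *)

Section levy_kernel.
Context {R : realType} (n : nat).
Local Notation V := 'rV[R]_n.+1.
Local Notation lam := (lebesgue_rV n.+1).
Variables (mu : probability (measurableTypeR R) R) (s0 : R).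
Hypothesis s0_gt0 : 0 < s0.
Let D : set R := `[s0, 1]%classic.

(* The power of |h| is written with expR and ln, which makes joint measurability in
   (s, h) immediate; at h = 0 the indicator restores the junk value 0 of 1 / 0. *)
Definition frac_density (s : R) (h : V) : R :=
  (\1_D s * (frac_const n.+1 s / 4)) *
  (\1_(~` [set 0]) h * expR (- (n.+1%:R + 2 * s) * ln (enorm h))).

Lemma frac_densityE s h : D s ->
  frac_density s h = frac_const n.+1 s / 4 / enorm h `^ (n.+1%:R + 2 * s).
Proof.
move=> Ds; rewrite /frac_density !indicE mem_set// mul1r; congr (_ * _).
have sp : 0 < n.+1%:R + 2 * s.
  move: Ds; rewrite /D/= in_itv/= => /andP[ss _].
  by rewrite addr_gt0// mulr_gt0// (lt_le_trans s0_gt0).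
have [->|h0] := eqVneq h 0.
  by rewrite memNset ?mul0r ?enorm0 ?powR0 ?invr0 ?gt_eqF//=; apply.
rewrite mem_set/=; last exact/eqP.
by rewrite mul1r /powR enorm_eq0 (negPf h0) mulNr expRN.
Qed.

Lemma frac_density_out s h : ~ D s -> frac_density s h = 0.
Proof. by move=> Ds; rewrite /frac_density indicE memNset// !mul0r. Qed.

Lemma frac_const_ge0 s : D s -> 0 <= frac_const n.+1 s.
Proof.
have [K _ HK] := frac_const_bounds n.+1 s0_gt0.
by rewrite /D /= in_itv/= => /HK/andP[].
Qed.

Lemma frac_density_ge0 s h : 0 <= frac_density s h.
Proof.
apply: mulr_ge0; last by apply: mulr_ge0 => //; exact: expR_ge0.
have [Ds|Ds] := pselect (D s); last by rewrite indicE memNset ?mul0r.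
by rewrite mulr_ge0// divr_ge0// frac_const_ge0.
Qed.

Lemma frac_densityN s h : frac_density s (- h) = frac_density s h.
Proof.
have [Ds|Ds] := pselect (D s); last by rewrite !frac_density_out.
by rewrite (frac_densityE _ Ds) (frac_densityE h Ds) enormN.
Qed.

Lemma measurable_rV_neq0 : measurable (~` [set 0] : set V).
Proof.
rewrite (_ : ~` _ = (@enorm R n.+1) @^-1` `]0, +oo[).
  rewrite -[X in measurable X]setTI.
  by apply: (measurable_enorm (@measurable_id _ _ setT)).
apply/seteqP; split => h /=; rewrite in_itv/= andbT enorm_gt0.
  by move=> h0; apply/eqP.
by move/eqP.
Qed.

Lemma measurable_frac_density d (T : measurableType d) (f : T -> measurableTypeR R) (g : T -> V) :
  measurable_fun setT f -> measurable_fun setT g ->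
  measurable_fun setT (fun x => frac_density (f x) (g x)).
Proof.
move=> mf mg; rewrite /frac_density; apply: measurable_funM.
  have mc : measurable_fun setT
      (fun s : measurableTypeR R => \1_D s * (frac_const n.+1 s / 4)).
    apply: measurable_funM; first by apply: measurable_indic; exact: measurable_itv.
    by apply: measurable_funM => //; exact: measurable_frac_const.
  exact: (measurableT_comp mc mf).
apply: measurable_funM.
  by apply: (measurableT_comp (measurable_indic measurable_rV_neq0)).
apply: (measurableT_comp (@measurable_expR R)); apply: measurable_funM.
  by apply: measurableT_comp => //; apply: measurable_funD => //; exact: measurable_funM.
by apply: (measurableT_comp (@measurable_ln R)); exact: measurable_enorm.
Qed.

Definition levy_kernel (h : V) : R := fine (\int[mu]_s (frac_density s h)%:E).

Lemma Rintegral_frac_density h : \int[mu]_s frac_density s h = levy_kernel h.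
Proof. by []. Qed.

Lemma measurable_levy_kernel : measurable_fun setT levy_kernel.
Proof.
apply: (measurableT_comp (@fine_measurable R setT measurableT)).
apply: (@measurable_integrall _ _ _ _ R mu (fun s h => (frac_density s h)%:E)) => /=.
  by apply/measurable_EFinP; exact: measurable_frac_density.
by move=> s h; rewrite lee_fin frac_density_ge0.
Qed.

Lemma levy_kernel_ge0 h : 0 <= levy_kernel h.
Proof.
by apply: fine_ge0; apply: integral_ge0 => s _; rewrite lee_fin frac_density_ge0.
Qed.

Lemma levy_kernelN h : levy_kernel (- h) = levy_kernel h.
Proof. by rewrite /levy_kernel; under eq_integral do rewrite frac_densityN. Qed.

Lemma integral_prob_le (f : R -> \bar R) (B : R) : 0 <= B ->
  measurable_fun setT (f : measurableTypeR R -> \bar R) ->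
  (forall s, 0 <= f s)%E -> (forall s, f s <= B%:E)%E -> (\int[mu]_s f s <= B%:E)%E.
Proof.
move=> B0 mf f0 fB; apply: (@le_trans _ _ (\int[mu]_s B%:E)%E).
  by apply: ge0_le_integral.
rewrite integral_cst// [X in (_ * X)%E](_ : _ = 1%E) ?mule1//.
exact: probability_setT.
Qed.

(** For fixed [h] the densities are bounded by [B] uniformly in [s], so the average is finite and
    [fine] loses nothing. *)
Lemma levy_kernelE h : (levy_kernel h)%:E = (\int[mu]_s (frac_density s h)%:E)%E.
Proof.
rewrite /levy_kernel fineK//.
have I0 : (0 <= \int[mu]_s (frac_density s h)%:E)%E.
  by apply: integral_ge0 => s _; rewrite lee_fin frac_density_ge0.
rewrite ge0_fin_numE//.
have [K K0 HK] := frac_const_bounds n.+1 s0_gt0.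
pose B := K / 4 * expR ((n.+1%:R + 2) * `|ln (enorm h)|).
have B0 : 0 <= B by rewrite mulr_ge0 ?expR_ge0// divr_ge0// ltW.
apply: (le_lt_trans (@integral_prob_le _ B B0 _ _ _)); last exact: ltry.
- by apply/measurable_EFinP; exact: measurable_frac_density.
- by move=> s; rewrite lee_fin frac_density_ge0.
- move=> s; rewrite lee_fin; have [Ds|Ds] := pselect (D s); last by rewrite frac_density_out.
  rewrite /frac_density indicE mem_set// mul1r.
  move: (Ds); rewrite /D/= in_itv/= => /andP[ss s1].
  apply: ler_pM.
  + by rewrite divr_ge0// frac_const_ge0.
  + by rewrite mulr_ge0 ?expR_ge0.
  + rewrite ler_wpM2r//; have /andP[_] : 0 <= frac_const n.+1 s <= K * (1 - s).
      by apply: HK; rewrite ss.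
    move=> /le_trans; apply; rewrite ler_piMr ?(ltW K0)//.
    by rewrite lerBlDr lerDl (le_trans _ ss)// ltW.
  + rewrite -[leRHS]mul1r; apply: ler_pM; rewrite ?expR_ge0//.
    rewrite ler_expR (le_trans (ler_norm _))// normrM normrN.
    rewrite ler_wpM2r// ger0_norm.
      by rewrite lerD2l ler_piMr.
    by rewrite addr_ge0// mulr_ge0// (le_trans _ ss)// ltW.
Qed.

Lemma levy_integralE (F : V -> R) : measurable_fun setT F -> (forall h, 0 <= F h) ->
  (\int[lam]_h (F h * levy_kernel h)%:E =
   \int[mu]_s \int[lam]_h (F h * frac_density s h)%:E)%E.
Proof.
move=> mF F0.
rewrite (@integral_exchange _ _ _ _ _ mu lam (fun s h => (F h * frac_density s h)%:E))//=.
- apply: eq_integral => h _; rewrite EFinM levy_kernelE -ge0_integralZl_EFin//.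
  + by move=> s _; rewrite lee_fin frac_density_ge0.
  + by apply/measurable_EFinP; exact: measurable_frac_density.
- apply/measurable_EFinP; apply: measurable_funM.
    exact: (measurableT_comp mF).
  exact: measurable_frac_density.
- by move=> s h; rewrite lee_fin mulr_ge0// frac_density_ge0.
Qed.

End levy_kernel.

Section levy_kernel_bounds.
Context {R : realType} (n : nat) (s0 : R).
Hypothesis s0_gt0 : 0 < s0.
Local Notation V := 'rV[R]_n.+1.
Local Notation lam := (lebesgue_rV n.+1).

Lemma measurable_eball_indic r d (T : measurableType d) (f : T -> V) :
  measurable_fun setT f -> measurable_fun setT (fun x => \1_(eball r) (f x) : R).
Proof.
by move=> mf; apply: (measurableT_comp (measurable_indic (@measurable_eball R n.+1 r))).
Qed.

(** The bound is uniform in [mu]: for each [s < 1] the factor [K * (1 - s)] of the constant cancels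
    the [C / (1 - s)] of the kernel before averaging, and at [s = 1] the constant is zero. *)
Lemma integral_levy_near0 : exists2 C : R, 0 < C &
  forall mu : probability (measurableTypeR R) R,
  (\int[lam]_h (\1_(eball 1) h * enorm h ^+ 2 * levy_kernel mu s0 h)%:E <= C%:E)%E.
Proof.
have [K K0 HK] := frac_const_bounds n.+1 s0_gt0.
have [C C0 HC] := @integral_kernel_near0 R n.
exists (K / 4 * C); first by rewrite mulr_gt0// divr_gt0.
move=> mu.
have mF : measurable_fun setT (fun h : V => \1_(eball 1) h * enorm h ^+ 2).
  apply: measurable_funM; first exact: measurable_eball_indic.
  by apply: measurable_funX; exact: measurable_enorm.
rewrite levy_integralE//; last by move=> h; rewrite mulr_ge0// sqr_ge0.
apply: integral_prob_le.
- by rewrite !mulr_ge0// ?divr_ge0// ltW.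
- apply: (@measurable_integralr _ _ _ _ R lam
    (fun s h => (\1_(eball 1) h * enorm h ^+ 2 * frac_density s0 s h)%:E)) => /=.
    apply/measurable_EFinP; apply: measurable_funM; last exact: measurable_frac_density.
    exact: (measurableT_comp mF).
  move=> s h; rewrite lee_fin; apply: mulr_ge0; last exact: frac_density_ge0.
  by apply: mulr_ge0 => //; exact: sqr_ge0.
- move=> s; apply: integral_ge0 => h _.
  rewrite lee_fin; apply: mulr_ge0; last exact: frac_density_ge0.
  by apply: mulr_ge0 => //; exact: sqr_ge0.
move=> s.
have KC0 : 0 <= K / 4 * C by rewrite !mulr_ge0// ?divr_ge0// ltW.
have [Ds|Ds] := pselect (`[s0, 1]%classic s); last first.
  by under eq_integral do rewrite frac_density_out// mulr0; rewrite integral0.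
move: (Ds); rewrite /= in_itv/= => /andP[ss s1].
have sp : 0 < s by exact: lt_le_trans ss.
have /andP[c0 cK] : 0 <= frac_const n.+1 s <= K * (1 - s) by apply: HK; rewrite ss.
have [s1'|] := ltP s 1; last first.
  move=> s1''; have s1E : s = 1 by apply/eqP; rewrite eq_le s1.
  have c00 : frac_const n.+1 s = 0.
    by apply/eqP; rewrite eq_le c0 andbT (le_trans cK)// s1E subrr mulr0.
  under eq_integral => h _ do rewrite frac_densityE// c00 !mul0r mulr0.
  by rewrite integral0.
have := HC s sp s1'; rewrite integral_mkcond => HC'.
rewrite (eq_integral (fun h => (frac_const n.+1 s / 4)%:E *
  ((fun h : V => (enorm h ^+ 2 / enorm h `^ (n.+1%:R + 2 * s))%:E) \_ (eball 1)) h)%E); last first.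
  move=> h _; rewrite frac_densityE// patchE indicE; case: ifPn => _.
    by rewrite mul1r -EFinM; congr EFin; ring.
  by rewrite !mul0r mule0.
rewrite ge0_integralZl_EFin//; first last.
- by rewrite divr_ge0.
- apply/(measurable_restrictT _ _).1 => //; first exact: measurable_eball.
  apply: measurable_funTS; apply/measurable_EFinP; apply: measurable_funM.
    by apply: measurable_funX; exact: measurable_enorm.
  exact: measurable_power_kernel.
- by move=> h _; apply: erestrict_ge0 => *; rewrite lee_fin divr_ge0 ?sqr_ge0 ?powR_ge0.
apply: (@le_trans _ _ ((frac_const n.+1 s / 4)%:E * (C / (1 - s))%:E)%E).
  by apply: lee_wpmul2l => //; rewrite lee_fin divr_ge0.
rewrite -EFinM lee_fin.
have q0 : 0 < 1 - s by rewrite subr_gt0.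
have -> : K / 4 * C = (K * (1 - s)) / 4 * (C / (1 - s)) by field; rewrite gt_eqF.
by rewrite ler_wpM2r ?divr_ge0 ?(ltW C0) ?(ltW q0)// ler_wpM2r.
Qed.

(** For $|h| \ge 1$ the slowest decay is that of the smallest exponent [s0]. *)
Lemma levy_kernel_far : exists2 C : R, 0 < C &
  forall (mu : probability (measurableTypeR R) R) (h : V), 1 <= enorm h ->
  levy_kernel mu s0 h <= C / enorm h `^ (n.+1%:R + 2 * s0).
Proof.
have [K K0 HK] := frac_const_bounds n.+1 s0_gt0.
exists (K / 4); first by rewrite divr_gt0.
move=> mu h h1; rewrite -lee_fin levy_kernelE//.
have B0 : 0 <= K / 4 / enorm h `^ (n.+1%:R + 2 * s0).
  by rewrite divr_ge0 ?powR_ge0// divr_ge0// ltW.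
apply: integral_prob_le => //.
- by apply/measurable_EFinP; exact: measurable_frac_density.
- by move=> s; rewrite lee_fin frac_density_ge0.
move=> s; rewrite lee_fin.
have [Ds|Ds] := pselect (`[s0, 1]%classic s); last by rewrite frac_density_out.
rewrite frac_densityE//; move: Ds; rewrite /= in_itv/= => /andP[ss s1].
have h0 : 0 < enorm h by exact: lt_le_trans h1.
have /andP[c0 cK] : 0 <= frac_const n.+1 s <= K * (1 - s) by apply: HK; rewrite ss.
apply: ler_pM; rewrite ?invr_ge0 ?powR_ge0 ?divr_ge0//.
  rewrite ler_wpM2r// (le_trans cK)// ler_piMr ?(ltW K0)//.
  by rewrite lerBlDr lerDl (le_trans _ ss)// ltW.
rewrite lef_pV2 ?posrE ?powR_gt0//; apply: ler_powR => //.
by rewrite lerD2l ler_pM2l.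
Qed.

Lemma integral_levy_far : exists2 C : R, 0 < C &
  forall (mu : probability (measurableTypeR R) R) (m : nat), (0 < m)%N ->
  (\int[lam]_h (\1_(~` eball 1) h * Num.min (enorm h) (4 * 2 ^+ m) *
     levy_kernel mu s0 h)%:E <=
   (C * \sum_(j < m) (2 `^ (1 - 2 * s0)) ^+ j)%:E)%E.
Proof.
have [K K0 HK] := levy_kernel_far.
have [C C0 HC] := @integral_kernel_far R n s0 s0_gt0.
exists (K * C); first by rewrite mulr_gt0.
move=> mu m m0; have := HC m m0; rewrite integral_mkcond => HC'.
have mC : measurable (~` eball 1 : set V) by apply: measurableC; exact: measurable_eball.
have min0 (h : V) : 0 <= Num.min (enorm h) (4 * 2 ^+ m).
  by rewrite le_min enorm_ge0 mulr_ge0// exprn_ge0.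
have mmin : measurable_fun setT (fun h : V => Num.min (enorm h) (4 * 2 ^+ m)).
  by apply: measurable_minr => //; exact: measurable_enorm.
set G := (X in X \_ _) in HC'.
have mG : measurable_fun setT (G \_ (~` eball 1)).
  apply/(measurable_restrictT _ _).1 => //.
  apply: measurable_funTS; apply/measurable_EFinP; apply: measurable_funM => //.
  exact: measurable_power_kernel.
have G0 h : (0 <= (G \_ (~` eball 1)) h)%E.
  by apply: erestrict_ge0 => *; rewrite lee_fin divr_ge0 ?powR_ge0.
apply: (@le_trans _ _ (\int[lam]_h (K%:E * (G \_ (~` eball 1)) h))%E).
  apply: ge0_le_integral => //.
  - by move=> h _; rewrite lee_fin !mulr_ge0// levy_kernel_ge0.
  - apply/measurable_EFinP; apply: measurable_funM; last exact: measurable_levy_kernel.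
    by apply: measurable_funM => //; exact: measurable_indic.
  - exact: measurable_funeM.
  move=> h _; rewrite patchE indicE; case: ifPn => [|_]; last by rewrite !mul0r mule0.
  rewrite inE /eball/= => /negP; rewrite -leNgt => h1.
  rewrite mul1r -EFinM lee_fin mulrCA; apply: ler_wpM2l => //.
  exact: HK.
rewrite ge0_integralZl_EFin ?(ltW K0)// -[K * C * _]mulrA EFinM.
by apply: lee_wpmul2l; rewrite ?lee_fin ?(ltW K0).
Qed.

(** Its square is the standard weight of Lévy kernels: first differences of bounded Lipschitz
    functions are controlled by [min1], second differences of smooth ones by [min1 ^+ 2]. *)
Definition min1 (h : V) : R := Num.min 1 (enorm h).

Lemma min1_ge0 h : 0 <= min1 h. Proof. by rewrite le_min ler01 enorm_ge0. Qed.

Lemma measurable_min1 : measurable_fun setT min1.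
Proof. by apply: measurable_minr => //; exact: measurable_enorm. Qed.

Lemma integral_levy_min1 : exists2 C : R, 0 < C &
  forall mu : probability (measurableTypeR R) R,
  (\int[lam]_h (min1 h ^+ 2 * levy_kernel mu s0 h)%:E <= C%:E)%E.
Proof.
have [C1 C10 H1] := integral_levy_near0.
have [C2 C20 H2] := integral_levy_far.
exists (C1 + C2 * \sum_(j < 1) (2 `^ (1 - 2 * s0)) ^+ j).
  by rewrite addr_gt0// big_ord1 expr0 mulr1.
move=> mu; rewrite EFinD; apply: le_trans (leeD (H1 mu) (H2 mu 1%N isT)).
have mk := @measurable_levy_kernel R n mu s0 s0_gt0.
have mC : measurable (~` eball 1 : set V) by apply: measurableC; exact: measurable_eball.
have m1 : measurable_fun setT (fun h : V => (\1_(eball 1) h * enorm h ^+ 2 * levy_kernel mu s0 h)%:E).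
  apply/measurable_EFinP; apply: measurable_funM => //; apply: measurable_funM.
    exact: measurable_eball_indic.
  by apply: measurable_funX; exact: measurable_enorm.
have m2 : measurable_fun setT (fun h : V => (\1_(~` eball 1) h *
    Num.min (enorm h) (4 * 2 ^+ 1) * levy_kernel mu s0 h)%:E).
  apply/measurable_EFinP; apply: measurable_funM => //; apply: measurable_funM.
    exact: measurable_indic.
  by apply: measurable_minr => //; exact: measurable_enorm.
have min0 (h : V) : 0 <= Num.min (enorm h) (4 * 2 ^+ 1).
  by rewrite le_min enorm_ge0 mulr_ge0// exprn_ge0.
rewrite -ge0_integralD//; last 2 first.
- move=> h _; rewrite lee_fin; apply: mulr_ge0; last exact: levy_kernel_ge0.
  by apply: mulr_ge0 => //; exact: sqr_ge0.
- move=> h _; rewrite lee_fin; apply: mulr_ge0; last exact: levy_kernel_ge0.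
  exact: mulr_ge0.
apply: ge0_le_integral => //.
- by move=> h _; rewrite lee_fin mulr_ge0 ?sqr_ge0 ?levy_kernel_ge0.
- apply/measurable_EFinP; apply: measurable_funM => //; apply: measurable_funX.
  exact: measurable_min1.
- exact: emeasurable_funD.
move=> h _; rewrite -EFinD lee_fin -mulrDl; apply: ler_wpM2r; first exact: levy_kernel_ge0.
rewrite !indicE /min1.
have [h1|h1] := ltP (enorm h) 1.
  by rewrite mem_set// memNset ?mul1r ?mul0r ?addr0//= /eball/=; apply.
rewrite memNset/=; last by rewrite /eball/= ltNge h1.
rewrite mem_set/=; last by rewrite /eball/= ltNge h1.
rewrite mul0r add0r mul1r expr1n le_min h1/= expr1.
by rewrite -natrM ler1n.
Qed.

End levy_kernel_bounds.

#[global] Opaque levy_kernel frac_density.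

(** * The energy and the operator in terms of the kernel *)

Section triple_tonelli.
Context d1 d2 d3 (T1 : measurableType d1) (T2 : measurableType d2)
  (T3 : measurableType d3) (R : realType).
Variable m1 : {sigma_finite_measure set T1 -> \bar R}.
Variable m2 : {sigma_finite_measure set T2 -> \bar R}.
Variable m3 : {sigma_finite_measure set T3 -> \bar R}.
Variable f : T1 -> T2 * T3 -> \bar R.
Hypothesis mf : measurable_fun setT (fun p : T1 * (T2 * T3) => f p.1 p.2).
Hypothesis f0 : forall x z, (0 <= f x z)%E.

Lemma integral_exchange_prod :
  (\int[m1]_x \int[m2 \x m3]_z f x z = \int[m2 \x m3]_z \int[m1]_x f x z)%E.
Proof.
have mfx x : measurable_fun setT (f x).
  exact: (measurableT_comp mf (measurable_pair1 x)).
transitivity (\int[m1]_x \int[m2]_y \int[m3]_t f x (y, t))%E.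
  by apply: eq_integral => x _; rewrite (fubini_tonelli1 (f x)).
have mf3 : measurable_fun setT (fun q : (T1 * T2) * T3 => f q.1.1 (q.1.2, q.2)).
  have mq : measurable_fun setT (fun q : (T1 * T2) * T3 => (q.1.1, (q.1.2, q.2))).
    apply: measurable_fun_pair; first exact: measurableT_comp.
    by apply: measurable_fun_pair => //; exact: measurableT_comp.
  exact: (measurableT_comp mf mq).
rewrite (@integral_exchange _ _ _ _ _ m1 m2 (fun x y => \int[m3]_t f x (y, t))%E); last 2 first.
- exact: (@measurable_integralr _ _ _ _ _ m3 (fun q t => f q.1 (q.2, t))).
- by move=> x y; exact: integral_ge0.
rewrite (fubini_tonelli1 (fun z => \int[m1]_x f x z)%E); last 2 first.
- exact: (@measurable_integrall _ _ _ _ _ m1 f).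
- by move=> z; exact: integral_ge0.
apply: eq_integral => y _; rewrite /fubini_F.
apply: (@integral_exchange _ _ _ _ _ m1 m3 (fun x t => f x (y, t))) => //.
have my : measurable_fun setT (fun p : T1 * T3 => (p.1, (y, p.2))).
  by apply: measurable_fun_pair => //; exact: measurable_fun_pair.
exact: (measurableT_comp mf my).
Qed.

End triple_tonelli.

Section real_fubini.
Context d1 d2 (T1 : measurableType d1) (T2 : measurableType d2) (R : realType).
Variable m1 : {sigma_finite_measure set T1 -> \bar R}.
Variable m2 : {sigma_finite_measure set T2 -> \bar R}.
Variable f : T1 -> T2 -> R.

Lemma integrable_prodP : measurable_fun setT (fun p : T1 * T2 => f p.1 p.2) ->
  (\int[m1]_x \int[m2]_y `|f x y|%:E < +oo)%E ->
  (m1 \x m2)%E.-integrable setT (fun p => (f p.1 p.2)%:E).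
Proof.
move=> mf foo; apply/integrable12ltyP; first exact/measurable_EFinP.
exact: foo.
Qed.

Hypothesis intf : (m1 \x m2)%E.-integrable setT (fun p => (f p.1 p.2)%:E).

Lemma Rintegral_prodE :
  \int[(m1 \x m2)%E]_p f p.1 p.2 = \int[m1]_x \int[m2]_y f x y.
Proof.
have iF := integrable_fubini_F intf.
rewrite /Rintegral -(integral12_prod_meas1 intf); congr fine.
(* The inner integrals are finite only almost everywhere; [fine] alters them on a null set. *)
apply: ae_eq_integral => //.
- exact: measurable_int iF.
- apply/measurable_EFinP; apply: (measurableT_comp (@fine_measurable R setT measurableT)).
  exact: measurable_int iF.
have := integrable_ae measurableT iF.
by apply: filterS => x /(_ I) fx _; rewrite fineK.
Qed.

Lemma Rintegral_prodE' :
  \int[(m1 \x m2)%E]_p f p.1 p.2 = \int[m2]_y \int[m1]_x f x y.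
Proof.
have mG := measurable_fubini_G intf.
rewrite /Rintegral -(integral21_prod_meas1 intf); congr fine.
apply: ae_eq_integral => //.
  apply/measurable_EFinP; apply: (measurableT_comp (@fine_measurable R setT measurableT)).
  exact: mG.
have := ae_integrable2 intf.
by apply: filterS => y fy _; rewrite fineK//; exact: integrable_fin_num.
Qed.

Lemma Rintegral_exchange :
  \int[m1]_x \int[m2]_y f x y = \int[m2]_y \int[m1]_x f x y.
Proof. by rewrite -Rintegral_prodE Rintegral_prodE'. Qed.

End real_fubini.

Section kinetic_representation.
Context {R : realType} (n : nat).
Local Notation V := 'rV[R]_n.+1.
Local Notation lam := (lebesgue_rV n.+1).
Variables (mu : probability (measurableTypeR R) R) (s0 : R).
Hypothesis s0_gt0 : 0 < s0.

Definition cross (Om : set V) : set (V * V) := ~` (~` Om `*` ~` Om).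

Lemma measurable_cross Om : measurable Om -> measurable (cross Om).
Proof.
by move=> mO; apply: measurableC; apply: measurableX; exact: measurableC.
Qed.

Lemma frac_kineticE (u : V -> R) Om s : measurable_fun setT u -> measurable Om ->
  `[s0, 1]%classic s ->
  (frac_kinetic s u Om = \int[lam \x lam]_z
    (\1_(cross Om) z * (u z.1 - u z.2) ^+ 2 * frac_density s0 s (z.1 - z.2))%:E)%E.
Proof.
move=> mu_ mO Ds; rewrite /frac_kinetic -/(cross Om) integral_mkcond.
have mS := measurable_cross mO.
have c0 := @frac_const_ge0 R n s0 s0_gt0 s Ds.
set G := (X in X \_ _).
rewrite -ge0_integralZl_EFin//.
- apply: eq_integral => z _; rewrite patchE indicE frac_densityE// /G.
  case: ifPn => _; last by rewrite !mul0r mule0.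
  by rewrite -EFinM mul1r; congr EFin; ring.
- by move=> z _; apply: erestrict_ge0 => *; rewrite lee_fin mulr_ge0 ?sqr_ge0 ?invr_ge0 ?powR_ge0.
- apply/(measurable_restrictT _ _).1 => //; apply: measurable_funTS.
  apply/measurable_EFinP; apply: measurable_funM.
    apply: measurable_funX; apply: measurable_funB.
      exact: (measurableT_comp mu_).
    exact: (measurableT_comp mu_).
  have mz : measurable_fun setT (fun z : V * V => z.1 - z.2) by exact: measurable_rVB.
  exact: (measurableT_comp (measurable_power_kernel _) mz).
- by rewrite divr_ge0.
Qed.

Lemma measurable_diff_kernel (F : V * V -> R) : measurable_fun setT F ->
  measurable_fun setT (fun p : measurableTypeR R * (V * V) =>
    (F p.2 * frac_density s0 p.1 (p.2.1 - p.2.2))%:E).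
Proof.
move=> mF; apply/measurable_EFinP; apply: measurable_funM.
  exact: (measurableT_comp mF).
apply: measurable_frac_density => //.
by apply: measurable_rVB; apply: measurableT_comp.
Qed.

Lemma kineticE (u : V -> R) Om : measurable_fun setT u -> measurable Om ->
  (kinetic mu s0 u Om = \int[lam \x lam]_z
    (\1_(cross Om) z * (u z.1 - u z.2) ^+ 2 * levy_kernel mu s0 (z.1 - z.2))%:E)%E.
Proof.
move=> mu_ mO; have mS := measurable_cross mO.
pose F z := \1_(cross Om) z * (u z.1 - u z.2) ^+ 2.
have F0 z : 0 <= F z by rewrite mulr_ge0// sqr_ge0.
have mF : measurable_fun setT F.
  apply: measurable_funM; first exact: measurable_indic.
  apply: measurable_funX; apply: measurable_funB.
    exact: (measurableT_comp mu_).
  exact: (measurableT_comp mu_).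
have FK0 s z : (0 <= (F z * frac_density s0 s (z.1 - z.2))%:E)%E.
  by rewrite lee_fin mulr_ge0// frac_density_ge0.
rewrite /kinetic integral_mkcond.
transitivity (\int[mu]_s \int[lam \x lam]_z (F z * frac_density s0 s (z.1 - z.2))%:E)%E.
  apply: eq_integral => s _; rewrite patchE; case: ifPn => [|].
    by rewrite inE => Ds; rewrite frac_kineticE.
  rewrite notin_setE => Ds; apply/esym.
  by under eq_integral => z _ do rewrite frac_density_out// mulr0; rewrite integral0.
rewrite (@integral_exchange_prod _ _ _ _ _ _ R mu lam lam
  (fun s z => (F z * frac_density s0 s (z.1 - z.2))%:E)); last 2 first.
- exact: measurable_diff_kernel.
- exact: FK0.
apply: eq_integral => z _; rewrite -/(F z) [RHS]EFinM levy_kernelE//.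
rewrite -ge0_integralZl_EFin//.
  by move=> s _; rewrite lee_fin frac_density_ge0.
by apply/measurable_EFinP; exact: measurable_frac_density.
Qed.

Lemma integral_diff_coord (F : V * V -> \bar R) : measurable_fun setT F ->
  (forall z, 0 <= F z)%E ->
  (\int[lam \x lam]_z F z = \int[lam \x lam]_z F (z.1, (z.1 + z.2)%R))%E.
Proof.
move=> mF F0.
have mF2 (x : V) : measurable_fun setT (fun y => F (x, y)) by exact: (measurableT_comp mF).
have mFc : measurable_fun setT (fun z : V * V => F (z.1, z.1 + z.2)).
  apply: (measurableT_comp mF); apply: measurable_fun_pair => //.
  exact: measurable_rVD.
apply: (etrans (@fubini_tonelli1 _ _ _ _ R lam lam F mF F0)).
apply: (etrans _ (esym (@fubini_tonelli1 _ _ _ _ R lam lam _ mFc _))) => //.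
apply: eq_integral => x _; rewrite /fubini_F /=.
apply: (etrans (esym (ge0_integral_shift x (mF2 x) _))) => //.
by apply: eq_integral => h _; rewrite addrC.
Qed.

Lemma kinetic_coordE (u : V -> R) Om : measurable_fun setT u -> measurable Om ->
  (kinetic mu s0 u Om = \int[lam \x lam]_z
    (\1_(cross Om) (z.1, (z.1 + z.2)%R) * (u (z.1 + z.2)%R - u z.1) ^+ 2 *
     levy_kernel mu s0 z.2)%:E)%E.
Proof.
move=> mu_ mO.
pose G (z : V * V) : \bar R :=
  (\1_(cross Om) z * (u z.1 - u z.2) ^+ 2 * levy_kernel mu s0 (z.1 - z.2))%:E.
have mG : measurable_fun setT G.
  apply/measurable_EFinP; apply: measurable_funM.
    apply: measurable_funM; first by apply: measurable_indic; exact: measurable_cross.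
    apply: measurable_funX; apply: measurable_funB.
      exact: (measurableT_comp mu_).
    exact: (measurableT_comp mu_).
  have mz : measurable_fun setT (fun z : V * V => z.1 - z.2) by exact: measurable_rVB.
  exact: (measurableT_comp (measurable_levy_kernel mu s0_gt0) mz).
have G0 z : (0 <= G z)%E.
  rewrite lee_fin; apply: mulr_ge0; last exact: levy_kernel_ge0.
  by apply: mulr_ge0 => //; exact: sqr_ge0.
rewrite (kineticE mu_ mO).
apply: (etrans (integral_diff_coord mG G0)).
have E (x h : V) : x - (x + h) = - h by rewrite opprD addrA subrr sub0r.
apply: eq_integral => z _; rewrite /G [fst _]/= [snd _]/= E levy_kernelN//.
by rewrite -[(u z.1 - _) ^+ 2]sqrrN opprB.
Qed.

End kinetic_representation.

(** * The operator as an integral of second differences *)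

Section operator_on_smooth_functions.
Context {R : realType} (n : nat).
Local Notation V := 'rV[R]_n.+1.
Local Notation lam := (lebesgue_rV n.+1).
Implicit Types (x h : V) (s : R).

(** Second difference with the sign of the operator. It is quadratic in [h] for smooth functions,
    which turns the principal value into an absolutely convergent integral. *)
Definition sdiff (xi : V -> R) x h : R := 2 * xi x - xi (x + h) - xi (x - h).

Lemma measurable_shiftr x : measurable_fun setT (fun h : V => x + h).
Proof. exact: measurable_rVD. Qed.

Lemma measurable_shiftrN x : measurable_fun setT (fun h : V => x - h).
Proof. exact: measurable_rVB. Qed.

Lemma measurable_sdiff (xi : V -> R) x : measurable_fun setT xi ->
  measurable_fun setT (sdiff xi x).
Proof.
move=> mxi; apply: measurable_funB; first apply: measurable_funB => //.
  exact: (measurableT_comp mxi (measurable_shiftr x)).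
exact: (measurableT_comp mxi (measurable_shiftrN x)).
Qed.

Definition power_weight s h : R := (enorm h `^ (n.+1%:R + 2 * s))^-1.

Lemma power_weight_ge0 s h : 0 <= power_weight s h.
Proof. by rewrite invr_ge0 powR_ge0. Qed.

Lemma integrable_min1_power s : 0 < s -> s < 1 ->
  lam.-integrable setT (fun h => (min1 h ^+ 2 * power_weight s h)%:E).
Proof.
move=> s_gt0 s_lt1.
have [C1 C10 H1] := @integral_kernel_near0 R n.
have [C2 C20 H2] := @integral_kernel_far R n s s_gt0.
have mw : measurable_fun setT (@power_weight s) by exact: measurable_power_kernel.
have mB := @measurable_eball R n.+1 1.
have mC : measurable (~` eball 1 : set V) by apply: measurableC.
have M0 h : 0 <= min1 h ^+ 2 * power_weight s h.
  by apply: mulr_ge0; [exact: sqr_ge0|exact: power_weight_ge0].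
have mM : measurable_fun setT (fun h : V => (min1 h ^+ 2 * power_weight s h)%:E).
  apply/measurable_EFinP; apply: measurable_funM => //; apply: measurable_funX.
  exact: measurable_min1.
apply/integrableP; split => //.
under eq_integral do rewrite gee0_abs ?lee_fin//.
rewrite -(setUv (eball 1)) ge0_integral_setU//; last 3 first.
- by apply: measurable_funTS.
- by move=> h _; rewrite lee_fin.
- by apply/disj_set2P; rewrite setICr.
apply: lte_add_pinfty.
- apply: (le_lt_trans _ (ltry (C1 / (1 - s)))); apply: le_trans (H1 s s_gt0 s_lt1).
  apply: ge0_le_integral => //.
  + by move=> h _; rewrite lee_fin.
  + exact: measurable_funTS.
  + apply: measurable_funTS; apply/measurable_EFinP; apply: measurable_funM => //.
    by apply: measurable_funX; exact: measurable_enorm.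
  + move=> h; rewrite /eball/= => h1; rewrite lee_fin.
    apply: ler_wpM2r; first exact: power_weight_ge0.
    by rewrite lerXn2r ?nnegrE ?min1_ge0 ?enorm_ge0// ge_min lexx orbT.
- apply: (le_lt_trans _ (ltry (C2 * \sum_(j < 1) (2 `^ (1 - 2 * s)) ^+ j))).
  apply: le_trans (H2 1%N isT).
  apply: ge0_le_integral => //.
  + by move=> h _; rewrite lee_fin.
  + exact: measurable_funTS.
  + apply: measurable_funTS; apply/measurable_EFinP; apply: measurable_funM => //.
    by apply: measurable_minr => //; exact: measurable_enorm.
  + move=> h /= /negP; rewrite /eball/= -leNgt => h1; rewrite lee_fin.
    apply: ler_wpM2r; first exact: power_weight_ge0.
    apply: (@le_trans _ _ 1).
      by rewrite -[leRHS](expr1n _ 2) lerXn2r ?nnegrE ?min1_ge0// ge_min lexx.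
    by rewrite le_min h1 expr1 -natrM ler1n.
Qed.

Section one_function.
Variables (xi : V -> R) (A : R).
Hypothesis mxi : measurable_fun setT xi.
Hypothesis xiA : forall x, `|xi x| <= A.
Hypothesis sdA : forall x h, `|sdiff xi x h| <= A * min1 h ^+ 2.

Let A0 : 0 <= A. Proof. exact: le_trans (xiA 0). Qed.

Let mw s : measurable_fun setT (@power_weight s).
Proof. exact: measurable_power_kernel. Qed.

Lemma integrable_dominated (F G : V -> R) : measurable_fun setT F ->
  (forall h, `|F h| <= G h) -> lam.-integrable setT (EFin \o G) ->
  lam.-integrable setT (EFin \o F).
Proof.
move=> mF FG; apply: le_integrable => //; first exact/measurable_EFinP.
by move=> h _ /=; rewrite lee_fin; apply: (le_trans (FG h)); exact: ler_norm.
Qed.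

Lemma integrable_scale_min1_power s (c : R) : 0 < s -> s < 1 ->
  lam.-integrable setT (EFin \o (fun h => c * (min1 h ^+ 2 * power_weight s h))).
Proof.
move=> s_gt0 s_lt1.
have := integrableZl measurableT c (integrable_min1_power s_gt0 s_lt1).
by apply: eq_integrable => // h _; rewrite /= EFinM.
Qed.

Let off (eps : R) h : R := \1_(~` eball eps) h.

Let moff eps : measurable_fun setT (off eps).
Proof. by apply: measurable_indic; apply: measurableC; exact: measurable_eball. Qed.

Let integrable_off s (eps : R) (f : V -> R) : 0 < s -> s < 1 -> 0 < eps ->
  measurable_fun setT f -> (forall h, `|f h| <= 2 * A) ->
  lam.-integrable setT (EFin \o (fun h => off eps h * f h * power_weight s h)).
Proof.
move=> s_gt0 s_lt1 e0 mf fA.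
pose m := Num.min 1 eps; have m0 : 0 < m by rewrite lt_min ltr01.
apply: (@integrable_dominated _ (fun h => 2 * A / m ^+ 2 * (min1 h ^+ 2 * power_weight s h))).
- by apply: measurable_funM => //; exact: measurable_funM.
- move=> h; rewrite !normrM (ger0_norm (power_weight_ge0 s h)) mulrA.
  apply: ler_wpM2r; first exact: power_weight_ge0.
  rewrite /off indicE; have [hb|hb] := boolP (h \in _); last first.
    rewrite normr0 mul0r; apply: mulr_ge0; last exact: sqr_ge0.
    by rewrite divr_ge0 ?sqr_ge0// mulr_ge0.
  rewrite normr1 mul1r; apply: (le_trans (fA h)).
  rewrite -mulrA ler_peMr ?mulr_ge0// ler_pdivlMl ?exprn_gt0// mulr1.
  rewrite lerXn2r ?nnegrE ?(ltW m0) ?min1_ge0//.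
  move: hb; rewrite inE/= /eball/= => /negP; rewrite -leNgt => hb.
  by rewrite le_min ge_min lexx/= ge_min hb orbT.
- exact: integrable_scale_min1_power.
Qed.

Let measurable_diffr x : measurable_fun setT (fun h => xi x - xi (x + h)).
Proof.
by apply: measurable_funB => //; exact: (measurableT_comp mxi (measurable_shiftr x)).
Qed.

Let measurable_difflr x : measurable_fun setT (fun h => xi x - xi (x - h)).
Proof.
by apply: measurable_funB => //; exact: (measurableT_comp mxi (measurable_shiftrN x)).
Qed.

(** The truncation is symmetric, so $y = x + h$ and $y = x - h$ give two expressions of the same
    integral; their average contains the second difference. *)
Lemma principal_value_eps s (eps : R) x : 0 < s -> s < 1 -> 0 < eps ->
  \int[lam]_(y in [set y | eps <= enorm (x - y)])
     ((xi x - xi y) / enorm (x - y) `^ (n.+1%:R + 2 * s)) =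
  2^-1 * \int[lam]_h (off eps h * sdiff xi x h * power_weight s h).
Proof.
move=> s_gt0 s_lt1 e0.
have b12 y : `|xi x - xi y| <= 2 * A.
  by rewrite (le_trans (ler_normB _ _))// mulr_natl mulr2n lerD.
pose F y : R := off eps (x - y) * (xi x - xi y) * power_weight s (x - y).
have mF : measurable_fun setT F.
  apply: measurable_funM; last exact: (measurableT_comp (mw s) (measurable_shiftrN x)).
  apply: measurable_funM; first exact: (measurableT_comp (moff eps) (measurable_shiftrN x)).
  exact: measurable_funB.
have -> : \int[lam]_(y in [set y | eps <= enorm (x - y)])
     ((xi x - xi y) / enorm (x - y) `^ (n.+1%:R + 2 * s)) = \int[lam]_y F y.
  rewrite Rintegral_mkcond; apply: eq_Rintegral => y _.
  rewrite patchE /F /off indicE; case: ifPn.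
    rewrite inE/= => ey; rewrite mem_set ?mul1r//=.
    by rewrite /eball/=; apply/negP; rewrite -leNgt.
  rewrite notin_setE/= => /negP; rewrite -ltNge => ey.
  by rewrite memNset ?mul0r//=; apply.
have E1 : \int[lam]_y F y = \int[lam]_h (off eps h * (xi x - xi (x + h)) * power_weight s h).
  rewrite -(Rintegral_shift x mF).
  apply: eq_Rintegral => h _; rewrite /F.
  have -> : x - (h + x) = - h by rewrite opprD addrCA subrr addr0.
  rewrite /power_weight enormN [h + x]addrC /off !indicE.
  congr (_ * _ * _); congr ((nat_of_bool _)%:R).
  by apply/idP/idP; rewrite !inE /eball/= enormN.
have E2 : \int[lam]_y F y = \int[lam]_h (off eps h * (xi x - xi (x - h)) * power_weight s h).
  rewrite -(Rintegral_reflect x mF).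
  apply: eq_Rintegral => h _; rewrite /F.
  by have -> : x - (x - h) = h by rewrite opprB addrCA subrr addr0.
have -> : \int[lam]_y F y = 2^-1 * (\int[lam]_y F y + \int[lam]_y F y) by field.
pose I1 h := off eps h * (xi x - xi (x + h)) * power_weight s h.
pose I2 h := off eps h * (xi x - xi (x - h)) * power_weight s h.
have m1 := measurable_diffr x; have m2 := measurable_difflr x.
have iI1 := integrable_off s_gt0 s_lt1 e0 m1 (fun h => b12 (x + h)).
have iI2 := integrable_off s_gt0 s_lt1 e0 m2 (fun h => b12 (x - h)).
apply: (etrans (congr1 ( *%R 2^-1) (congr2 +%R E1 E2))).
rewrite -/I1 -/I2.
rewrite -(RintegralD measurableT iI1 iI2); apply: congr1.
by apply: eq_Rintegral => h _; rewrite /I1 /I2 /sdiff; ring.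
Qed.

Lemma integrable_sdiff_power s x : 0 < s -> s < 1 ->
  lam.-integrable setT (EFin \o (fun h => sdiff xi x h * power_weight s h)).
Proof.
move=> s_gt0 s_lt1; apply: integrable_dominated (integrable_scale_min1_power A s_gt0 s_lt1).
  by apply: measurable_funM => //; exact: measurable_sdiff.
move=> h; rewrite normrM (ger0_norm (power_weight_ge0 s h)) mulrA.
by apply: ler_wpM2r; [exact: power_weight_ge0|exact: sdA].
Qed.

Lemma frac_laplacianE s x : 0 < s -> s < 1 -> frac_laplacian s xi x =
  frac_const n.+1 s * (2^-1 * \int[lam]_h (sdiff xi x h * power_weight s h)).
Proof.
move=> s_gt0 s_lt1; rewrite /frac_laplacian; congr (_ * _); apply/cvg_lim => //.
apply/cvg_at_rightP => e [e0 ecvg].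
under eq_fun => k do rewrite (principal_value_eps x s_gt0 s_lt1 (e0 k)).
apply: cvgMr; rewrite /Rintegral.
have isd := integrable_sdiff_power x s_gt0 s_lt1.
apply: fine_cvg; rewrite fineK; last exact: integrable_fin_num.
apply: (@dominated_cvg _ _ _ lam setT measurableT
  (fun k h => (off (e k) h * sdiff xi x h * power_weight s h)%:E)
  (fun h => (sdiff xi x h * power_weight s h)%:E)
  (fun h => (A * (min1 h ^+ 2 * power_weight s h))%:E)).
- move=> k; apply/measurable_EFinP; apply: measurable_funM => //.
  by apply: measurable_funM => //; exact: measurable_sdiff.
(* The truncation never uncovers the origin, but the weight is zero there by the convention $1/0 =
   0$. *)
- move=> h _; have [->|h0] := eqVneq h 0.
    rewrite /power_weight enorm0 powR0 ?invr0 ?mulr0; last first.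
      by rewrite gt_eqF// addr_gt0// mulr_gt0.
    by under eq_fun do rewrite mulr0; exact: cvg_cst.
  have hp : 0 < enorm h by rewrite enorm_gt0.
  apply: cvg_near_cst; move/cvgrPdist_lt : ecvg => /(_ _ hp).
  apply: filterS => k; rewrite sub0r normrN gtr0_norm ?e0// => ek.
  rewrite /off indicE mem_set ?mul1r//= /eball/=.
  by apply/negP; rewrite -leNgt ltW.
- by [].
- exact: (integrable_scale_min1_power A s_gt0 s_lt1).
- move=> k h _; rewrite /= lee_fin !normrM (ger0_norm (power_weight_ge0 s h)) mulrA.
  apply: ler_wpM2r; first exact: power_weight_ge0.
  apply: le_trans (sdA x h); rewrite ler_piMl// /off indicE.
  by case: (_ \in _); rewrite ?normr1 ?normr0.
Qed.

Variables (mu : probability (measurableTypeR R) R) (s0 : R).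
Hypothesis s0_gt0 : 0 < s0.

Lemma integrable_levy_min1 (c : R) : lam.-integrable setT
  (EFin \o (fun h => c * (min1 h ^+ 2 * levy_kernel mu s0 h))).
Proof.
have [C C0 HC] := @integral_levy_min1 R n s0 s0_gt0.
have i1 : lam.-integrable setT (fun h => (min1 h ^+ 2 * levy_kernel mu s0 h)%:E).
  apply/integrableP; split.
    apply/measurable_EFinP; apply: measurable_funM; last exact: measurable_levy_kernel.
    by apply: measurable_funX; exact: measurable_min1.
  apply: (le_lt_trans _ (ltry C)); apply: le_trans (HC mu).
  rewrite le_eqVlt; apply/orP; left; apply/eqP; apply: eq_integral => h _.
  by rewrite gee0_abs// lee_fin mulr_ge0 ?sqr_ge0 ?levy_kernel_ge0.
have := integrableZl measurableT c i1.
by apply: eq_integrable => // h _; rewrite /= EFinM.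
Qed.

(** The kernel carries a quarter of the constant and the symmetrised operator one half, hence the
    factor 2. The exchange of the integrals in [s] and [h] is justified by the bound [sdA]; at
    [s = 1] both sides vanish with [frac_const]. *)
Lemma sum_frac_laplacianE x : sum_frac_laplacian mu s0 xi x =
  2 * \int[lam]_h (sdiff xi x h * levy_kernel mu s0 h).
Proof.
rewrite /sum_frac_laplacian Rintegral_mkcond.
pose G s h := 2 * sdiff xi x h * frac_density s0 s h.
have mG : measurable_fun setT (fun p : measurableTypeR R * V => G p.1 p.2).
  apply: measurable_funM; last exact: measurable_frac_density.
  apply: (measurableT_comp (f := fun h => 2 * sdiff xi x h)) => //.
  by apply: measurable_funM => //; exact: measurable_sdiff.
transitivity (\int[mu]_s \int[lam]_h G s h).
  apply: eq_Rintegral => s _; rewrite patchE; case: ifPn => [|]; last first.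
    rewrite notin_setE => Ds; rewrite /G; apply/esym.
    by under eq_Rintegral => h _ do rewrite frac_density_out// mulr0; rewrite Rintegral_cst// mul0r.
  rewrite inE => Ds; have := Ds; rewrite /= in_itv/= => /andP[ss s1].
  have sp : 0 < s by exact: lt_le_trans ss.
  have [s1'|] := ltP s 1; last first.
    move=> s1''; have s1E : s = 1 by apply/eqP; rewrite eq_le s1.
    have c0 : frac_const n.+1 s = 0 by rewrite /frac_const s1E subrr !mulr0.
    rewrite /frac_laplacian c0 mul0r /G; apply/esym.
    under eq_Rintegral => h _ do rewrite (frac_densityE s0_gt0 _ Ds) c0 !mul0r mulr0.
    by rewrite Rintegral_cst// mul0r.
  rewrite (frac_laplacianE x sp s1') mulrA -RintegralZl//; last exact: integrable_sdiff_power.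
  apply: eq_Rintegral => h _; rewrite /G (frac_densityE s0_gt0 _ Ds) /power_weight.
  by move: (enorm h `^ (n.+1%:R + 2 * s))^-1 => w; field.
have iG : (mu \x lam)%E.-integrable setT (fun p => (G p.1 p.2)%:E).
  apply: integrable_prodP => //.
  apply: (@le_lt_trans _ _ (\int[mu]_s \int[lam]_h
     (2 * A * min1 h ^+ 2 * frac_density s0 s h)%:E)%E).
    have mH : measurable_fun setT (fun p : measurableTypeR R * V =>
        (2 * A * min1 p.2 ^+ 2 * frac_density s0 p.1 p.2)%:E).
      apply/measurable_EFinP; apply: measurable_funM; last exact: measurable_frac_density.
      apply: measurable_funM => //; apply: measurable_funX.
      exact: (measurableT_comp (@measurable_min1 R n)).
    have H0 s h : (0 <= (2 * A * min1 h ^+ 2 * frac_density s0 s h)%:E)%E.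
      rewrite lee_fin; apply: mulr_ge0; last exact: frac_density_ge0.
      by apply: mulr_ge0; [exact: mulr_ge0|exact: sqr_ge0].
    have GH s h : (`|G s h|%:E <= (2 * A * min1 h ^+ 2 * frac_density s0 s h)%:E)%E.
      rewrite lee_fin /G normrM (ger0_norm (frac_density_ge0 s0_gt0 s h)).
      apply: ler_wpM2r; first exact: frac_density_ge0.
      by rewrite normrM ger0_norm// -mulrA ler_wpM2l.
    apply: ge0_le_integral => //.
    - by move=> s _; apply: integral_ge0 => h _; rewrite lee_fin.
    - apply: (@measurable_integralr _ _ _ _ _ lam (fun s h => `|G s h|%:E)) => //.
      by apply/measurable_EFinP; exact: (measurableT_comp (@normr_measurable R setT) mG).
    - exact: (@measurable_integralr _ _ _ _ _ lam
        (fun s h => (2 * A * min1 h ^+ 2 * frac_density s0 s h)%:E)).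
    - move=> s _; apply: ge0_le_integral => //.
      + apply/measurable_EFinP; apply: (measurableT_comp (@normr_measurable R setT)).
        exact: (measurableT_comp mG (measurable_pair1 s)).
      + exact: (measurableT_comp mH (measurable_pair1 s)).
  rewrite -(@levy_integralE R n mu s0 s0_gt0 (fun h => 2 * A * min1 h ^+ 2)); last 2 first.
  - by apply: measurable_funM => //; apply: measurable_funX; exact: measurable_min1.
  - by move=> h; apply: mulr_ge0; [exact: mulr_ge0|exact: sqr_ge0].
  have := integrable_lty measurableT (integrable_levy_min1 (2 * A)).
  by under eq_integral do rewrite /= mulrA.
rewrite (Rintegral_exchange iG) -RintegralZl//; last first.
  apply: integrable_dominated (integrable_levy_min1 A).
    by apply: measurable_funM; [exact: measurable_sdiff|exact: measurable_levy_kernel].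
  move=> h; rewrite normrM (ger0_norm (levy_kernel_ge0 _ s0_gt0 h)) mulrA.
  by apply: ler_wpM2r; [exact: levy_kernel_ge0|exact: sdA].
apply: eq_Rintegral => h _; rewrite /G mulrA.
rewrite RintegralZl; last 2 first.
- exact: measurableT.
- apply/integrableP; split.
    by apply/measurable_EFinP; exact: measurable_frac_density.
  under eq_integral do rewrite gee0_abs ?lee_fin ?frac_density_ge0//.
  by rewrite -levy_kernelE// ltry.
by rewrite Rintegral_frac_density.
Qed.

End one_function.
End operator_on_smooth_functions.

(** * Test functions and the mollified equation *)

Section flat_functions.
Context {R : realType}.
Implicit Types (p q : {poly R}) (t : R).

(** The classical function flat at the origin. The polynomial in $1/t$ makes the family closed under
    differentiation. *)
Definition flat_exp p t : R := if 0 < t then p.[t^-1] * expR (- t^-1) else 0.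

Lemma pow_expR_le (i : nat) : exists2 C : R, 0 <= C &
  forall x, 0 < x -> x ^+ i * expR (- x) <= C.
Proof.
case: i => [|i].
  exists 1 => // x x0; rewrite expr0 mul1r -[leRHS]expR0 ler_expR.
  by rewrite oppr_le0 ltW.
exists (i.+1%:R ^+ i.+1); first exact: exprn_ge0.
move=> x x0; have x0' : 0 < x ^+ i.+1 by rewrite exprn_gt0.
apply: (le_trans (ler_wpM2l (ltW x0') (expRN_le_pow i x0))).
by rewrite mulrCA divff ?mulr1// gt_eqF.
Qed.

Lemma horner_expR_le p : exists2 C : R, 0 <= C &
  forall x, 0 < x -> `|p.[x] * expR (- x)| <= C.
Proof.
have /boolp.choice[C HC] : forall i : nat, exists c : R, 0 <= c /\
    forall x, 0 < x -> x ^+ i * expR (- x) <= c.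
  by move=> i; have [c c0 H] := pow_expR_le i; exists c.
exists (\sum_(i < size p) `|p`_i| * C i).
  by apply: sumr_ge0 => i _; rewrite mulr_ge0//; case: (HC i).
move=> x x0; rewrite horner_coef mulr_suml (le_trans (ler_norm_sum _ _ _))//.
apply: ler_sum => i _; rewrite -mulrA normrM ler_wpM2l//.
rewrite ger0_norm; first by case: (HC i) => _; exact.
by rewrite mulr_ge0 ?expR_ge0// exprn_ge0// ltW.
Qed.

Lemma flat_exp_bounded p : exists2 C : R, 0 <= C & forall t, `|flat_exp p t| <= C.
Proof.
have [C C0 HC] := horner_expR_le p; exists C => // t; rewrite /flat_exp.
by case: ifPn => t0; rewrite ?normr0// HC// invr_gt0.
Qed.

Lemma flat_exp_le_sqr p : exists2 C : R, 0 <= C & forall t, `|flat_exp p t| <= C * t ^+ 2.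
Proof.
have [C C0 HC] := horner_expR_le (p * 'X ^+ 2); exists C => // t; rewrite /flat_exp.
case: ifPn => t0; last by rewrite normr0 mulr_ge0// sqr_ge0.
have := HC t^-1; rewrite invr_gt0 => /(_ t0).
rewrite hornerM hornerXn mulrAC normrM (ger0_norm (sqr_ge0 _)) exprVn.
by rewrite ler_pdivrMr ?exprn_gt0.
Qed.

(** Away from 0 this is the chain rule. At 0 the function is $O(t^2)$, so its difference quotient
    extends continuously by 0 and Carathéodory's criterion applies. *)
Lemma is_derive_flat_exp p t :
  is_derive t 1 (flat_exp p) (flat_exp ('X ^+ 2 * (p - p^`())) t).
Proof.
have [t0|t0|->] := ltgtP t 0.
- apply: (@is_derive_eq _ _ _ _ _ _ _ 0); last by rewrite /flat_exp ltNge (ltW t0).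
  have : \forall z \near t, cst 0 z = flat_exp p z.
    near=> z; rewrite /flat_exp /= ifF//; apply/negbTE; rewrite -leNgt ltW//.
    by near: z; exact: lt_nbhsl.
  by move/near_eq_is_derive; apply => //; exact: is_derive_cst.
- pose F z := p.[z^-1] * expR (- z^-1).
  have tn0 : t != 0 by rewrite gt_eqF.
  have dV : is_derive t 1 (fun z : R => z^-1) (- t ^- 2).
    by apply: is_derive_eq (is_deriveV tn0 (is_derive_id t 1)) _; rewrite /GRing.scale /= mulr1.
  have dp : is_derive t 1 (fun z => p.[z^-1]) (p^`().[t^-1] * (- t ^- 2)).
    exact: (@is_derive1_comp _ (horner p) (fun z => z^-1)).
  have dN : is_derive t 1 (fun z : R => - z^-1) (t ^- 2).
    by apply: is_derive_eq (is_deriveN dV) _; rewrite opprK.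
  have de : is_derive t 1 (fun z => expR (- z^-1)) (expR (- t^-1) * t ^- 2).
    exact: (@is_derive1_comp _ expR (fun z => - z^-1)).
  have dF : is_derive t 1 F (flat_exp ('X ^+ 2 * (p - p^`())) t).
    apply: is_derive_eq (is_deriveM dp de) _.
    rewrite /flat_exp t0 !hornerE exprVn /= /GRing.scale /=.
    by move: (t ^- 2) => w; ring.
  have : \forall z \near t, F z = flat_exp p z.
    near=> z; rewrite /flat_exp ifT//.
    by near: z; exact: lt_nbhsr.
  by move/near_eq_is_derive; apply.
have [C C0 HC] := flat_exp_le_sqr p.
have f0 : flat_exp p 0 = 0 by rewrite /flat_exp ltxx.
apply/is_derive1_caratheodory; exists (fun z => flat_exp p z / z); split.
- move=> z; rewrite f0 !subr0; have [->|z0] := eqVneq z 0; first by rewrite f0 mulr0.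
  by rewrite divfK.
- change (flat_exp p z / z @[z --> (0 : R)] --> flat_exp p 0 / 0).
  rewrite f0 mul0r; apply/cvgrPdist_le => e e0.
  near=> z; rewrite sub0r normrN.
  have [->|z0] := eqVneq z 0; first by rewrite invr0 mulr0 normr0 ltW.
  rewrite normrM normfV ler_pdivrMr ?normr_gt0//.
  rewrite (le_trans (HC z))// -real_normK ?num_real// expr2 mulrA ler_wpM2r//.
  apply: (@le_trans _ _ ((C + 1) * `|z|)); first by rewrite ler_wpM2r// lerDl.
  rewrite -ler_pdivlMl ?ltr_wpDl//.
  near: z; have r0 : 0 < (C + 1)^-1 * e by rewrite mulr_gt0// invr_gt0 ltr_wpDl.
  move/cvgrPdist_le : (@cvg_id _ (nbhs (0 : R))) => /(_ _ r0).
  by apply: filterS => z; rewrite sub0r normrN.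
- by rewrite invr0 mulr0 /flat_exp ltxx.
Unshelve. all: by end_near. Qed.

(* A class of functions closed under differentiation that contains compactly
   supported members. *)
Inductive flat_class : (R -> R) -> Prop :=
| flat_base p a b : flat_class (fun t => flat_exp p (a * t + b))
| flat_add f g : flat_class f -> flat_class g -> flat_class (fun t => f t + g t)
| flat_mul f g : flat_class f -> flat_class g -> flat_class (fun t => f t * g t).

Lemma flat_class_bounded f : flat_class f -> exists2 C : R, 0 <= C & forall t, `|f t| <= C.
Proof.
elim=> [p a b|{}f g _ [C C0 HC] _ [D D0 HD]|{}f g _ [C C0 HC] _ [D D0 HD]].
- by have [C C0 HC] := flat_exp_bounded p; exists C.
- exists (C + D); first exact: addr_ge0.
  by move=> t; rewrite (le_trans (ler_normD _ _))// lerD.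
- exists (C * D); first exact: mulr_ge0.
  by move=> t; rewrite normrM ler_pM.
Qed.

Lemma flat_class_derive f : flat_class f ->
  exists2 g, flat_class g & forall t, is_derive t 1 f (g t).
Proof.
elim=> [p a b|{}f g Ff [f' Ff' df] Fg [g' Fg' dg]|{}f g Ff [f' Ff' df] Fg [g' Fg' dg]].
- exists (fun t => flat_exp (a *: ('X ^+ 2 * (p - p^`()))) (a * t + b)).
    exact: flat_base.
  move=> t; have dl : is_derive t 1 (fun t : R => a * t + b) a.
    have d1 : is_derive t 1 (a \*: (@id R)) a.
      by apply: is_derive_eq (is_deriveZ a (is_derive_id t 1)) _; rewrite /GRing.scale /= mulr1.
    by apply: is_derive_eq (is_deriveD d1 (is_derive_cst b t 1)) _; rewrite addr0.
  apply: is_derive_eq (@is_derive1_comp _ _ (fun t => a * t + b) _ _ _ (is_derive_flat_exp p _) dl) _.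
  by rewrite /flat_exp; case: ifPn => _; rewrite ?mul0r// hornerZ; ring.
- exists (fun t => f' t + g' t); first exact: flat_add.
  by move=> t; exact: is_deriveD (df t) (dg t).
- exists (fun t => f t * g' t + g t * f' t).
    by apply: flat_add; exact: flat_mul.
  by move=> t; exact: is_deriveM (df t) (dg t).
Qed.

Lemma flat_class_continuous f : flat_class f -> continuous f.
Proof.
move=> /flat_class_derive[g _ df] t; apply: differentiable_continuous.
by apply/derivable1_diffP; case: (df t).
Qed.

Lemma lipschitz_of_derive (f g : R -> R) (C : R) : (forall t, is_derive t 1 f (g t)) ->
  (forall t, `|g t| <= C) -> forall s t, `|f t - f s| <= C * `|t - s|.
Proof.
move=> df gC; have cf : continuous f.
  move=> t; apply: differentiable_continuous.
  by apply/derivable1_diffP; case: (df t).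
have main a b : a <= b -> `|f b - f a| <= C * `|b - a|.
  move=> ab; have cw : {within `[a, b], continuous f} by exact: continuous_subspaceT.
  have [c _ ->] := MVT_segment ab (fun x _ => df x) cw.
  by rewrite normrM ler_wpM2r.
move=> s t; have [st|/ltW ts] := leP s t; first exact: main.
by rewrite distrC [`|t - s|]distrC; exact: main.
Qed.

Lemma flat_class_lipschitz f : flat_class f -> exists2 C : R, 0 <= C &
  forall s t, `|f t - f s| <= C * `|t - s|.
Proof.
move=> /flat_class_derive[g /flat_class_bounded[C C0 HC] df].
by exists C => //; exact: (lipschitz_of_derive df).
Qed.

(** The mean value theorem for $s \mapsto f(t+s) + f(t-s)$, whose derivative $f'(t+s) - f'(t-s)$ is
    at most $2C|s|$ because $f'$ is Lipschitz. *)
Lemma flat_class_sdiff f : flat_class f -> exists2 C : R, 0 <= C &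
  forall t h, `|2 * f t - f (t + h) - f (t - h)| <= C * h ^+ 2.
Proof.
move=> /flat_class_derive[g /flat_class_lipschitz[C C0 HC] df].
exists (C * 2); first exact: mulr_ge0.
move=> t h; pose F s := f (t + s) + f (t - s).
have dF (s : R) : is_derive s 1 F (g (t + s) - g (t - s)).
  have d1 : is_derive s 1 (fun s : R => t + s) 1.
    by apply: is_derive_eq (is_deriveD (is_derive_cst t s 1) (is_derive_id s 1)) _; rewrite add0r.
  have d2 : is_derive s 1 (fun s : R => t - s) (-1).
    by apply: is_derive_eq (is_deriveB (is_derive_cst t s 1) (is_derive_id s 1)) _; rewrite sub0r.
  have e1 := @is_derive1_comp _ f (fun s => t + s) _ _ _ (df _) d1.
  have e2 := @is_derive1_comp _ f (fun s => t - s) _ _ _ (df _) d2.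
  by apply: is_derive_eq (is_deriveD e1 e2) _; rewrite mulr1 mulrN1.
have cF : continuous F.
  move=> s; apply: differentiable_continuous.
  by apply/derivable1_diffP; case: (dF s).
have -> : 2 * f t - f (t + h) - f (t - h) = - (F h - F 0).
  by rewrite /F addr0 subr0; ring.
have FN s : F (- s) = F s by rewrite /F opprK addrC.
rewrite normrN; wlog h0 : h / 0 <= h.
  move=> H; have [/H//|/ltW h0] := leP 0 h.
  by rewrite -FN -sqrrN; apply: H; rewrite oppr_ge0.
have cw : {within `[0, h], continuous F} by exact: continuous_subspaceT.
have [c cin ->] := MVT_segment h0 (fun x _ => dF x) cw.
move: cin; rewrite in_itv/= => /andP[c0 ch].
rewrite subr0 normrM (ger0_norm h0) expr2 mulrA; apply: ler_wpM2r => //.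
apply: (le_trans (HC _ _)).
have -> : t + c - (t - c) = 2 * c by ring.
by rewrite normrM !ger0_norm// mulrA ler_wpM2l// mulr_ge0.
Qed.

(** A bump on [[0, eps]]: the first factor vanishes for $t \le 0$, the second for $t \ge
    \varepsilon$. *)
Definition bump1 (eps t : R) : R :=
  flat_exp 1 (eps^-1 * t + 0) * flat_exp 1 (- eps^-1 * t + 1).

Lemma flat_class_bump1 eps a : flat_class (fun t => bump1 eps (t - a)).
Proof.
have -> : (fun t => bump1 eps (t - a)) = (fun t => flat_exp 1 (eps^-1 * t + - (eps^-1 * a)) *
    flat_exp 1 (- eps^-1 * t + (eps^-1 * a + 1))).
  by apply/funext => t; rewrite /bump1; congr (flat_exp _ _ * flat_exp _ _); ring.
by apply: flat_mul; exact: flat_base.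
Qed.

Lemma flat_exp1_ge0 t : 0 <= flat_exp 1 t.
Proof. by rewrite /flat_exp; case: ifPn => // _; rewrite hornerC mul1r expR_ge0. Qed.

Lemma bump1_ge0 eps t : 0 <= bump1 eps t.
Proof. by apply: mulr_ge0; exact: flat_exp1_ge0. Qed.

Lemma bump1_supp eps t : 0 < eps -> bump1 eps t != 0 -> 0 <= t <= eps.
Proof.
move=> e0 b0; apply/andP; split.
  rewrite leNgt; apply: contra b0 => t0; rewrite /bump1 /flat_exp.
  by rewrite addr0 pmulr_rgt0 ?invr_gt0// ltNge (ltW t0)/= mul0r.
rewrite leNgt; apply: contra b0 => t0; rewrite /bump1 /flat_exp [X in _ * X]ifF ?mulr0//.
apply/negbTE; rewrite -leNgt mulNr addrC subr_le0.
by rewrite mulrC ler_pdivlMr// mul1r ltW.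
Qed.

(** Both $t/\varepsilon$ and $1 - t/\varepsilon$ are at least $1/4$, so each factor is at least
    $e^{-4}$. *)
Lemma bump1_ge eps t : 0 < eps -> eps / 4 <= t <= eps / 2 -> expR (- 8) <= bump1 eps t.
Proof.
move=> e0 /andP[t1 t2].
have H s : 4^-1 <= s -> expR (- 4) <= flat_exp 1 s.
  move=> s4; have s0 : 0 < s by apply: lt_le_trans s4; rewrite invr_gt0.
  rewrite /flat_exp s0 hornerC mul1r ler_expR lerN2 -[leRHS]invrK lef_pV2 ?posrE ?invr_gt0//.
have -> : - 8 = - 4 + - 4 :> R by ring.
rewrite expRD /bump1; apply: ler_pM; rewrite ?expR_ge0//; apply: H.
  rewrite addr0 mulrC ler_pdivlMr//; lra.
have : eps^-1 * t <= 2^-1 by rewrite mulrC ler_pdivrMr//; lra.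
lra.
Qed.

End flat_functions.

(** * Products of one-variable bumps as test functions *)

Section tensor_products.
Context {R : realType} (n : nat).
Local Notation V := 'rV[R]_n.+1.
Local Notation lam := (lebesgue_rV n.+1).
Implicit Types (x h y z : V) (b : 'I_n.+1 -> R -> R).

Definition tensor b x : R := \prod_i b i (x ord0 i).

Lemma tensor_continuous b : (forall i, flat_class (b i)) -> continuous (tensor b).
Proof.
move=> Fb; rewrite /tensor; elim: (index_enum _) => [|i s IHs] x.
  have -> : (fun y : V => \prod_(i <- [::]) b i (y ord0 i)) = cst 1.
    by apply/funext => y; rewrite big_nil.
  exact: cst_continuous.
have -> : (fun y : V => \prod_(j <- i :: s) b j (y ord0 j)) =
    (fun y => b i (y ord0 i) * \prod_(j <- s) b j (y ord0 j)).
  by apply/funext => y; rewrite big_cons.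
have cb : {for x, continuous (fun y : V => b i (y ord0 i))}.
  apply: (@continuous_comp _ _ _ (fun y : V => y ord0 i) (b i)).
    exact: coord_continuous.
  exact: flat_class_continuous.
exact: (continuousM cb (IHs x)).
Qed.

(** Along a coordinate axis only one factor varies, so a partial derivative is again a product, with
    one factor replaced. Smoothness of every order is then an induction inside this family. *)
Lemma tensor_derive b (g : R -> R) i x : (forall t : R, is_derive t 1 (b i) (g t)) ->
  derivable (tensor b) x (delta_mx ord0 i) /\
  'D_(delta_mx ord0 i) (tensor b) x = tensor (fun j => if j == i then g else b j) x.
Proof.
move=> dg; pose Q := \prod_(j | j != i) b j (x ord0 j).
have E (h : R) : tensor b (h *: delta_mx ord0 i + x) = b i (h *: 1 + x ord0 i) * Q.
  rewrite /tensor (bigD1 i)//= !mxE !eqxx; congr (_ * _).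
  by apply: eq_bigr => j ji; rewrite !mxE (negPf ji) andbF mulr0 add0r.
have Ex : tensor b x = b i (x ord0 i) * Q by rewrite /tensor (bigD1 i).
have c : h^-1 *: (tensor b (h *: delta_mx ord0 i + x) - tensor b x) @[h --> 0^'] -->
    (g (x ord0 i) * Q : R).
  have -> : (fun h : R => h^-1 *: (tensor b (h *: delta_mx ord0 i + x) - tensor b x)) =
      (fun h : R => (h^-1 *: (b i (h *: 1 + x ord0 i) - b i (x ord0 i))) * Q).
    by apply/funext => h; rewrite E Ex -mulrBl /GRing.scale /= mulrA.
  apply: cvgMl; have [dx dv] := dg (x ord0 i).
  by rewrite -dv; exact: dx.
split; first by apply/cvg_ex; exists (g (x ord0 i) * Q).
rewrite /derive (cvg_lim _ c)//= /tensor (bigD1 i)//= eqxx; congr (_ * _).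
by apply: eq_bigr => j /negPf ->.
Qed.

Lemma tensor_smooth k b : (forall i, flat_class (b i)) -> is_Ck_rV k (tensor b).
Proof.
elim: k b => [|k IHk] b Fb /=; split => //; try exact: tensor_continuous.
move=> i; have [g Fg dg] := flat_class_derive (Fb i); split.
  by move=> x; have [] := tensor_derive x dg.
have -> : (fun x => 'D_(delta_mx ord0 i) (tensor b) x) =
    tensor (fun j => if j == i then g else b j).
  by apply/funext => x; have [] := tensor_derive x dg.
by apply: IHk => j; case: ifP.
Qed.

(** The $C^{1,1}$ information that the operator needs, stated through differences so that it passes
    to mollifications without differentiating them. *)
Definition tame (f : V -> R) := exists2 A : R, 0 <= A &
  [/\ forall x, `|f x| <= A,
      forall x h, `|f (x + h) - f x| <= A * enorm h &
      forall x h, `|sdiff f x h| <= A * enorm h ^+ 2].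

Lemma tame_cst (c : R) : tame (fun=> c).
Proof.
exists `|c| => //; split=> [//|x h|x h]; first by rewrite subrr normr0 mulr_ge0 ?enorm_ge0.
rewrite /sdiff (_ : 2 * c - c - c = 0); last by ring.
by rewrite normr0 mulr_ge0// sqr_ge0.
Qed.

(** The second difference of a product is a second difference times an average, plus a value times a
    second difference, minus half a product of two central differences; the last one is quadratic in
    [h] by the Lipschitz bounds. *)
Lemma tameM f g : tame f -> tame g -> tame (fun x => f x * g x).
Proof.
move=> [A A0 [f0 f1 f2]] [B B0 [g0 g1 g2]].
have AB0 : 0 <= A * B by exact: mulr_ge0.
exists (4 * (A * B)); first exact: mulr_ge0.
split.
- by move=> x; rewrite normrM (le_trans (ler_pM _ _ (f0 x) (g0 x)))//; lra.
- move=> x h.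
  have -> : f (x + h) * g (x + h) - f x * g x =
    (f (x + h) - f x) * g (x + h) + f x * (g (x + h) - g x) by ring.
  rewrite (le_trans (ler_normD _ _))// !normrM.
  have e0 := enorm_ge0 h.
  have := ler_pM (normr_ge0 _) (normr_ge0 _) (f1 x h) (g0 (x + h)).
  have := ler_pM (normr_ge0 _) (normr_ge0 _) (f0 x) (g1 x h).
  have : 0 <= A * B * enorm h by exact: mulr_ge0.
  lra.
- move=> x h; rewrite /sdiff.
  have -> : 2 * (f x * g x) - f (x + h) * g (x + h) - f (x - h) * g (x - h) =
    sdiff f x h * (2^-1 * (g (x + h) + g (x - h))) + f x * sdiff g x h -
    2^-1 * (f (x + h) - f (x - h)) * (g (x + h) - g (x - h)).
    by rewrite /sdiff; field.
  have g3 : `|2^-1 * (g (x + h) + g (x - h))| <= B.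
    rewrite normrM ger0_norm ?invr_ge0// ler_pdivrMl// mulr_natl mulr2n.
    by rewrite (le_trans (ler_normD _ _))// lerD.
  have dd (k : V -> R) (C : R) : (forall x h, `|k (x + h) - k x| <= C * enorm h) ->
      `|k (x + h) - k (x - h)| <= 2 * C * enorm h.
    move=> kC; have -> : k (x + h) - k (x - h) = (k (x + h) - k x) - (k (x + - h) - k x) by ring.
    rewrite (le_trans (ler_normB _ _))//; have := kC x h; have := kC x (- h).
    rewrite enormN; lra.
  have F1 := dd f A f1; have G1 := dd g B g1.
  rewrite (le_trans (ler_normB _ _))// (le_trans (lerD (ler_normD _ _) (lexx _)))// !normrM.
  rewrite (_ : `|2^-1 : R| = 2^-1); last by rewrite ger0_norm ?invr_ge0.
  have := ler_pM (normr_ge0 _) (normr_ge0 _) (f2 x h) g3.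
  have := ler_pM (normr_ge0 _) (normr_ge0 _) (f0 x) (g2 x h).
  have := ler_pM (normr_ge0 _) (normr_ge0 _) F1 G1.
  rewrite !normrM (_ : `|2^-1 : R| = 2^-1); last by rewrite ger0_norm ?invr_ge0.
  have : 0 <= A * B * enorm h ^+ 2 by rewrite mulr_ge0// sqr_ge0.
  rewrite expr2; lra.
Qed.

Lemma tame_coord (b : R -> R) (i : 'I_n.+1) : flat_class b -> tame (fun x => b (x ord0 i)).
Proof.
move=> Fb; have [A0 A00 H0] := flat_class_bounded Fb.
have [A1 A10 H1] := flat_class_lipschitz Fb; have [A2 A20 H2] := flat_class_sdiff Fb.
have P0 : 0 <= A0 + A1 + A2 by rewrite !addr_ge0.
exists (A0 + A1 + A2) => //; split.
- by move=> x; rewrite (le_trans (H0 _))// -addrA lerDl addr_ge0.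
- move=> x h; rewrite (le_trans (H1 _ _))// mxE addrAC subrr add0r.
  apply: ler_pM => //; first by lra.
  exact: coord_le_enorm.
- move=> x h; rewrite /sdiff !mxE (le_trans (H2 _ _))//.
  apply: ler_pM; rewrite ?sqr_ge0//; first by lra.
  by rewrite -[leLHS]real_normK ?num_real// lerXn2r ?nnegrE ?enorm_ge0// coord_le_enorm.
Qed.

Lemma tame_tensor b : (forall i, flat_class (b i)) -> tame (tensor b).
Proof.
move=> Fb; rewrite /tensor; elim: (index_enum _) => [|i s IHs].
  have -> : (fun y : V => \prod_(i <- [::]) b i (y ord0 i)) = cst 1.
    by apply/funext => y; rewrite big_nil.
  exact: tame_cst.
have -> : (fun y : V => \prod_(j <- i :: s) b j (y ord0 j)) =
    (fun y => b i (y ord0 i) * \prod_(j <- s) b j (y ord0 j)).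
  by apply/funext => y; rewrite big_cons.
by apply: tameM => //; exact: tame_coord.
Qed.

Lemma tame_min1 f : tame f -> exists2 A : R, 0 <= A &
  [/\ forall x, `|f x| <= A,
      forall x h, `|f (x + h) - f x| <= A * min1 h &
      forall x h, `|sdiff f x h| <= A * min1 h ^+ 2].
Proof.
move=> [A A0 [f0 f1 f2]]; exists (4 * A); first exact: mulr_ge0.
have f0' x : - A <= f x <= A by rewrite -ler_norml.
split.
- by move=> x; rewrite (le_trans (f0 x))//; lra.
- move=> x h; rewrite /min1; have [h1|h1] := leP 1 (enorm h).
    rewrite mulr1 ler_norml; have := f0' (x + h); have := f0' x; lra.
  by rewrite (le_trans (f1 x h))// ler_wpM2r ?enorm_ge0//; lra.
- move=> x h; rewrite /min1; have [h1|h1] := leP 1 (enorm h).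
    rewrite expr1n mulr1 /sdiff ler_norml.
    by have := f0' (x + h); have := f0' x; have := f0' (x - h); lra.
  by rewrite (le_trans (f2 x h))// ler_wpM2r ?sqr_ge0//; lra.
Qed.

Lemma measurable_tensor b : (forall i, flat_class (b i)) ->
  measurable_fun setT (tensor b).
Proof.
move=> Fb; apply: measurable_prod => i _.
apply: (measurableT_comp _ (measurable_rV_coord i)).
by apply: continuous_measurable_fun; exact: flat_class_continuous.
Qed.

Lemma integrable_bounded_support (f : V -> R) (A r : R) : measurable_fun setT f ->
  (forall x, `|f x| <= A) -> (forall x, r <= enorm x -> f x = 0) ->
  lam.-integrable setT (EFin \o f).
Proof.
move=> mf fA fr; have mB := @measurable_eball R n.+1 r.
have i1 : lam.-integrable setT (EFin \o (fun x => A * \1_(eball r) x)).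
  apply/integrableP; split.
    by apply/measurable_EFinP; apply: measurable_funM => //; exact: measurable_indic.
  have A0 : 0 <= A by exact: le_trans (fA 0).
  rewrite (eq_integral (fun x => A%:E * (\1_(eball r) x)%:E)%E); last first.
    by move=> x _; rewrite /= ger0_norm ?mulr_ge0.
  rewrite ge0_integralZl_EFin//; last first.
    by apply/measurable_EFinP; exact: measurable_indic.
  rewrite integral_indic// setIT lte_mul_pinfty ?lee_fin//.
  exact: lebesgue_eball_fin.
apply: integrable_dominated i1 => // x; rewrite indicE.
have [xr|xr] := boolP (x \in _); first by rewrite mulr1.
rewrite mulr0 fr ?normr0//; move: xr; rewrite notin_setE /eball/=.
by move=> /negP; rewrite -leNgt.
Qed.

Definition cube_bump (eps : R) : V -> R := tensor (fun=> bump1 eps).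

Lemma bump_shiftE eps y : (fun x => cube_bump eps (x - y)) =
  tensor (fun i t => bump1 eps (t - y ord0 i)).
Proof.
by apply/funext => x; rewrite /cube_bump /tensor; apply: eq_bigr => i _; rewrite !mxE.
Qed.

Let flat_shift eps y i : flat_class (fun t => bump1 eps (t - y ord0 i)).
Proof. exact: flat_class_bump1. Qed.

Lemma bump_ge0 eps z : 0 <= cube_bump eps z.
Proof. by apply: prodr_ge0 => i _; exact: bump1_ge0. Qed.

Lemma bump_supp_coord eps z : 0 < eps -> cube_bump eps z != 0 -> forall i, 0 <= z ord0 i <= eps.
Proof.
move=> e0 bz i; apply: (bump1_supp e0); apply: contra bz => /eqP bi.
by rewrite /cube_bump /tensor (bigD1 i)//= bi mul0r.
Qed.

Lemma bump_supp eps z : 0 < eps -> cube_bump eps z != 0 -> enorm z <= n.+1%:R * eps.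
Proof.
move=> e0 bz; apply: (le_trans (ler_enorm_sum z)).
apply: (@le_trans _ _ (\sum_(i < n.+1) eps)).
  by apply: ler_sum => i _; have /andP[z0 ze] := bump_supp_coord e0 bz i; rewrite ger0_norm.
by rewrite sumr_const card_ord mulr_natl.
Qed.

Lemma bump_eq0 eps z : 0 < eps -> n.+1%:R * eps < enorm z -> cube_bump eps z = 0.
Proof.
move=> e0 ze; apply/eqP; apply: contraTT ze => /(bump_supp e0).
by rewrite leNgt.
Qed.

(** These translates are the only test functions in which the equation is used. Compactness of the
    support comes from a closed box containing it. *)
Lemma test_function_bump eps y : 0 < eps -> test_function (fun x => cube_bump eps (x - y)).
Proof.
move=> e0; split; first by move=> k; rewrite bump_shiftE; exact: tensor_smooth.
pose K : set V := [set x | forall i, `[y ord0 i, y ord0 i + eps]%classic (x ord0 i)].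
have cK : compact K.
  apply: (@rV_compact R n.+1 (fun i => `[y ord0 i, y ord0 i + eps]%classic)) => i.
  exact: segment_compact.
apply: (subclosed_compact (@closed_closure _ _) cK).
have KK : closure K `<=` K.
  by rewrite -(closure_id K).1//; apply: compact_closed => //; exact: norm_hausdorff.
apply: subset_trans KK.
apply: closure_subset => x /= bx; rewrite /K /= => i; rewrite in_itv/=.
by have := bump_supp_coord e0 bx i; rewrite !mxE; lra.
Qed.

Lemma tame_bump eps : tame (cube_bump eps).
Proof.
have -> : cube_bump eps = (fun x => cube_bump eps (x - 0)) by apply/funext => x; rewrite subr0.
by rewrite bump_shiftE; exact: tame_tensor.
Qed.

Lemma measurable_bump eps : measurable_fun setT (cube_bump eps).
Proof.
have -> : cube_bump eps = (fun x => cube_bump eps (x - 0)) by apply/funext => x; rewrite subr0.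
by rewrite bump_shiftE; exact: measurable_tensor.
Qed.

Lemma integrable_bump eps : 0 < eps -> lam.-integrable setT (EFin \o cube_bump eps).
Proof.
move=> e0; have [A A0 [HA _ _]] := tame_bump eps.
apply: (@integrable_bounded_support _ A (n.+1%:R * eps + 1)) => //.
  exact: measurable_bump.
by move=> x xr; apply: bump_eq0 => //; lra.
Qed.

Definition bump_mass eps : R := \int[lam]_x cube_bump eps x.

(** On the box where all coordinates lie in [[eps / 4, eps / 2]] the bump is at least
    $e^{-8(n+1)}$. *)
Lemma bump_mass_gt0 eps : 0 < eps -> 0 < bump_mass eps.
Proof.
move=> e0; pose D := fun _ : 'I_n.+1 => `[eps / 4, eps / 2]%classic : set R.
pose B : set V := [set x | forall i, D i (x ord0 i)].
have mB : measurable B.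
  by apply: (@measurable_box R n.+1 D) => i; exact: measurable_itv.
have lB : lam B = ((eps / 4) ^+ n.+1)%:E.
  rewrite (@lebesgue_rV_box R n.+1 D); last by move=> i; exact: measurable_itv.
  rewrite (eq_bigr (fun=> (eps / 4)%:E)); last first.
    move=> i _; rewrite /D lebesgue_measure_itv/= lte_fin.
    rewrite ifT; last by rewrite ltr_pM2l// ltf_pV2 ?posrE// ltr_nat.
    by rewrite -EFinB; congr EFin; field.
  by rewrite prodEFin big_const_ord iter_mulr_1.
pose c : R := expR (- 8) ^+ n.+1.
have c0 : 0 < c by rewrite exprn_gt0// expR_gt0.
apply: (@lt_le_trans _ _ (c * (eps / 4) ^+ n.+1)).
  by rewrite mulr_gt0// exprn_gt0// divr_gt0.
rewrite -lee_fin /bump_mass /Rintegral fineK; last first.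
  exact: (integrable_fin_num _ (integrable_bump e0)).
rewrite EFinM -lB -[X in (_ * lam X)%E](setIT B) -integral_indic//.
rewrite -ge0_integralZl_EFin ?(ltW c0)//; last first.
  by apply/measurable_EFinP; exact: measurable_indic.
apply: ge0_le_integral => //.
- by move=> x _; rewrite -EFinM lee_fin mulr_ge0// ltW.
- by apply: measurable_funeM; apply/measurable_EFinP; exact: measurable_indic.
- by apply/measurable_EFinP; exact: measurable_bump.
move=> x _; rewrite -EFinM lee_fin indicE.
have [xB|xB] := boolP (x \in B); last by rewrite mulr0 bump_ge0.
rewrite mulr1 /cube_bump /tensor /c -[X in _ ^+ X]card_ord -prodr_const.
apply: ler_prod => i _; rewrite expR_ge0/=; apply: bump1_ge => //.
by move: xB; rewrite inE => /(_ i); rewrite /D/= in_itv.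
Qed.

End tensor_products.

(** * Mollification *)

Section mollification.
Context {R : realType} (n : nat).
Local Notation V := 'rV[R]_n.+1.
Local Notation lam := (lebesgue_rV n.+1).
Implicit Types (x h y z : V).

Lemma le_norm_Rintegral_bounded_support (F : V -> R) (B r : R) : 0 <= B ->
  measurable_fun setT F -> (forall x, `|F x| <= B) ->
  (forall x, r <= enorm x -> F x = 0) ->
  \int[lam]_x `|F x| <= B * fine (lam (eball r)).
Proof.
move=> B0 mF FB Fr; have mB := @measurable_eball R n.+1 r.
have iF := integrable_bounded_support mF FB Fr.
rewrite -(Rintegral_cst _ mB) [leRHS]Rintegral_mkcond; apply: le_Rintegral => //.
- apply: (@integrable_bounded_support _ _ _ B r).
  + exact: (measurableT_comp (@normr_measurable R setT) mF).
  + by move=> x; rewrite normr_id.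
  + by move=> x xr; rewrite Fr ?normr0.
- apply: (@integrable_bounded_support _ _ _ B r).
  + by apply/(measurable_restrictT _ mB).
  + by move=> x; rewrite patchE; case: ifP => _; rewrite ?normr0// ger0_norm.
  + move=> x xr; rewrite patchE ifF//; apply/negbTE; rewrite notin_setE /eball/=.
    by apply/negP; rewrite -leNgt.
move=> x _; rewrite patchE; case: ifPn => [_|]; first exact: FB.
rewrite notin_setE /eball/= => /negP; rewrite -leNgt => /Fr ->.
by rewrite normr0.
Qed.

(** For a long shift twice the $L^1$ norm suffices. For a short one the difference is at most $B|h|$
    and lives in the ball of radius [r + 1]. *)
Lemma integral_diff_le (f : V -> R) (B r : R) : measurable_fun setT f -> 0 <= B ->
  (forall x, `|f x| <= B) -> (forall x h, `|f (x + h) - f x| <= B * min1 h) ->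
  (forall x, r <= enorm x -> f x = 0) ->
  exists2 C : R, 0 <= C & forall h, \int[lam]_x `|f (x + h) - f x| <= C * min1 h.
Proof.
move=> mf B0 fB fL fr.
have mfh h : measurable_fun setT (fun x => f (x + h)).
  by apply: (measurableT_comp mf); exact: measurable_rVD.
have ifh h : lam.-integrable setT (EFin \o (fun x => f (x + h))).
  apply: (@integrable_bounded_support _ _ _ B (r + enorm h)) => // x xr; apply: fr.
  by have := enormD (x + h) (- h); rewrite addrK enormN; lra.
have iN h : lam.-integrable setT (EFin \o (fun x => `|f (x + h)|)).
  by have := integrable_norm (ifh h); apply: eq_integrable.
pose C0 := B * fine (lam (eball r)); pose C1 := B * fine (lam (eball (r + 1))).
have C00 : 0 <= C0 by rewrite mulr_ge0// fine_ge0.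
have C10 : 0 <= C1 by rewrite mulr_ge0// fine_ge0.
exists (2 * C0 + C1); first by rewrite addr_ge0// mulr_ge0.
move=> h; rewrite /min1; have [h1|h1] := leP 1 (enorm h).
  rewrite mulr1; apply: (@le_trans _ _ (2 * C0)); last by rewrite lerDl.
  have I0 : \int[lam]_x `|f x| <= C0 by exact: le_norm_Rintegral_bounded_support.
  have Ih k : \int[lam]_x `|f (x + k)| <= C0.
    rewrite (@Rintegral_shift _ _ k (fun x => `|f x|))//.
    exact: (measurableT_comp (@normr_measurable R setT)).
  apply: (@le_trans _ _ (\int[lam]_x `|f (x + h)| + \int[lam]_x `|f (x + 0)|)); last first.
    by rewrite mulr_natl mulr2n lerD.
  rewrite -RintegralD//; apply: le_Rintegral => //.
  - have := integrable_norm (integrableB measurableT (ifh h) (ifh 0)).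
    by apply: eq_integrable => // z _; rewrite /= addr0.
  - by have := integrableD measurableT (iN h) (iN 0); apply: eq_integrable.
  - by move=> z _; rewrite addr0 (le_trans (ler_normB _ _)).
apply: (@le_trans _ _ (B * enorm h * fine (lam (eball (r + 1))))).
  apply: le_norm_Rintegral_bounded_support.
  - by rewrite mulr_ge0 ?enorm_ge0.
  - exact: measurable_funB.
  - by move=> x; rewrite (le_trans (fL x h))// ler_wpM2l// ge_min lexx orbT.
  - move=> z zr; rewrite !fr ?subrr//; first by lra.
    by have := enormD (z + h) (- h); rewrite addrK enormN; lra.
by rewrite mulrAC -/C1 ler_wpM2r ?enorm_ge0// lerDr mulr_ge0.
Qed.

Section one_scale.
Variables (eps : R) (eps_gt0 : 0 < eps).
Local Notation b := (@cube_bump R n eps).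
Local Notation M := (@bump_mass R n eps).
Local Notation rho := (n.+1%:R * eps + 2).

Let bump_far z : n.+1%:R * eps + 1 <= enorm z -> b z = 0.
Proof. by move=> zr; apply: bump_eq0 => //; lra. Qed.

Let bump_far1 z h : enorm h <= 1 -> rho <= enorm z -> b (z + h) = 0.
Proof.
move=> h1 zr; apply: bump_far.
by have := enormD (z + h) (- h); rewrite addrK enormN; lra.
Qed.

Let mb := @measurable_bump R n eps.

Let mbs h : measurable_fun setT (fun z => b (z + h)).
Proof. by apply: (measurableT_comp mb); exact: measurable_rVD. Qed.

Let ib h : lam.-integrable setT (EFin \o (fun z => b (z + h))).
Proof.
have [A A0 [HA _ _]] := tame_bump n eps.
apply: (@integrable_bounded_support _ _ _ A (n.+1%:R * eps + 1 + enorm h)) => //.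
move=> x xr; apply: bump_far.
by have := enormD (x + h) (- h); rewrite addrK enormN; lra.
Qed.

Let ibs h : \int[lam]_z b (z + h) = M.
Proof. by rewrite Rintegral_shift. Qed.

Lemma integral_diff_bump : exists2 C : R, 0 <= C &
  forall h, \int[lam]_z `|b (z + h) - b z| <= C * min1 h.
Proof.
have [A A0 [HA H1 _]] := tame_min1 (tame_bump n eps).
exact: (integral_diff_le mb A0 HA H1 bump_far).
Qed.

Lemma measurable_sdiff_bump h : measurable_fun setT (fun z => sdiff b z h).
Proof.
apply: measurable_funB; first by apply: measurable_funB => //; exact: measurable_funM.
by apply: (measurableT_comp mb); exact: measurable_rVB.
Qed.

Lemma integrable_sdiff_bump h :
  lam.-integrable setT (EFin \o (fun z => sdiff b z h)).
Proof.
have i0 := ib 0; have i1 := ib h; have i2 := ib (- h).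
have := integrableB measurableT (integrableB measurableT
  (integrableZl measurableT 2 i0) i1) i2.
by apply: eq_integrable => // z _; rewrite /= addr0.
Qed.

Lemma integral_sdiff_bump : exists2 C : R, 0 <= C &
  forall h, \int[lam]_z `|sdiff b z h| <= C * min1 h ^+ 2.
Proof.
have [A A0 [HA _ H2]] := tame_bump n eps.
have M0 := ltW (@bump_mass_gt0 R n eps eps_gt0).
pose C := A * fine (lam (eball rho)).
have C0 : 0 <= C by rewrite mulr_ge0// fine_ge0.
exists (C + 4 * M); first by rewrite addr_ge0// mulr_ge0.
move=> h; rewrite /min1; have [h1|h1] := leP 1 (enorm h).
  (* For long [h] the second difference is at most the sum of the three nonnegative terms, which
     have total mass [4 * M]. *)
  rewrite expr1n mulr1; apply: (@le_trans _ _ (4 * M)); last by rewrite lerDr.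
  have -> : 4 * M = 2 * (\int[lam]_z b (z + 0)) + \int[lam]_z b (z + h) + \int[lam]_z b (z + - h).
    by rewrite !ibs; ring.
  have i2 : lam.-integrable setT (EFin \o (fun z => 2 * b (z + 0))).
    by have := integrableZl measurableT 2 (ib 0); apply: eq_integrable.
  have i3 : lam.-integrable setT (EFin \o (fun z => 2 * b (z + 0) + b (z + h))).
    by have := integrableD measurableT i2 (ib h); apply: eq_integrable.
  rewrite -RintegralZl// -RintegralD// -RintegralD//.
  apply: le_Rintegral => //.
  - have := integrable_sdiff_bump h; move/integrable_norm.
    exact: eq_integrable.
  - have := integrableD measurableT i3 (ib (- h)).
    exact: eq_integrable.
  - move=> z _; rewrite addr0 /sdiff.
    have b0 := @bump_ge0 R n eps.
    rewrite ler_norml; apply/andP; split.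
      by have := b0 z; have := b0 (z + h); have := b0 (z - h); lra.
    by have := b0 z; have := b0 (z + h); have := b0 (z - h); lra.
apply: (@le_trans _ _ (A * enorm h ^+ 2 * fine (lam (eball rho)))).
  apply: le_norm_Rintegral_bounded_support => //.
  - by rewrite mulr_ge0 ?sqr_ge0.
  - exact: measurable_sdiff_bump.
  - move=> z zr; rewrite /sdiff bump_far1 ?(ltW h1)// bump_far; last by lra.
    by rewrite bump_far1 ?enormN ?(ltW h1)//; ring.
rewrite mulrAC -/C ler_wpM2r ?sqr_ge0// lerDl mulr_ge0//.
Qed.

(** The weight is, up to the mass, literally one of the test functions of the equation. *)
Definition moll (w : V -> R) y : R := M^-1 * \int[lam]_x (w x * b (x - y)).

Section one_function.
Variables (w : V -> R) (A : R).
Hypothesis mw : measurable_fun setT w.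
Hypothesis wA : forall x, `|w x| <= A.

Let A_ge0 : 0 <= A. Proof. exact: le_trans (wA 0). Qed.

Let M_gt0 : 0 < M. Proof. exact: bump_mass_gt0. Qed.

Let dominated_w (F : V -> R) : measurable_fun setT F ->
  lam.-integrable setT (EFin \o F) -> lam.-integrable setT (EFin \o (fun x => w x * F x)).
Proof.
move=> mF iF; apply: (@integrable_dominated _ _ _ (fun x => A * `|F x|)).
- exact: measurable_funM.
- by move=> x; rewrite normrM ler_wpM2r.
- by have := integrableZl measurableT A (integrable_norm iF); apply: eq_integrable.
Qed.

Let le_w (F : V -> R) (B : R) : measurable_fun setT F ->
  lam.-integrable setT (EFin \o F) -> \int[lam]_x `|F x| <= B ->
  `|\int[lam]_x (w x * F x)| <= A * B.
Proof.
move=> mF iF FB; have i1 := dominated_w mF iF.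
apply: (le_trans (le_normr_Rintegral measurableT i1)).
apply: (@le_trans _ _ (A * \int[lam]_x `|F x|)); last by rewrite ler_wpM2l.
have iN := integrable_norm iF.
rewrite -RintegralZl//; apply: le_Rintegral => //.
- by have := integrable_norm i1; apply: eq_integrable.
- by have := integrableZl measurableT A iN; apply: eq_integrable.
- by move=> x _; rewrite normrM ler_wpM2r.
Qed.

Let integrable_wb y : lam.-integrable setT (EFin \o (fun x => w x * b (x - y))).
Proof. exact: dominated_w. Qed.

Lemma moll_le y : `|moll w y| <= A.
Proof.
rewrite /moll normrM ger0_norm ?invr_ge0 ?(ltW M_gt0)// ler_pdivrMl// mulrC.
apply: le_w => //; rewrite -(ibs (- y)) le_eqVlt; apply/orP; left; apply/eqP.
by apply: eq_Rintegral => x _; rewrite ger0_norm// bump_ge0.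
Qed.

Lemma moll_diff y h :
  moll w (y + h) - moll w y = M^-1 * \int[lam]_x (w x * (b (x - y - h) - b (x - y))).
Proof.
rewrite /moll -mulrBr -RintegralB//; congr (_ * _).
by apply: eq_Rintegral => x _; rewrite -mulrBr opprD addrA.
Qed.

Lemma sdiff_mollE y h : sdiff (moll w) y h = M^-1 * \int[lam]_x (w x * sdiff b (x - y) h).
Proof.
rewrite /sdiff /moll mulrCA -!mulrBr; congr (_ * _).
have i2 : lam.-integrable setT (EFin \o (fun x => 2 * (w x * b (x - y)))).
  by have := integrableZl measurableT 2 (integrable_wb y); apply: eq_integrable.
have i3 : lam.-integrable setT
    (EFin \o (fun x => 2 * (w x * b (x - y)) - w x * b (x - (y + h)))).
  by have := integrableB measurableT i2 (integrable_wb (y + h)); apply: eq_integrable.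
rewrite -RintegralZl// -RintegralB// -RintegralB//.
apply: eq_Rintegral => x _.
have -> : x - (y + h) = x - y - h by rewrite opprD addrA.
have -> : x - (y - h) = x - y + h by rewrite opprB addrA addrAC.
ring.
Qed.

(** Since [w] is only bounded, all differences are moved onto the bump, and only the $L^1$ norms of
    its first and second differences enter. *)
Lemma tame_moll : tame (moll w).
Proof.
have [C1 C10 H1] := integral_diff_bump; have [C2 C20 H2] := integral_sdiff_bump.
have MV0 : 0 <= M^-1 by rewrite invr_ge0 ltW.
have P1 : 0 <= M^-1 * (A * C1) by rewrite !mulr_ge0.
have P2 : 0 <= M^-1 * (A * C2) by rewrite !mulr_ge0.
have m1 h : min1 h <= enorm h by rewrite ge_min lexx orbT.
exists (A + M^-1 * (A * C1) + M^-1 * (A * C2)); first by rewrite !addr_ge0.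
split.
- by move=> x; rewrite (le_trans (moll_le x))// -addrA lerDl addr_ge0.
- move=> y h; rewrite moll_diff normrM (ger0_norm MV0).
  apply: (@le_trans _ _ (M^-1 * (A * C1) * enorm h)); last first.
    by rewrite ler_wpM2r ?enorm_ge0// -addrA addrCA lerDl addr_ge0.
  rewrite -!mulrA ler_wpM2l//.
  apply: le_w.
  + by apply: measurable_funB => //; have := mbs (- y - h); under eq_fun do rewrite addrA.
  + have := integrableB measurableT (ib (- y - h)) (ib (- y)).
    by apply: eq_integrable => // x _; rewrite /= addrA.
  + apply: (@le_trans _ _ (C1 * min1 h)); last by rewrite ler_wpM2l.
    have -> : min1 h = min1 (- h) by rewrite /min1 enormN.
    apply: le_trans (H1 (- h)); rewrite le_eqVlt; apply/orP; left; apply/eqP.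
    rewrite -[RHS](@Rintegral_shift _ _ (- y)) //.
    by apply: (measurableT_comp (@normr_measurable R setT)); exact: measurable_funB.
- move=> y h; rewrite sdiff_mollE normrM (ger0_norm MV0).
  apply: (@le_trans _ _ (M^-1 * (A * C2) * enorm h ^+ 2)); last first.
    by rewrite ler_wpM2r ?sqr_ge0// lerDr addr_ge0.
  rewrite -!mulrA ler_wpM2l//.
  apply: le_w.
  + have := measurable_sdiff_bump h.
    by move/measurableT_comp; apply; exact: measurable_rVB.
  + have := integrable_sdiff_bump h; move=> /integrableP[mi oo]; apply/integrableP; split.
      by apply/measurable_EFinP; have := measurable_sdiff_bump h;
        move/measurableT_comp; apply; exact: measurable_rVB.
    rewrite (integral_shift (- y) (F := fun z => (`|(sdiff b z h)%:E|)%E))//.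
    exact: measurableT_comp.
  + apply: (@le_trans _ _ (C2 * min1 h ^+ 2)); last first.
      by rewrite ler_wpM2l// lerXn2r ?nnegrE ?min1_ge0 ?enorm_ge0.
    apply: le_trans (H2 h); rewrite le_eqVlt; apply/orP; left; apply/eqP.
    rewrite -[RHS](@Rintegral_shift _ _ (- y)) //.
    apply: (measurableT_comp (@normr_measurable R setT)); exact: measurable_sdiff_bump.
Qed.

Lemma moll_shiftE y : moll w y = M^-1 * \int[lam]_z (w (z + y) * b z).
Proof.
rewrite /moll; congr (_ * _).
rewrite -(Rintegral_shift y); first by apply: eq_Rintegral => z _; rewrite addrK.
by apply: measurable_funM.
Qed.

Lemma measurable_moll : measurable_fun setT (moll w).
Proof.
(* Adding [A] makes the integrand nonnegative, so that Tonelli gives measurability in the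
   parameter. *)
have -> : moll w = (fun y => M^-1 * \int[lam]_x ((w x + A) * b (x - y)) - A).
  apply/funext => y; rewrite /moll.
  have i1 : lam.-integrable setT (EFin \o (fun x => A * b (x - y))).
    by have := integrableZl measurableT A (ib (- y)); apply: eq_integrable.
  have -> : \int[lam]_x ((w x + A) * b (x - y)) = \int[lam]_x (w x * b (x - y)) + A * M.
    rewrite -(ibs (- y)) -RintegralZl// -RintegralD//.
    by apply: eq_Rintegral => x _; rewrite mulrDl.
  by rewrite mulrDr mulrCA mulVf ?gt_eqF// mulr1 addrK.
apply: measurable_funB => //; apply: measurable_funM => //.
apply: (measurableT_comp (@fine_measurable R setT measurableT)).
apply: (@measurable_integrall _ _ _ _ R lam (fun x y => ((w x + A) * b (x - y))%:E)) => /=.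
  apply/measurable_EFinP; apply: measurable_funM.
    by apply: measurable_funD => //; exact: (measurableT_comp mw).
  by apply: (measurableT_comp mb); exact: measurable_rVB.
move=> x y; rewrite lee_fin mulr_ge0 ?bump_ge0//.
by have := wA x; rewrite ler_norml; lra.
Qed.

End one_function.

(** Two different base points are allowed so that the monotonicity of a layer under translation
    passes to its mollification. *)
Lemma le_moll (w1 w2 : V -> R) (A : R) : measurable_fun setT w1 -> measurable_fun setT w2 ->
  (forall x, `|w1 x| <= A) -> (forall x, `|w2 x| <= A) ->
  forall y1 y2, (forall z, w1 (z + y1) <= w2 (z + y2)) -> moll w1 y1 <= moll w2 y2.
Proof.
move=> m1 m2 w1A w2A y1 y2 w12; rewrite !moll_shiftE//.
apply: ler_wpM2l; first by rewrite invr_ge0 ltW// bump_mass_gt0.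
have i (w : V -> R) y : measurable_fun setT w -> (forall x, `|w x| <= A) ->
    lam.-integrable setT (EFin \o (fun z => w (z + y) * b z)).
  move=> mw wA; have A0 : 0 <= A by exact: le_trans (wA 0).
  apply: (@integrable_dominated _ _ _ (fun x => A * b (x + 0))).
  - by apply: measurable_funM => //; apply: (measurableT_comp mw); exact: measurable_rVD.
  - by move=> x; rewrite addr0 normrM (ger0_norm (bump_ge0 _ _)) ler_wpM2r ?bump_ge0.
  - by have := integrableZl measurableT A (ib 0); apply: eq_integrable.
apply: le_Rintegral => //; [exact: i|exact: i|].
by move=> z _; rewrite ler_wpM2r ?bump_ge0.
Qed.

End one_scale.
End mollification.

(** * The mollified equation and its weak form *)

Section weak_formulation.
Context {R : realType} (n : nat).
Local Notation V := 'rV[R]_n.+1.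
Local Notation lam := (lebesgue_rV n.+1).
Implicit Types (x h y z : V).
Variables (mu : probability (measurableTypeR R) R) (s0 : R).
Hypothesis s0_gt0 : 0 < s0.
Local Notation k := (@levy_kernel R n mu s0).

Lemma EFin_Rintegral (f : V -> R) : lam.-integrable setT (EFin \o f) ->
  (\int[lam]_x (f x)%:E)%E = (\int[lam]_x f x)%:E.
Proof. by move=> fi; rewrite /Rintegral fineK//; exact: (integrable_fin_num _ fi). Qed.

Lemma integrable_prod_dominated (F : V -> V -> R) (G : V -> R) :
  measurable_fun setT (fun p : V * V => F p.1 p.2) ->
  (forall h, (\int[lam]_x `|F x h|%:E <= (G h)%:E)%E) ->
  lam.-integrable setT (EFin \o G) ->
  (lam \x lam)%E.-integrable setT (fun p => (F p.1 p.2)%:E).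
Proof.
move=> mF FG iG; apply: integrable_prodP => //.
have mN : measurable_fun setT (fun p : V * V => `|F p.1 p.2|%:E).
  by apply/measurable_EFinP; exact: (measurableT_comp (@normr_measurable R setT) mF).
rewrite (@integral_exchange _ _ _ _ R lam lam (fun x h => `|F x h|%:E))//.
apply: (le_lt_trans _ (integrable_lty measurableT iG)).
apply: ge0_le_integral => //.
- by move=> h _; apply: integral_ge0.
- exact: (@measurable_integrall _ _ _ _ R lam (fun x h => `|F x h|%:E)).
- exact: measurable_int iG.
Qed.

Let mk : measurable_fun setT k. Proof. exact: measurable_levy_kernel. Qed.

Let k_ge0 h : 0 <= k h. Proof. exact: levy_kernel_ge0. Qed.

Lemma measurable_comp_add (f : V -> R) : measurable_fun setT f ->
  measurable_fun setT (fun p : V * V => f (p.1 + p.2)).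
Proof. by move=> mf; apply: (measurableT_comp mf); exact: measurable_rVD. Qed.

Lemma measurable_comp_sub (f : V -> R) : measurable_fun setT f ->
  measurable_fun setT (fun p : V * V => f (p.1 - p.2)).
Proof. by move=> mf; apply: (measurableT_comp mf); exact: measurable_rVB. Qed.

Lemma measurable_diff2 (f : V -> R) : measurable_fun setT f ->
  measurable_fun setT (fun p : V * V => f (p.1 + p.2) - f p.1).
Proof.
move=> mf; apply: measurable_funB; first exact: measurable_comp_add.
exact: (measurableT_comp mf).
Qed.

Lemma measurable_sdiff2 (f : V -> R) : measurable_fun setT f ->
  measurable_fun setT (fun p : V * V => sdiff f p.1 p.2).
Proof.
move=> mf; apply: measurable_funB; last exact: measurable_comp_sub.
apply: measurable_funB; last exact: measurable_comp_add.
by apply: measurable_funM => //; exact: (measurableT_comp mf).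
Qed.

Let measurable_k2 : measurable_fun setT (fun p : V * V => k p.2).
Proof. exact: (measurableT_comp mk). Qed.

Lemma integral_norm_le (f g : V -> R) (c C : R) : 0 <= c -> measurable_fun setT g ->
  (forall x, `|g x| <= c * `|f x|) -> lam.-integrable setT (EFin \o f) ->
  \int[lam]_x `|f x| <= C -> (\int[lam]_x `|g x|%:E <= (c * C)%:E)%E.
Proof.
move=> c0 mg gf iF fC; have iN := integrable_norm iF.
have mf : measurable_fun setT f by apply/measurable_EFinP; exact: measurable_int iF.
apply: (@le_trans _ _ (\int[lam]_x (c * `|f x|)%:E)%E).
  apply: ge0_le_integral => //.
  - by apply/measurable_EFinP; exact: (measurableT_comp (@normr_measurable R setT) mg).
  - apply/measurable_EFinP; apply: measurable_funM => //.
    exact: (measurableT_comp (@normr_measurable R setT) mf).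
  - by move=> x _; rewrite lee_fin.
rewrite (@EFin_Rintegral (fun x => c * `|f x|)); last first.
  by have := integrableZl measurableT c iN; apply: eq_integrable.
by rewrite RintegralZl// lee_fin ler_wpM2l.
Qed.

Lemma integrable_sdiff_levy (f : V -> R) (A : R) y : measurable_fun setT f ->
  (forall h, `|sdiff f y h| <= A * min1 h ^+ 2) ->
  lam.-integrable setT (EFin \o (fun h => sdiff f y h * k h)).
Proof.
move=> mf fA; apply: (@integrable_dominated R n _ (fun h => A * (min1 h ^+ 2 * k h))).
- by apply: measurable_funM; [exact: measurable_sdiff|exact: mk].
- by move=> h; rewrite normrM (ger0_norm (k_ge0 h)) mulrA; exact: ler_wpM2r.
- exact: integrable_levy_min1.
Qed.

Section mollified_equation.
Variables (W : R -> R) (u : V -> R) (eps : R).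
Hypothesis mu_ : measurable_fun setT u.
Hypothesis u1 : forall x, `|u x| <= 1.
Hypothesis u_sol : distributional_solution mu s0 W u.
Hypothesis eps_gt0 : 0 < eps.
Local Notation b := (@cube_bump R n eps).
Local Notation M := (@bump_mass R n eps).

Let measurable_sdiff_shift y h : measurable_fun setT (fun x => sdiff b (x - y) h).
Proof.
have := @measurable_sdiff_bump R n eps h.
by move/measurableT_comp; apply; exact: measurable_rVB.
Qed.

Let integrable_sdiff_shift y h :
  lam.-integrable setT (EFin \o (fun x => sdiff b (x - y) h)).
Proof.
have /integrableP[mi oo] := @integrable_sdiff_bump R n eps eps_gt0 h.
apply/integrableP; split; first exact/measurable_EFinP.
rewrite (integral_shift (- y) (F := fun z => (`|(sdiff b z h)%:E|)%E))//.
exact: measurableT_comp.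
Qed.

Let integral_sdiff_shift y h :
  \int[lam]_x `|sdiff b (x - y) h| = \int[lam]_x `|sdiff b x h|.
Proof.
rewrite -[RHS](@Rintegral_shift _ _ (- y)) //.
apply: (measurableT_comp (@normr_measurable R setT)); exact: measurable_sdiff_bump.
Qed.

(* The equation tested against the translates of the bump function. *)
Lemma moll_equation y :
  2 * \int[lam]_h (sdiff (moll eps u) y h * k h) = - moll eps (fun x => derive1 W (u x)) y.
Proof.
have M0 := @bump_mass_gt0 R n eps eps_gt0.
have mb := @measurable_bump R n eps.
have := u_sol (test_function_bump y eps_gt0).
have [B B0 [b0 _ b2]] := tame_min1 (tame_bump n eps).
have mby : measurable_fun setT (fun x => b (x - y)).
  by apply: (measurableT_comp mb); exact: measurable_rVB.
have E x h : sdiff (fun x => b (x - y)) x h = sdiff b (x - y) h.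
  by rewrite /sdiff; congr (_ - b _ - b _); rewrite addrAC.
have bE x : sum_frac_laplacian mu s0 (fun x => b (x - y)) x =
    2 * \int[lam]_h (sdiff b (x - y) h * k h).
  have b2' x' h : `|sdiff (fun x => b (x - y)) x' h| <= B * min1 h ^+ 2 by rewrite E.
  apply: etrans (sum_frac_laplacianE mby (fun x' => b0 (x' - y)) b2' mu s0_gt0 x) _.
  apply: (congr1 ( *%R 2)); apply: eq_Rintegral => h _.
  exact: (congr1 ( *%R^~ (k h)) (E x h)).
have [C C0 HC] := @integral_sdiff_bump R n eps eps_gt0.
(* Exchanging the integrals in [x] and [h] moves the operator from the bump to the mollification of
   [u]. It is allowed because the $L^1$ norm in [x] of the second difference of the bump is at most
   a multiple of [min1 h ^+ 2]. *)
pose F x h := u x * (2 * (sdiff b (x - y) h * k h)).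
have iF : (lam \x lam)%E.-integrable setT (fun p => (F p.1 p.2)%:E).
  apply: (@integrable_prod_dominated _ (fun h => 2 * C * (min1 h ^+ 2 * k h))).
  - apply: measurable_funM; first exact: (measurableT_comp mu_).
    apply: measurable_funM => //; apply: measurable_funM => //.
    have mp : measurable_fun setT (fun p : V * V => (p.1 - y, p.2)).
      by apply: measurable_fun_pair => //; apply: measurable_rVB.
    exact: (measurableT_comp (measurable_sdiff2 mb) mp).
  - move=> h; rewrite [X in (_ <= X%:E)%E](_ : _ = 2 * k h * (C * min1 h ^+ 2)); last by ring.
    apply: (@integral_norm_le (fun x => sdiff b (x - y) h)) => //.
    + by rewrite mulr_ge0.
    + apply: measurable_funM; first exact: mu_.
      apply: measurable_funM; first exact: measurable_cst.
      by apply: measurable_funM; [exact: measurable_sdiff_shift|exact: measurable_cst].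
    + move=> x; rewrite /F !normrM (ger0_norm (k_ge0 h)) normr_nat.
      rewrite (_ : _ * _ = `|u x| * (2 * k h * `|sdiff b (x - y) h|)); last by ring.
      by rewrite ler_piMl// mulr_ge0// mulr_ge0.
    + by rewrite integral_sdiff_shift.
  - exact: integrable_levy_min1.
have i1 x : lam.-integrable setT (EFin \o (fun h => sdiff b (x - y) h * k h)).
  exact: integrable_sdiff_levy mb (b2 (x - y)).
have [B' B'0 [_ _ m2]] := tame_min1 (tame_moll eps_gt0 mu_ u1).
have i2 : lam.-integrable setT (EFin \o (fun h => sdiff (moll eps u) y h * k h)).
  exact: integrable_sdiff_levy (measurable_moll eps_gt0 mu_ u1) (m2 y).
have -> : \int[lam]_x (u x * sum_frac_laplacian mu s0 (fun x => b (x - y)) x) =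
    \int[lam]_x \int[lam]_h F x h.
  apply: eq_Rintegral => x _; rewrite bE /F -RintegralZl// -RintegralZl//.
  by have := integrableZl measurableT 2 (i1 x); apply: eq_integrable.
rewrite (Rintegral_exchange iF).
have -> : \int[lam]_h \int[lam]_x F x h =
    2 * M * \int[lam]_h (sdiff (moll eps u) y h * k h).
  rewrite -RintegralZl//; apply: eq_Rintegral => h _.
  rewrite (sdiff_mollE eps_gt0 mu_ u1) [RHS](_ : _ =
    2 * k h * \int[lam]_x (u x * sdiff b (x - y) h)); last by field; rewrite gt_eqF.
  rewrite -RintegralZl//; first by apply: eq_Rintegral => x _; rewrite /F; ring.
  apply: integrable_dominated (integrable_norm (integrable_sdiff_shift y h)).
    exact: measurable_funM.
  by move=> x; rewrite normrM ler_piMl.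
rewrite /moll => H; rewrite -mulrN.
apply: (mulfI (lt0r_neq0 M0)); rewrite mulVKf ?gt_eqF//.
by rewrite mulrA [M * 2]mulrC; apply/eqP; rewrite -addr_eq0; apply/eqP.
Qed.

End mollified_equation.

Section weak_form.
Variables (f g xi : V -> R) (B r : R).
Hypothesis f_tame : tame f.
Hypothesis mf : measurable_fun setT f.
Hypothesis f_eq : forall y, 2 * \int[lam]_h (sdiff f y h * k h) = - g y.
Hypothesis mxi : measurable_fun setT xi.
Hypothesis B_ge0 : 0 <= B.
Hypothesis xiB : forall x, `|xi x| <= B.
Hypothesis xiL : forall x h, `|xi (x + h) - xi x| <= B * min1 h.
Hypothesis xi_supp : forall x, r <= enorm x -> xi x = 0.

Let ixi : lam.-integrable setT (EFin \o xi).
Proof. exact: integrable_bounded_support xi_supp. Qed.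

Let mdxi h : measurable_fun setT (fun x => xi (x + h) - xi x).
Proof.
by apply: measurable_funB => //; apply: (measurableT_comp mxi); exact: measurable_rVD.
Qed.

Let mdf h : measurable_fun setT (fun x => f (x + h) - f x).
Proof.
by apply: measurable_funB => //; apply: (measurableT_comp mf); exact: measurable_rVD.
Qed.

Let ixih h : lam.-integrable setT (EFin \o (fun x => xi (x + h))).
Proof.
apply: (@integrable_bounded_support _ _ _ B (r + enorm h)) => //.
  by apply: (measurableT_comp mxi); exact: measurable_rVD.
move=> x xr; apply: xi_supp.
by have := enormD (x + h) (- h); rewrite addrK enormN; lra.
Qed.

Let idxi h : lam.-integrable setT (EFin \o (fun x => xi (x + h) - xi x)).
Proof. by have := integrableB measurableT (ixih h) ixi; apply: eq_integrable. Qed.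

(** For fixed [h] the difference of [w] is at most a multiple of [min1 h] pointwise, and that of the
    compactly supported [xi] is so in $L^1$; together they give the weight [min1 h ^+ 2]. *)
Lemma integrable_pairing (w : V -> R) (A : R) : measurable_fun setT w ->
  (forall x h, `|w (x + h) - w x| <= A * min1 h) ->
  (lam \x lam)%E.-integrable setT
    (fun p => ((w (p.1 + p.2) - w p.1) * (xi (p.1 + p.2) - xi p.1) * k p.2)%:E).
Proof.
move=> mw wA; have [C C0 HC] := integral_diff_le mxi B_ge0 xiB xiL xi_supp.
have A0 : 0 <= Num.max A 0 by rewrite le_max lexx orbT.
apply: (@integrable_prod_dominated
  (fun x h => (w (x + h) - w x) * (xi (x + h) - xi x) * k h)
  (fun h => Num.max A 0 * C * (min1 h ^+ 2 * k h))).
- by apply: measurable_funM => //; apply: measurable_funM; exact: measurable_diff2.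
- move=> h; rewrite [X in (_ <= X%:E)%E](_ : _ =
    (Num.max A 0 * min1 h * k h) * (C * min1 h)); last by ring.
  have P0 : 0 <= Num.max A 0 * min1 h by rewrite mulr_ge0 ?min1_ge0.
  apply: (@integral_norm_le (fun x => xi (x + h) - xi x)) => //.
  + by rewrite mulr_ge0.
  + apply: measurable_funM; last exact: measurable_cst.
    apply: measurable_funM; last exact: mdxi.
    by apply: measurable_funB => //; apply: (measurableT_comp mw); exact: measurable_rVD.
  + move=> x; rewrite !normrM (ger0_norm (k_ge0 h)) mulrAC ler_wpM2r//.
    rewrite ler_wpM2r// (le_trans (wA x h))// ler_wpM2r ?min1_ge0// le_max lexx//.
- exact: integrable_levy_min1.
Qed.

(** For fixed [h] a translation of [x] turns the product of differences into [xi] times the second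
    difference of [f]. Integrating in [h] first then gives the equation, and the factor 2 in [f_eq]
    becomes $-1/2$. *)
Lemma weak_equation :
  \int[(lam \x lam)%E]_p ((f (p.1 + p.2) - f p.1) * (xi (p.1 + p.2) - xi p.1) * k p.2) =
  - 2^-1 * \int[lam]_x (xi x * g x).
Proof.
have [A A0 [fA f1 f2]] := tame_min1 f_tame.
have iP := integrable_pairing mf f1.
apply: (etrans (Rintegral_prodE' (f := fun x h =>
  (f (x + h) - f x) * (xi (x + h) - xi x) * k h) iP)).
pose F x h := xi x * (sdiff f x h * k h).
have iF : (lam \x lam)%E.-integrable setT (fun p => (F p.1 p.2)%:E).
  apply: (@integrable_prod_dominated _
    (fun h => (A * \int[lam]_x `|xi x|) * (min1 h ^+ 2 * k h))).
  - apply: measurable_funM; first exact: (measurableT_comp mxi).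
    by apply: measurable_funM => //; exact: measurable_sdiff2.
  - move=> h; rewrite [X in (_ <= X%:E)%E](_ : _ =
      (A * min1 h ^+ 2 * k h) * \int[lam]_x `|xi x|); last by ring.
    apply: (@integral_norm_le xi) => //.
    + by apply: mulr_ge0 => //; apply: mulr_ge0 => //; exact: sqr_ge0.
    + apply: measurable_funM; first exact: mxi.
      apply: measurable_funM; last exact: measurable_cst.
      have m1 : measurable_fun setT (fun x : V => (x, h)) by apply: measurable_fun_pair.
      exact: (measurableT_comp (measurable_sdiff2 mf) m1).
    + move=> x; rewrite /F !normrM (ger0_norm (k_ge0 h)) mulrC ler_wpM2r//.
      by rewrite ler_wpM2r.
  - exact: integrable_levy_min1.
have i2 y : lam.-integrable setT (EFin \o (fun h => sdiff f y h * k h)).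
  exact: integrable_sdiff_levy mf (f2 y).
transitivity (\int[lam]_h \int[lam]_x F x h).
  apply: eq_Rintegral => h _.
  have bd (w v : V -> R) (a : R) : measurable_fun setT w -> measurable_fun setT v ->
      (forall x, `|w x| <= a) ->
      lam.-integrable setT (EFin \o v) -> lam.-integrable setT (EFin \o (fun x => w x * v x)).
    move=> mw mv wa iv; apply: (@integrable_dominated _ _ _ (fun x => a * `|v x|)).
    - exact: measurable_funM.
    - by move=> x; rewrite normrM ler_wpM2r.
    - by have := integrableZl measurableT a (integrable_norm iv); apply: eq_integrable.
  pose D1 x := (f (x + h) - f x) * xi (x + h); pose D2 x := (f (x + h) - f x) * xi x.
  pose D3 x := (f x - f (x - h)) * xi x.
  have mfm : measurable_fun setT (fun x => f x - f (x - h)).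
    by apply: measurable_funB => //; apply: (measurableT_comp mf); exact: measurable_rVB.
  have mD3 : measurable_fun setT D3 by exact: measurable_funM.
  have iD1 : lam.-integrable setT (EFin \o D1).
    apply: (bd _ _ (A * min1 h)) => //.
    by apply: (measurableT_comp mxi); exact: measurable_rVD.
  have iD2 : lam.-integrable setT (EFin \o D2) by exact: (bd _ _ (A * min1 h)).
  have iD3 : lam.-integrable setT (EFin \o D3).
    apply: (bd _ _ (A * min1 h)) => // x.
    by have := f1 (x - h) h; rewrite subrK.
  have E : \int[lam]_x ((f (x + h) - f x) * (xi (x + h) - xi x)) =
      \int[lam]_x D3 x - \int[lam]_x D2 x.
    rewrite -[\int[lam]_x D3 x](@Rintegral_shift _ _ h)// -RintegralB//; last first.
      by move: iD1; apply: eq_integrable => // x _; rewrite /= /D3 addrK.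
    by apply: eq_Rintegral => x _; rewrite /D3 /D2 addrK mulrBr.
  have i3 : lam.-integrable setT (EFin \o (fun x => (f (x + h) - f x) * (xi (x + h) - xi x))).
    by apply: (bd _ _ (A * min1 h)); [exact: mdf|exact: mdxi|by []|exact: idxi].
  rewrite RintegralZr// E -RintegralB// -RintegralZr//; last first.
    by have := integrableB measurableT iD3 iD2; apply: eq_integrable.
  by apply: eq_Rintegral => x _; rewrite /F /D3 /D2 /sdiff; ring.
have E x : \int[lam]_h F x h = - 2^-1 * (xi x * g x).
  apply: (etrans (RintegralZl (xi x) measurableT (i2 x))).
  by have /(congr1 (fun t => 2^-1 * t)) := f_eq x; rewrite mulKf// => ->; ring.
(* The integrability of [xi * g] is read off from that of [F] through the equation. *)
have ig : lam.-integrable setT (EFin \o (fun x => xi x * g x)).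
  have := integrableZl measurableT (-2) (integrable_fubini_F iF).
  apply: eq_integrable => // x _; rewrite /fubini_F /= (@EFin_Rintegral (F x)); last first.
    by have := integrableZl measurableT (xi x) (i2 x); apply: eq_integrable.
  by rewrite E -EFinM; congr EFin; field.
rewrite -(Rintegral_exchange iF) -RintegralZl//.
by apply: eq_Rintegral => x _; exact: E.
Qed.

End weak_form.
End weak_formulation.

(** * The energy comparison for mollified layers *)

Section layers.
Context {R : realType} (n : nat).
Local Notation V := 'rV[R]_n.+1.
Local Notation e := (delta_mx ord0 ord_max : V).
Variables (mu : probability (measurableTypeR R) R) (s0 : R) (W : R -> R) (u : V -> R).
Hypothesis u_layer : layer_solution mu s0 W u.

Let is_derive_path (x : V) (t : R) :
  is_derive t 1 (fun t : R => u (x + t *: e)) ('D_e u (x + t *: e)).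
Proof.
have [_ _ /(_ (x + t *: e))[du _] _] := u_layer.
have E : (fun h : R => h^-1 *: (u (x + (h *: 1 + t) *: e) - u (x + t *: e))) =
    (fun h : R => h^-1 *: (u (h *: e + (x + t *: e)) - u (x + t *: e))).
  apply/funext => h; congr (_ *: (u _ - _)).
  by rewrite [h *: (1 : R)]mulr1 scalerDl addrCA.
have c : (h^-1 *: (u (x + (h *: 1 + t) *: e) - u (x + t *: e))) @[h --> (0 : R)^'] -->
    'D_e u (x + t *: e) by rewrite E; exact: du.
by split; [apply/cvg_ex; exists ('D_e u (x + t *: e))|apply/cvg_lim].
Qed.

Lemma layer_continuous (x : V) : continuous (fun t : R => u (x + t *: e)).
Proof.
move=> t; apply: differentiable_continuous; apply/derivable1_diffP.
by have [] := is_derive_path x t.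
Qed.

Lemma layer_le (x : V) (t : R) : 0 <= t -> u x <= u (x + t *: e).
Proof.
move=> t0; have [_ _ du _] := u_layer.
have := @ger0_derive1_ndecr R (fun t : R => u (x + t *: e)) 0 t.
move=> /(_ _ _ _ 0 t); rewrite scale0r addr0; apply => //.
- by move=> s _; have [] := is_derive_path x s.
- move=> s _; rewrite derive1E; have [_ ->] := is_derive_path x s.
  by have [] := du (x + s *: e).
- exact: continuous_subspaceT (@layer_continuous x).
Qed.

Lemma layer_nondecreasing (x : V) : {homo (fun t : R => u (x + t *: e)) : s t / s <= t}.
Proof.
move=> s t st; have := @layer_le (x + s *: e) (t - s).
by rewrite subr_ge0 -addrA -scalerDl [s + _]addrC subrK; exact.
Qed.

Let unsnocE (x : V) (t : R) :
  x + t *: e = rV_snoc ((rV_unsnoc x).1, x ord0 ord_max + t).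
Proof.
apply/rowP => i; rewrite !mxE /=; case: (unliftP ord_max i) => [j|] ->.
  by rewrite /= mxE eq_sym (negPf (neq_lift _ _)) mulr0 addr0.
by rewrite /= eqxx mulr1.
Qed.

Lemma layer_cvg (x : V) : u (x + t *: e) @[t --> +oo] --> (1 : R).
Proof.
have [_ _ _ /(_ (rV_unsnoc x).1)[cp _]] := u_layer.
under eq_fun do rewrite unsnocE.
by apply: (cvg_comp _ _ _ cp); exact: cvg_addrl.
Qed.

Lemma layer_cvgNy (x : V) : u (x + t *: e) @[t --> -oo] --> (-1 : R).
Proof.
have [_ _ _ /(_ (rV_unsnoc x).1)[_ cp]] := u_layer.
under eq_fun do rewrite unsnocE.
by apply: (cvg_comp _ _ _ cp); exact: cvg_addrl_Ny.
Qed.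

Lemma layer_bounded (x : V) : `|u x| <= 1.
Proof.
have E : u x = u (x + (0 : R) *: e) by rewrite scale0r addr0.
rewrite ler_norml E; apply/andP; split.
- rewrite -(cvg_lim _ (@layer_cvgNy x))//; apply: limr_le.
    by apply/cvg_ex; exists (-1); exact: layer_cvgNy.
  near=> t; apply: layer_nondecreasing; near: t.
  exact: nbhs_ninfty_le.
- rewrite -(cvg_lim _ (@layer_cvg x))//; apply: limr_ge.
    by apply/cvg_ex; exists 1; exact: layer_cvg.
  near=> t; apply: layer_nondecreasing; near: t.
  exact: nbhs_pinfty_ge.
Unshelve. all: by end_near.
Qed.

End layers.

Section lipschitz.
Context {R : realType} (n : nat).
Local Notation V := 'rV[R]_n.+1.

(** The increments of the deformation are made with [min] and [max], so they are only Lipschitz; the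
    weak equation asks no more of what it is tested with. *)
Definition lip_min1 (f : V -> R) := exists2 A : R, 0 <= A &
  forall x h, `|f (x + h) - f x| <= A * min1 h.

Lemma tame_lip_min1 f : tame f -> lip_min1 f.
Proof. by move=> /tame_min1[A A0 [_ fA _]]; exists A. Qed.

Lemma lip_min1_cst c : lip_min1 (fun=> c).
Proof. by exists 0 => // x h; rewrite subrr normr0 mul0r. Qed.

Lemma lip_min1_shift f (a : V) : lip_min1 f -> lip_min1 (fun x => f (x + a)).
Proof. by move=> [A A0 fA]; exists A => // x h; rewrite addrAC. Qed.

Lemma lip_min1_op2 (op : R -> R -> R) f g :
  (forall a b c d, `|op a b - op c d| <= `|a - c| + `|b - d|) ->
  lip_min1 f -> lip_min1 g -> lip_min1 (fun x => op (f x) (g x)).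
Proof.
move=> opP [A A0 fA] [B B0 gB]; exists (A + B); first exact: addr_ge0.
by move=> x h; rewrite (le_trans (opP _ _ _ _))// mulrDl lerD.
Qed.

Lemma dist_max (a b c d : R) : `|Num.max a b - Num.max c d| <= `|a - c| + `|b - d|.
Proof.
have := ler_norm (a - c); have := ler_norm (c - a); rewrite distrC => h1 h2.
have := ler_norm (b - d); have := ler_norm (d - b); rewrite distrC => h3 h4.
by rewrite ler_norml; case: (leP a b); case: (leP c d) => ? ?; lra.
Qed.

Lemma dist_min (a b c d : R) : `|Num.min a b - Num.min c d| <= `|a - c| + `|b - d|.
Proof.
have := ler_norm (a - c); have := ler_norm (c - a); rewrite distrC => h1 h2.
have := ler_norm (b - d); have := ler_norm (d - b); rewrite distrC => h3 h4.
by rewrite ler_norml; case: (leP a b); case: (leP c d) => ? ?; lra.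
Qed.

Lemma dist_sub (a b c d : R) : `|(a - b) - (c - d)| <= `|a - c| + `|b - d|.
Proof. by rewrite (_ : _ - _ = (a - c) - (b - d)) ?ler_normB//; ring. Qed.

End lipschitz.

(** * The comparison at a pair of points *)

Section cutoffs.
Context {R : realType}.
Implicit Types (a b : nat -> R) (p q : R).

(** One point of space: [a j] is the value of the [j]-th translate and [p] that of the cutoff
    function. The sequence starts at [a 0] and stops at the competitor [max (a 0) p]. *)
Definition cutoff a p (j : nat) : R := Num.min (Num.max (a 0%N) p) (a j).

Definition increment a p (j : nat) : R := cutoff a p j.+1 - cutoff a p j.

(** Used to cancel the square of the layer at the pairs of points where it is not to be
    estimated. *)
Lemma sqr_max_le (x y p q : R) :
  (Num.max y q - Num.max x p) ^+ 2 <= (y - x) ^+ 2 + (q - p) ^+ 2.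
Proof.
have [yq|qy] := leP y q; have [xp|px] := leP x p.
- by rewrite lerDr sqr_ge0.
- have [qx|xq] := leP q x; first by have := sqr_ge0 (q - p); nra.
  by have := sqr_ge0 (y - x); nra.
- have [yp|py] := leP y p; first by have := sqr_ge0 (y - x); nra.
  by have := sqr_ge0 (q - p); nra.
- by rewrite lerDl sqr_ge0.
Qed.

Lemma increment_ge0 a p j : a j <= a j.+1 -> 0 <= increment a p j.
Proof.
move=> aj; rewrite subr_ge0 /cutoff le_min ge_min lexx/=.
by rewrite ge_min aj orbT.
Qed.

(** While the translate is below the target the deformation sits on it and there is no slack; once
    it is above, the deformation has stopped and there is no increment. *)
Lemma slack_increment a p j : a j <= a j.+1 ->
  (a j - cutoff a p j) * increment a p j = 0.
Proof.
rewrite /increment /cutoff; set v := Num.max _ _ => aj.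
have [vj|jv] := leP v (a j); last by rewrite subrr mul0r.
by rewrite min_l ?(le_trans vj)// subrr mulr0.
Qed.

(* The slack a j - cutoff a p j is nonnegative and vanishes wherever the increment does
   not, so that replacing a by its cutoff only increases the product of differences. *)
Lemma increment_diff_le a b p q j : a j <= a j.+1 -> b j <= b j.+1 ->
  (b j - a j) * (increment b q j - increment a p j) *+ 2 <=
  (cutoff b q j.+1 - cutoff a p j.+1) ^+ 2 - (cutoff b q j - cutoff a p j) ^+ 2.
Proof.
move=> aj bj.
have a0 := increment_ge0 p aj; have b0 := increment_ge0 q bj.
have sa := slack_increment p aj; have sb := slack_increment q bj.
have wa : 0 <= a j - cutoff a p j by rewrite subr_ge0 ge_min lexx orbT.
have wb : 0 <= b j - cutoff b q j by rewrite subr_ge0 ge_min lexx orbT.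
have ab := mulr_ge0 wa b0; have ba := mulr_ge0 wb a0.
have := sqr_ge0 (increment b q j - increment a p j).
have -> : cutoff b q j.+1 = cutoff b q j + increment b q j by rewrite /increment addrC subrK.
have -> : cutoff a p j.+1 = cutoff a p j + increment a p j by rewrite /increment addrC subrK.
move: (increment a p j) (increment b q j) (cutoff a p j) (cutoff b q j) (a j) (b j) sa sb ab ba
  => x y s t a' b' sa sb ab ba; rewrite -mulr_natl; nra.
Qed.

Lemma cutoff_sum_le a b p q N : (forall j, (j < N)%N -> a j <= a j.+1) ->
  (forall j, (j < N)%N -> b j <= b j.+1) -> Num.max (a 0%N) p <= a N -> Num.max (b 0%N) q <= b N ->
  (b 0%N - a 0%N) ^+ 2 + 2 * \sum_(j < N) (b j - a j) * (increment b q j - increment a p j) <=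
  (Num.max (b 0%N) q - Num.max (a 0%N) p) ^+ 2.
Proof.
move=> aj bj aN bN.
have c0 c t : cutoff c t 0 = c 0%N by rewrite /cutoff min_r// le_max lexx.
have cN c t : Num.max (c 0%N) t <= c N -> cutoff c t N = Num.max (c 0%N) t.
  by move=> h; rewrite /cutoff min_l.
rewrite -(cN a p aN) -(cN b q bN) -{1}(c0 a p) -{1}(c0 b q) -lerBrDl.
rewrite -(telescope_sumr (fun j => (cutoff b q j - cutoff a p j) ^+ 2) (leq0n N)) big_mkord.
rewrite mulr_sumr; apply: ler_sum => j _.
by rewrite mulr_natl; apply: increment_diff_le; [exact: aj|exact: bj].
Qed.

(** If [p = q = 1] the competitor is 1 at both points, its square vanishes, and the square of the
    layer survives on the left; otherwise [sqr_max_le] cancels that square. Either way the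
    right-hand side is free of it, and therefore integrable later. *)
Lemma competitor_le a b p q N : (forall j, (j < N)%N -> a j <= a j.+1) ->
  (forall j, (j < N)%N -> b j <= b j.+1) -> Num.max (a 0%N) p <= a N -> Num.max (b 0%N) q <= b N ->
  a 0%N <= 1 -> b 0%N <= 1 ->
  ((p == 1) && (q == 1))%:R * (b 0%N - a 0%N) ^+ 2 <= (q - p) ^+ 2 -
  2 * \sum_(j < N) (b j - a j) * (increment b q j - increment a p j).
Proof.
move=> aj bj aN bN a1 b1; have := cutoff_sum_le aj bj aN bN.
case: eqP => [->|_]; first case: eqP => [->|_].
- by rewrite !max_r// subrr expr0n/= !mul1r; lra.
- by have := sqr_max_le (a 0%N) (b 0%N) 1 q; rewrite mul0r; lra.
- by have := sqr_max_le (a 0%N) (b 0%N) p q; rewrite mul0r; lra.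
Qed.

End cutoffs.

(** * Continuity of translations in $L^1_{loc}$ *)

Section translation_continuity.
Context {R : realType} (n : nat).
Local Notation V := 'rV[R]_n.+1.
Local Notation lam := (lebesgue_rV n.+1).
Implicit Types (x z : V) (f g h : V -> R) (S : set V).

Definition L1ball (rho : R) f : \bar R := \int[lam]_x (\1_(eball rho) x * `|f x|)%:E.

Let measurable_L1 rho f : measurable_fun setT f ->
  measurable_fun setT (fun x => (\1_(eball rho) x * `|f x|)%:E).
Proof.
move=> mf; apply/measurable_EFinP; apply: measurable_funM.
  by apply: measurable_indic; exact: measurable_eball.
exact: (measurableT_comp (@normr_measurable R setT) mf).
Qed.

Let L1_ge0 rho f x : (0 <= (\1_(eball rho) x * `|f x|)%:E)%E.
Proof. by rewrite lee_fin mulr_ge0. Qed.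

Lemma L1ball_ge0 rho f : (0 <= L1ball rho f)%E.
Proof. exact: integral_ge0. Qed.

Lemma L1ball_le rho f g : measurable_fun setT f -> measurable_fun setT g ->
  (forall x, enorm x < rho -> `|f x| <= `|g x|) -> (L1ball rho f <= L1ball rho g)%E.
Proof.
move=> mf mg fg; apply: ge0_le_integral => //; [exact: measurable_L1|exact: measurable_L1|].
move=> x _; rewrite lee_fin indicE; case: (boolP (x \in _)) => [|_]; last by rewrite !mul0r.
by rewrite inE => /fg; rewrite !mul1r.
Qed.

Lemma L1ballD rho f g : measurable_fun setT f -> measurable_fun setT g ->
  (L1ball rho (fun x => `|f x| + `|g x|)%R = L1ball rho f + L1ball rho g)%E.
Proof.
move=> mf mg; rewrite /L1ball -ge0_integralD//; [|exact: measurable_L1|exact: measurable_L1].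
by apply: eq_integral => x _; rewrite -EFinD -mulrDr ger0_norm ?addr_ge0.
Qed.

Lemma measurable_normD f g : measurable_fun setT f -> measurable_fun setT g ->
  measurable_fun setT (fun x => `|f x| + `|g x|).
Proof.
by move=> mf mg; apply: measurable_funD; exact: (measurableT_comp (@normr_measurable R setT)).
Qed.

Lemma L1ball_le_sum rho f g h : measurable_fun setT f -> measurable_fun setT g ->
  measurable_fun setT h -> (forall x, enorm x < rho -> `|f x| <= `|g x| + `|h x|) ->
  (L1ball rho f <= L1ball rho g + L1ball rho h)%E.
Proof.
move=> mf mg mh fgh; rewrite -L1ballD//; apply: L1ball_le => //.
  exact: measurable_normD.
by move=> x /fgh fx; apply: (le_trans fx); exact: ler_norm.
Qed.

Lemma L1ball_shift rho rho' f z : measurable_fun setT f -> rho + enorm z <= rho' ->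
  (L1ball rho (fun x => f (x + z)%R) <= L1ball rho' f)%E.
Proof.
move=> mf rz; rewrite /L1ball -[leRHS](ge0_integral_shift z)//; last exact: measurable_L1.
apply: ge0_le_integral => //.
- by apply: measurable_L1; apply: (measurableT_comp mf); exact: measurable_rVD.
- have mz : measurable_fun setT (fun x : V => x + z) by exact: measurable_rVD.
  exact: (measurableT_comp (measurable_L1 rho' mf) mz).
- move=> x _; rewrite lee_fin ler_wpM2r//.
  rewrite !indicE; case: (boolP (x \in _)) => //; rewrite inE /eball/= => xr.
  by rewrite mem_set// /eball/= (le_lt_trans (enormD x z)) ?(lt_le_trans _ rz) ?ltrD2r.
Qed.

Lemma L1ballZ rho f c : measurable_fun setT f ->
  (L1ball rho (fun x => c * f x)%R = `|c|%:E * L1ball rho f)%E.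
Proof.
move=> mf; rewrite /L1ball -ge0_integralZl_EFin//; last exact: measurable_L1.
by apply: eq_integral => x _; rewrite -EFinM normrM mulrCA.
Qed.

Lemma L1ball_indic rho S : measurable S -> L1ball rho \1_S = lam (eball rho `&` S).
Proof.
move=> mS; have mB := @measurable_eball R n.+1 rho.
rewrite -[X in lam X]setIT -integral_indic//; last exact: measurableI.
by apply: eq_integral => x _; rewrite ger0_norm// indicI.
Qed.

Lemma L1ball_cst rho c : L1ball rho (cst c) = (`|c|%:E * lam (eball rho))%E.
Proof.
have -> : cst c = (fun x : V => c * \1_[set: V] x).
  by apply/funext => x; rewrite indicT mulr1.
by rewrite L1ballZ// L1ball_indic// setIT.
Qed.

Definition translation_continuous f := forall rho eps : R, 0 < eps ->
  exists2 d : R, 0 < d & forall z, enorm z <= d ->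
    (L1ball rho (fun x => f (x + z) - f x)%R <= eps%:E)%E.

Let mshift f z : measurable_fun setT f -> measurable_fun setT (fun x => f (x + z) - f x).
Proof.
by move=> mf; apply: measurable_funB => //; apply: (measurableT_comp mf); exact: measurable_rVD.
Qed.

Lemma translation_continuous_sub f g h : measurable_fun setT f -> measurable_fun setT g ->
  measurable_fun setT h ->
  (forall x z, `|f (x + z) - f x| <= `|g (x + z) - g x| + `|h (x + z) - h x|) ->
  translation_continuous g -> translation_continuous h -> translation_continuous f.
Proof.
move=> mf mg mh fgh tg th rho eps e0; have e2 : 0 < eps / 2 by rewrite divr_gt0.
have [d1 d10 H1] := tg rho _ e2; have [d2 d20 H2] := th rho _ e2.
exists (Num.min d1 d2); first by rewrite lt_min d10.
move=> z; rewrite le_min => /andP[z1 z2]; rewrite [eps]splitr EFinD.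
apply: (le_trans _ (leeD (H1 _ z1) (H2 _ z2))).
by apply: L1ball_le_sum => //; exact: mshift.
Qed.

Lemma translation_continuousZ f c : measurable_fun setT f ->
  translation_continuous f -> translation_continuous (fun x => c * f x).
Proof.
move=> mf tf rho eps e0.
have c0 : 0 < `|c| + 1 by rewrite ltr_wpDl.
have [d d0 H] := tf rho (eps / (`|c| + 1)) (divr_gt0 e0 c0); exists d => // z /H zd.
have -> : (fun x => c * f (x + z) - c * f x) = (fun x => c * (f (x + z) - f x)).
  by apply/funext => x; rewrite mulrBr.
rewrite L1ballZ; last exact: mshift.
apply: (@le_trans _ _ ((`|c| + 1)%:E * L1ball rho (fun x => f (x + z) - f x)%R)%E).
  by rewrite lee_pmul ?L1ball_ge0 ?lee_fin// lerDl.
apply: (@le_trans _ _ ((`|c| + 1)%:E * (eps / (`|c| + 1))%:E)%E).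
  by rewrite lee_pmul ?L1ball_ge0 ?lee_fin// ltW.
by rewrite -EFinM lee_fin mulrCA divff ?mulr1// gt_eqF.
Qed.

Lemma translation_continuous_cst c : translation_continuous (fun=> c).
Proof.
move=> rho eps e0; exists 1 => // z _; rewrite /L1ball.
by under eq_integral do rewrite subrr normr0 mulr0; rewrite integral0 lee_fin ltW.
Qed.

Lemma translation_continuous_sum (I : Type) (s : seq I) (F : I -> V -> R) :
  (forall i, measurable_fun setT (F i)) -> (forall i, translation_continuous (F i)) ->
  translation_continuous (fun x => \sum_(i <- s) F i x).
Proof.
move=> mF tF; elim: s => [|i s IHs].
  by under eq_fun do rewrite big_nil; exact: translation_continuous_cst.
under eq_fun do rewrite big_cons.
apply: (@translation_continuous_sub _ (F i) (fun x => \sum_(j <- s) F j x)) => //.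
- by apply: measurable_funD => //; exact: measurable_sum.
- exact: measurable_sum.
- by move=> x z; rewrite opprD addrACA ler_normD.
Qed.

Lemma translation_continuous_lim f : measurable_fun setT f ->
  (forall rho eps : R, 0 < eps -> exists g, [/\ measurable_fun setT g,
     translation_continuous g & (L1ball rho (fun x => f x - g x)%R <= eps%:E)%E]) ->
  translation_continuous f.
Proof.
move=> mf fg rho eps e0; have e3 : 0 < eps / 3 by rewrite divr_gt0.
have [g [mg tg fge]] := fg (rho + 1) _ e3.
have [d d0 H] := tg rho _ e3.
exists (Num.min 1 d); first by rewrite lt_min ltr01.
move=> z; rewrite le_min => /andP[z1 zd].
have mfg : measurable_fun setT (fun x => f x - g x) by exact: measurable_funB.
have mfgz : measurable_fun setT (fun x => f (x + z) - g (x + z)).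
  by apply: (measurableT_comp mfg); exact: measurable_rVD.
have A1 : (L1ball rho (fun x => f (x + z) - g (x + z))%R <= (eps / 3)%:E)%E.
  apply: le_trans fge; apply: (@L1ball_shift rho (rho + 1) (fun x => f x - g x)) => //.
  by rewrite lerD2l.
have A2 : (L1ball rho (fun x => f x - g x)%R <= (eps / 3)%:E)%E.
  apply: le_trans fge.
  have := @L1ball_shift rho (rho + 1) (fun x => f x - g x) 0 mfg.
  rewrite enorm0 addr0 => /(_ _); under eq_fun do rewrite addr0.
  by apply; rewrite lerDl.
rewrite (_ : eps = eps / 3 + (eps / 3 + eps / 3)); last by field.
rewrite !EFinD; apply: (le_trans _ (leeD A1 (leeD (H z zd) A2))).
rewrite -L1ballD//; last exact: mshift.
apply: L1ball_le_sum => //; first exact: mshift.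
  by apply: measurable_normD => //; exact: mshift.
move=> x _; apply: le_trans (_ : _ <= `|f (x + z) - g (x + z)| +
  (`|g (x + z) - g x| + `|f x - g x|)) _; last by rewrite lerD2l ler_norm.
have -> : f (x + z) - f x = (f (x + z) - g (x + z)) + ((g (x + z) - g x) - (f x - g x)) by ring.
by rewrite (le_trans (ler_normD _ _))// lerD2l ler_normB.
Qed.

Let mind S : measurable S -> measurable_fun setT (\1_S : V -> R).
Proof. by move=> mS; exact: measurable_indic. Qed.

Lemma translation_continuous_indicC S : measurable S ->
  translation_continuous \1_S -> translation_continuous \1_(~` S).
Proof.
move=> mS tS; have mC := measurableC mS.
apply: (@translation_continuous_sub _ \1_S (fun=> 0)) => //; last exact: translation_continuous_cst.
- move=> x z; rewrite subrr normr0 addr0 !indicE !in_setC.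
  by do 2 case: (_ \in _) => /=; rewrite ?subrr ?subr0 ?sub0r ?normr0 ?normrN ?normr1; lra.
Qed.

Lemma translation_continuous_indicU S S' : measurable S -> measurable S' ->
  translation_continuous \1_S -> translation_continuous \1_S' ->
  translation_continuous \1_(S `|` S').
Proof.
move=> mS mS'; have mU := measurableU _ _ mS mS'.
apply: translation_continuous_sub; [exact: mind..|].
move=> x z; rewrite !indicE !in_setU.
by do 4 case: (_ \in _) => /=; rewrite ?subrr ?subr0 ?sub0r ?normr0 ?normrN ?normr1; lra.
Qed.

(** Inside a ball, which has finite measure, the part of the union missed by the first [m] sets
    decreases to the empty set, so finite unions approximate it in $L^1$. *)
Lemma translation_continuous_indic_bigcup (F : (set V)^nat) :
  (forall k, measurable (F k)) -> (forall k, translation_continuous \1_(F k)) ->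
  translation_continuous \1_(\bigcup_k F k).
Proof.
move=> mF tF; have mU : measurable (\bigcup_k F k) by exact: bigcupT_measurable.
pose U m := \big[setU/set0]_(i < m) F i.
have mUm m : measurable (U m) by exact: bigsetU_measurable.
have tU m : translation_continuous \1_(U m).
  elim: m => [|m IHm]; rewrite /U.
    by rewrite big_ord0 (_ : \1_set0 = fun=> 0) ?indic0//; exact: translation_continuous_cst.
  rewrite big_ord_recr/=; apply: translation_continuous_indicU => //.
  exact: mUm.
apply: translation_continuous_lim; first exact: mind.
move=> rho eps e0; have mB := @measurable_eball R n.+1 rho.
pose D m := eball rho `&` (\bigcup_k F k `\` U m).
have mD m : measurable (D m) by apply: measurableI => //; exact: measurableD.
have niD : nonincreasing_seq D.
  move=> i j ij; apply/subsetPset => x [xB [xU xj]]; split => //; split => // xi; apply: xj.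
  move: xi; rewrite /U -!bigcup_mkord => -[k ki Fk]; exists k => //=.
  exact: leq_trans ki ij.
have D0 : \bigcap_m D m = set0.
  apply/seteqP; split => // x Dx; have [_ [[k _ Fk] _]] := Dx 0%N I.
  have [_ [_ +]] := Dx k.+1 I; apply.
  by rewrite /U -bigcup_mkord; exists k => /=.
have /fine_cvgP[_ /cvgrPdist_lt/(_ _ e0)] : lam \o D @ \oo --> 0%:E.
  have -> : (0%:E = lam (\bigcap_m D m))%E by rewrite D0 measure0.
  apply: nonincreasing_cvg_mu => //.
    by apply: le_lt_trans (lebesgue_eball_fin n.+1 rho); apply: le_measure; rewrite ?inE//; exact: subIsetl.
  by rewrite D0.
move=> [m _ /(_ m)]; rewrite /= sub0r normrN => /(_ (leqnn m)) Dm.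
exists \1_(U m); split; [exact: mind|exact: tU|].
have Dfin : lam (D m) \is a fin_num.
  rewrite ge0_fin_numE//; apply: le_lt_trans (lebesgue_eball_fin n.+1 rho).
  by apply: le_measure; rewrite ?inE//; exact: subIsetl.
have -> : (fun x => \1_(\bigcup_k F k) x - \1_(U m) x : R) = \1_(\bigcup_k F k `\` U m).
  apply/funext => x; have sub : U m `<=` \bigcup_k F k.
    by rewrite /U -bigcup_mkord => y [k _ Fk]; exists k.
  rewrite !indicE in_setD; have [xU|xU] := boolP (x \in U m).
    by rewrite (mem_set (sub _ (set_mem xU))) subrr.
  by rewrite subr0 andbT.
rewrite L1ball_indic; last exact: measurableD.
rewrite -[lam _]fineK// lee_fin ltW//.
by move: Dm; rewrite ger0_norm// fine_ge0.
Qed.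

(** A shift of length at most [d] changes membership only in the slab $|x_i - a| \le d$. Its part in
    the cube of side [2 * r] has volume $2d(2r)^n$, and [d] is chosen to make this [eps]. *)
Let halfspace (i : 'I_n.+1) (a : R) : translation_continuous \1_(rV_coord i @^-1` `]a, +oo[).
Proof.
pose S : set V := rV_coord i @^-1` `]a, +oo[.
have mS : measurable S.
  by rewrite -[X in measurable X]setTI; exact: (measurable_rV_coord i).
move=> rho eps e0; pose r := Num.max rho 1.
have r0 : 0 < r by rewrite lt_max ltr01 orbT.
pose d := eps / 2 / (2 * r) ^+ n.
have d0 : 0 < d by rewrite !divr_gt0// exprn_gt0// mulr_gt0.
exists d => // z zd.
pose D (j : 'I_n.+1) : set R := if j == i then `[a - d, a + d]%classic else `[- r, r]%classic.
have mD j : measurable (D j) by rewrite /D; case: ifP.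
pose B : set V := [set x | forall j, D j (x ord0 j)].
have mB : measurable B by exact: measurable_box.
apply: (@le_trans _ _ (lam B)).
  rewrite -[X in lam X]setIT -integral_indic//; apply: ge0_le_integral => //.
  - by apply: measurable_L1; exact: mshift (mind mS).
  - by apply/measurable_EFinP; exact: mind.
  move=> x _; rewrite lee_fin -/S.
  have [xB|xB] := pselect (B x).
    rewrite [leRHS]indicE mem_set// -[leRHS]mulr1 ler_pM// !indicE; first by case: (_ \in _).
    by do 2 case: (_ \in _); rewrite ?subrr ?subr0 ?sub0r ?normrN ?normr0 ?normr1.
  rewrite [leRHS]indicE memNset// [\1_(eball _) _]indicE.
  have [|_] := boolP (x \in _); last by rewrite mul0r.
  rewrite inE /eball /= => xr; rewrite mul1r.
  suff -> : (\1_S (x + z) : R) = \1_S x by rewrite subrr normr0.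
  rewrite !indicE; congr ((nat_of_bool _)%:R).
  have zi : `|z ord0 i| <= d by exact: le_trans (coord_le_enorm _ _) zd.
  suff xi : d < `|x ord0 i - a|.
    move: xi zi; rewrite ler_norml ltr_normr => xi /andP[z1 z2].
    apply/idP/idP; rewrite !inE /S/= /rV_coord !in_itv/= !andbT mxE.
      by case/orP: xi; lra.
    by case/orP: xi; lra.
  rewrite ltNge; apply/negP => xa; apply: xB => j; rewrite /D.
  case: eqP => [->|_]; rewrite /= in_itv/=; first by move: xa; rewrite ler_norml; lra.
  have := le_lt_trans (coord_le_enorm x j) xr; rewrite -ler_norml => /ltW xj.
  by rewrite (le_trans xj)// le_max lexx.
rewrite lebesgue_rV_box// (bigD1 i)//= (eq_bigr (fun=> (2 * r)%:E)); last first.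
  move=> j ji; rewrite /D (negPf ji) lebesgue_measure_itv/= lte_fin ifT; last by lra.
  by rewrite -EFinD; congr EFin; ring.
rewrite prodEFin prodr_const /D eqxx lebesgue_measure_itv/= lte_fin ifT; last by lra.
rewrite -EFinB -EFinM lee_fin.
have -> : #|(fun j : 'I_n.+1 => j != i)| = n.
  by have := cardC1 i; rewrite card_ord.
rewrite (_ : a + d - (a - d) = 2 * d); last by ring.
rewrite /d mulrA mulrAC -mulrA divff ?mulr1; last by rewrite gt_eqF// exprn_gt0// mulr_gt0.
by rewrite mulrC divfK.
Qed.

(** The sets with this property form a sigma-algebra containing the half-spaces $x_i > a$, hence
    contain all measurable sets. This replaces the density of continuous functions. *)
Lemma translation_continuous_indic S : measurable S -> translation_continuous \1_S.
Proof.
pose G := [set S : set V | measurable S /\ translation_continuous \1_S].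
suff mG : measurable `<=` G by move=> /mG[].
have tT : translation_continuous \1_(set0 : set V).
  by rewrite (_ : \1_set0 = fun=> 0) ?indic0//; exact: translation_continuous_cst.
have GC (A : set V) : G A -> G (~` A).
  by move=> [mA tA]; split; [exact: measurableC|exact: translation_continuous_indicC].
have GU (F : (set V)^nat) : (forall k, G (F k)) -> G (\bigcup_k F k).
  move=> GF; split; first by apply: bigcupT_measurable => k; have [] := GF k.
  by apply: translation_continuous_indic_bigcup => k; have [] := GF k.
apply: smallest_sub.
  by split => [|A GA|F GF]; [split|rewrite setTD; exact: GC|exact: GU].
rewrite -bigcup_seq; apply: bigcup_sub => i _ _ [Y mY <-]; rewrite setTI.
pose H := [set Y : set R | G (rV_coord i @^-1` Y)].
have : (@ocitv R).-sigma.-measurable Y by exact: mY.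
rewrite RGenOInfty.measurableE; suff : (@RGenOInfty.G R).-sigma.-measurable `<=` H by apply.
apply: smallest_sub.
  split => [|A GA|F GF]; rewrite /H/= ?preimage_set0.
  - by split.
  - by rewrite setTD preimage_setC; exact: GC.
  - by rewrite preimage_bigcup; exact: GU.
move=> _ [a ->]; split; last exact: halfspace.
by rewrite -[X in measurable X]setTI; exact: (measurable_rV_coord i).
Qed.

(** A discrete layer-cake formula: [t] is recovered up to [eta] by counting the thresholds below it.
    Hence a bounded function is uniformly close to a finite combination of indicators of superlevel
    sets. *)
Let staircase (eta t : R) (K : nat) : 0 < eta -> 0 <= t -> t <= K%:R * eta ->
  `|t - eta * \sum_(i < K) ((i.+1%:R * eta < t)%R)%:R| <= eta.
Proof.
move=> eta0 t0; elim: K => [|K IHK] tK.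
  by rewrite big_ord0 mulr0 subr0 ger0_norm//; move: tK; rewrite mul0r; lra.
rewrite big_ord_recr/= (_ : (K.+1%:R * eta < t) = false) ?addr0; last first.
  by apply/negbTE; rewrite -leNgt.
have [/IHK//|Kt] := leP t (K%:R * eta).
rewrite (eq_bigr (fun=> 1)); last first.
  move=> i _; rewrite (_ : (_ < _) = true)//; apply: le_lt_trans Kt.
  by rewrite ler_wpM2r ?(ltW eta0)// ler_nat.
rewrite sumr_const card_ord mulrC ger0_norm ?subr_ge0 ?(ltW Kt)//.
by move: tK; rewrite -natr1; lra.
Qed.

Lemma translation_continuous_bounded f (A : R) : measurable_fun setT f ->
  (forall x, `|f x| <= A) -> translation_continuous f.
Proof.
move=> mf fA; apply: translation_continuous_lim => // rho eps e0.
pose L := fine (lam (eball rho)); have L0 : 0 <= L by rewrite fine_ge0.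
pose eta := eps / (L + 1); have eta0 : 0 < eta by rewrite divr_gt0// ltr_wpDl.
have fA2 x : 0 <= f x + A <= 2 * A by have := fA x; rewrite ler_norml; lra.
have [K AK] : exists K : nat, 2 * A <= K%:R * eta.
  exists (Num.trunc (2 * A / eta)).+1.
  rewrite -ler_pdivrMr// ltW//; apply: truncnS_gt.
pose S (i : 'I_K) : set V := f @^-1` `]i.+1%:R * eta - A, +oo[.
have mS i : measurable (S i) by rewrite -[X in measurable X]setTI; exact: mf.
exists (fun x => - A + eta * \sum_(i < K) \1_(S i) x); split.
- apply: measurable_funD => //; apply: measurable_funM => //.
  by apply: measurable_sum => i; exact: mind.
- apply: (@translation_continuous_sub _ (fun=> - A)
    (fun x => eta * \sum_(i < K) \1_(S i) x)) => //.
  + apply: measurable_funD => //; apply: measurable_funM => //.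
    by apply: measurable_sum => i; exact: mind.
  + by apply: measurable_funM => //; apply: measurable_sum => i; exact: mind.
  + by move=> x z; rewrite subrr normr0 add0r opprD addrACA subrr add0r.
  + exact: translation_continuous_cst.
  apply: translation_continuousZ; first by apply: measurable_sum => i; exact: mind.
  apply: translation_continuous_sum => i; first exact: mind.
  exact: translation_continuous_indic.
- apply: (@le_trans _ _ (L1ball rho (cst eta))); last first.
    rewrite L1ball_cst (ger0_norm (ltW eta0)) -[lam _]fineK; last first.
      by rewrite ge0_fin_numE//; exact: lebesgue_eball_fin.
    rewrite -EFinM lee_fin -/L /eta mulrAC ler_pdivrMr; last by rewrite ltr_wpDl.
    by rewrite ler_wpM2l ?(ltW e0)// lerDl.
  apply: L1ball_le => //.
    apply: measurable_funB => //; apply: measurable_funD => //; apply: measurable_funM => //.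
    by apply: measurable_sum => i; exact: mind.
  move=> x _ /=; rewrite (ger0_norm (ltW eta0)).
  have /andP[f0 f2] := fA2 x.
  have := @staircase eta (f x + A) K eta0 f0 (le_trans f2 AK).
  rewrite opprD opprK addrA; congr (`|_ - _ * _| <= _).
  apply: eq_bigr => i _; rewrite indicE; congr ((nat_of_bool _)%:R).
  by apply/idP/idP; rewrite inE /S/= in_itv/= andbT; lra.
Qed.

End translation_continuity.

Section mollification_convergence.
Context {R : realType} (n : nat).
Local Notation V := 'rV[R]_n.+1.
Local Notation lam := (lebesgue_rV n.+1).

(** [moll eps w - w] is an average of $w(x+z) - w(x)$ over shifts with $|z| \le (n+1)\varepsilon$,
    each of which is small in $L^1$ of the ball. *)
Lemma moll_cvg (w : V -> R) (A rho e : R) : measurable_fun setT w ->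
  (forall x, `|w x| <= A) -> 0 < e -> exists2 d : R, 0 < d & forall eps : R, 0 < eps ->
  eps <= d -> (L1ball rho (fun x => moll eps w x - w x)%R <= e%:E)%E.
Proof.
move=> mw wA e0; have [d d0 Hd] := translation_continuous_bounded mw wA rho e0.
have n0 : (0 : R) < n.+1%:R by [].
exists (d / n.+1%:R); first by rewrite divr_gt0.
move=> eps eps0; rewrite ler_pdivlMr// mulrC => epsd.
have M0 := @bump_mass_gt0 R n eps eps0; have mb := @measurable_bump R n eps.
have iM := integrable_bump n eps0.
pose F (x z : V) : R := \1_(eball rho) x * `|w (x + z) - w x| * cube_bump eps z.
have F0 x z : (0 <= (F x z)%:E)%E.
  by rewrite lee_fin mulr_ge0 ?bump_ge0// mulr_ge0.
have mF : measurable_fun setT (fun p : V * V => (F p.1 p.2)%:E).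
  apply/measurable_EFinP; apply: measurable_funM; last exact: (measurableT_comp mb).
  apply: measurable_funM.
    apply: (@measurableT_comp _ _ _ _ _ _ (\1_(eball rho) : V -> R)) => //.
    by apply: measurable_indic; exact: measurable_eball.
  by apply: (measurableT_comp (@normr_measurable R setT)); exact: measurable_diff2.
have A0 : 0 <= A by exact: le_trans (wA 0).
have mdw (x : V) : measurable_fun setT (fun z : V => w (x + z) - w x).
  by apply: measurable_funB => //; apply: (measurableT_comp mw); exact: measurable_rVD.
have wd (x z : V) : `|w (x + z) - w x| <= 2 * A.
  by rewrite (le_trans (ler_normB _ _))// mulr_natl mulr2n lerD.
have idw (x : V) : lam.-integrable setT (EFin \o (fun z : V => (w (x + z) - w x) * cube_bump eps z)).
  apply: (@integrable_dominated _ _ _ (fun z => 2 * A * cube_bump eps z)).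
  - exact: measurable_funM.
  - by move=> z; rewrite normrM (ger0_norm (bump_ge0 _ _)) ler_wpM2r ?bump_ge0.
  - by have := integrableZl measurableT (2 * A) iM; apply: eq_integrable.
have iwb (x : V) : lam.-integrable setT (EFin \o (fun z : V => w (x + z) * cube_bump eps z)).
  apply: (@integrable_dominated _ _ _ (fun z => A * cube_bump eps z)).
  - by apply: measurable_funM => //; apply: (measurableT_comp mw); exact: measurable_rVD.
  - by move=> z; rewrite normrM (ger0_norm (bump_ge0 _ _)) ler_wpM2r ?bump_ge0.
  - by have := integrableZl measurableT A iM; apply: eq_integrable.
have mE (x : V) : moll eps w x - w x =
    (bump_mass n eps)^-1 * \int[lam]_z ((w (x + z) - w x) * cube_bump eps z).
  have -> : \int[lam]_z ((w (x + z) - w x) * cube_bump eps z) =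
      \int[lam]_z (w (x + z) * cube_bump eps z) - w x * bump_mass n eps.
    rewrite /bump_mass -RintegralZl// -RintegralB//; last first.
      by have := integrableZl measurableT (w x) iM; apply: eq_integrable.
    by apply: eq_Rintegral => z _; rewrite mulrBl.
  rewrite moll_shiftE// mulrBr mulrCA mulVf ?gt_eqF// mulr1; congr (_ * _ - _).
  by apply: eq_Rintegral => z _; rewrite addrC.
apply: (@le_trans _ _ (((bump_mass n eps)^-1)%:E * \int[lam]_x \int[lam]_z (F x z)%:E)%E).
  rewrite -ge0_integralZl_EFin ?invr_ge0 ?(ltW M0)//; last 2 first.
  - by move=> x _; exact: integral_ge0.
  - exact: (@measurable_integralr _ _ _ _ _ lam (fun x z => (F x z)%:E)).
  apply: ge0_le_integral => //.
  - apply/measurable_EFinP; apply: measurable_funM.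
      by apply: measurable_indic; exact: measurable_eball.
    apply: (measurableT_comp (@normr_measurable R setT)); apply: measurable_funB => //.
    exact: measurable_moll mw wA.
  - apply: measurable_funeM.
    exact: (@measurable_integralr _ _ _ _ _ lam (fun x z => (F x z)%:E)).
  move=> x _; rewrite mE normrM ger0_norm ?invr_ge0 ?(ltW M0)// mulrCA EFinM.
  apply: lee_wpmul2l; first by rewrite lee_fin invr_ge0 ltW.
  have iN := integrable_norm (idw x).
  apply: (@le_trans _ _ (\1_(eball rho) x * \int[lam]_z `|(w (x + z) - w x) * cube_bump eps z|)%:E).
    by rewrite lee_fin ler_wpM2l//; exact: le_normr_Rintegral.
  rewrite -RintegralZl// -EFin_Rintegral; last first.
    by have := integrableZl measurableT (\1_(eball rho) x) iN; apply: eq_integrable.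
  apply: ge0_le_integral => //.
  - apply/measurable_EFinP; apply: measurable_funM => //.
    apply: (measurableT_comp (@normr_measurable R setT)); exact: measurable_funM.
  - exact: (measurableT_comp mF (measurable_pair1 x)).
  - by move=> z _; rewrite lee_fin /F normrM (ger0_norm (bump_ge0 _ _)) mulrA.
rewrite (@integral_exchange _ _ _ _ R lam lam (fun x z => (F x z)%:E))//.
apply: (@le_trans _ _ (((bump_mass n eps)^-1)%:E * \int[lam]_z (e * cube_bump eps z)%:E)%E).
  apply: lee_wpmul2l; first by rewrite lee_fin invr_ge0 ltW.
  apply: ge0_le_integral => //.
  - by move=> z _; exact: integral_ge0.
  - exact: (@measurable_integrall _ _ _ _ _ lam (fun x z => (F x z)%:E)).
  - by apply/measurable_EFinP; exact: measurable_funM.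
  move=> z _; have [bz|bz] := eqVneq (cube_bump eps z) 0.
    by rewrite bz mulr0; under eq_integral do rewrite /F bz mulr0; rewrite integral0.
  have zd : enorm z <= d by apply: (le_trans (bump_supp eps0 bz)).
  rewrite /F; under eq_integral do rewrite mulrC EFinM.
  rewrite ge0_integralZl_EFin ?bump_ge0//; last first.
    apply/measurable_EFinP; apply: measurable_funM.
      by apply: measurable_indic; exact: measurable_eball.
    apply: (measurableT_comp (@normr_measurable R setT)); apply: measurable_funB => //.
    by apply: (measurableT_comp mw); exact: measurable_rVD.
  by rewrite mulrC EFinM lee_wpmul2l ?lee_fin ?bump_ge0//; exact: Hd.
rewrite (@EFin_Rintegral _ _ (fun z => e * cube_bump eps z)); last first.
  by have := integrableZl measurableT e iM; apply: eq_integrable.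
rewrite RintegralZl// -EFinM lee_fin -/(bump_mass n eps) mulrCA mulVf ?mulr1//.
by rewrite gt_eqF.
Qed.

End mollification_convergence.

(** * The deformation and the variational inequality *)

Section deformation.
Context {R : realType} (n : nat).
Local Notation V := 'rV[R]_n.+1.
Local Notation lam := (lebesgue_rV n.+1).
Local Notation e := (delta_mx ord0 ord_max : V).

Lemma enorm_e_last : enorm e = 1.
Proof.
rewrite /enorm (bigD1 ord_max)//= big1 ?addr0.
  by rewrite mxE !eqxx expr1n sqrtr1.
by move=> i im; rewrite mxE (negPf im) expr0n.
Qed.

Lemma Rintegral_sum d (T : measurableType d) (m : {measure set T -> \bar R})
  (I : Type) (s : seq I) (F : I -> T -> R) :
  (forall i, m.-integrable setT (EFin \o F i)) ->
  m.-integrable setT (EFin \o (fun x => \sum_(i <- s) F i x)) /\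
  \int[m]_x (\sum_(i <- s) F i x) = \sum_(i <- s) \int[m]_x F i x.
Proof.
move=> iF; elim: s => [|i s [IH1 IH2]].
  under eq_fun do rewrite big_nil; rewrite big_nil; split; first exact: integrable0.
  by rewrite Rintegral_cst// mul0r.
split.
  have := integrableD measurableT (iF i) IH1; apply: eq_integrable => // x _.
  by rewrite /= big_cons.
by under eq_Rintegral do rewrite big_cons; rewrite RintegralD// IH2 big_cons.
Qed.

Variables (phi : V -> R) (r : R) (N : nat) (delta : R).
Hypothesis mphi : measurable_fun setT phi.
Hypothesis phi1 : forall x, -1 <= phi x <= 1.
Hypothesis phi_lip : lip_min1 phi.
Hypothesis phi_in : forall x, enorm x < r + 1 -> phi x = 1.
Hypothesis phi_out : forall x, r + 2 <= enorm x -> phi x = -1.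
Hypothesis delta_ge0 : 0 <= delta.

Definition shift_last (j : nat) : V := (j%:R * delta) *: e.

(* The deformation from f to max(f, phi) goes through the functions
   min(max(f, phi), f(. + j delta e)), j <= N; the constant level 1 closes the last gap. *)
Definition level (f : V -> R) x (j : nat) : R :=
  if (j <= N)%N then f (x + shift_last j) else 1.

Definition gap (f : V -> R) (j : nat) x : R := increment (level f x) (phi x) j.

Lemma level0 f x : level f x 0 = f x.
Proof. by rewrite /level /shift_last leq0n mul0r scale0r addr0. Qed.

Lemma enorm_shift_last j : enorm (shift_last j) = j%:R * delta.
Proof. by rewrite enormZ enorm_e_last mulr1 ger0_norm// mulr_ge0. Qed.

Lemma measurable_level f j : measurable_fun setT f ->
  measurable_fun setT (fun x => level f x j).
Proof.
move=> mf; rewrite /level; case: (j <= N)%N => //.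
by apply: (measurableT_comp mf); exact: measurable_rVD.
Qed.

Lemma measurable_cutoff f j : measurable_fun setT f ->
  measurable_fun setT (fun x => cutoff (level f x) (phi x) j).
Proof.
move=> mf; apply: measurable_minr; last exact: measurable_level.
by apply: measurable_maxr => //; exact: measurable_level.
Qed.

Lemma measurable_gap f j : measurable_fun setT f -> measurable_fun setT (gap f j).
Proof. by move=> mf; apply: measurable_funB; exact: measurable_cutoff. Qed.

Lemma lip_min1_gap f j : lip_min1 f -> lip_min1 (gap f j).
Proof.
move=> lf; have ll i : lip_min1 (fun x => level f x i).
  rewrite /level; case: (i <= N)%N; last exact: lip_min1_cst.
  exact: lip_min1_shift.
have lc i : lip_min1 (fun x => cutoff (level f x) (phi x) i).
  apply: (lip_min1_op2 (op := Num.min)); [exact: dist_min| |exact: ll].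
  by apply: (lip_min1_op2 (op := Num.max)); [exact: dist_max|exact: ll|].
by apply: (lip_min1_op2 (op := fun a b => a - b)); [exact: dist_sub|exact: lc|exact: lc].
Qed.

Section ordered.
Variable f : V -> R.
Hypothesis f1 : forall x, `|f x| <= 1.
Hypothesis f_le : forall x t, 0 <= t -> f x <= f (x + t *: e).

Let f_le1 x : f x <= 1. Proof. by have := f1 x; rewrite ler_norml => /andP[]. Qed.

Let f_geN1 x : -1 <= f x. Proof. by have := f1 x; rewrite ler_norml => /andP[]. Qed.

Lemma level_le x j : level f x j <= level f x j.+1.
Proof.
rewrite /level; case: ltnP => jN; last by case: ifP.
rewrite (ltnW jN) /shift_last -natr1 mulrDl mul1r scalerDl addrA.
exact: f_le.
Qed.

Lemma level_end x : Num.max (level f x 0) (phi x) <= level f x N.+1.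
Proof.
rewrite level0 /level ltnn ge_max f_le1/=.
by have /andP[] := phi1 x.
Qed.

Lemma level_bounds x j : -1 <= level f x j <= 1.
Proof. by rewrite /level; case: ifP => _; rewrite ?f_geN1 ?f_le1// lexx andbT; lra. Qed.

Lemma cutoff_bounds x j : -1 <= cutoff (level f x) (phi x) j <= 1.
Proof.
have /andP[l1 l2] := level_bounds x j; have /andP[m1 m2] := level_bounds x 0.
by rewrite /cutoff le_min le_max m1 l1/= ge_min l2 orbT.
Qed.

Lemma gap_ge0 j x : 0 <= gap f j x.
Proof. exact/increment_ge0/level_le. Qed.

Lemma gap_le2 j x : gap f j x <= 2.
Proof.
rewrite /gap /increment; have := cutoff_bounds x j; have := cutoff_bounds x j.+1; lra.
Qed.

Lemma norm_gap j x : `|gap f j x| <= 2.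
Proof. by rewrite ger0_norm ?gap_ge0 ?gap_le2. Qed.

Lemma level0_le x j : f x <= level f x j.
Proof.
rewrite -(level0 f x); elim: j => // j IHj; apply: le_trans IHj _; exact: level_le.
Qed.

(** Where [phi = -1] the target is [f] itself, which lies below every level, so nothing moves. This
    compact support makes each gap admissible in the weak equation. *)
Lemma gap_supp j x : r + 2 <= enorm x -> gap f j x = 0.
Proof.
move=> xr; rewrite /gap /increment /cutoff level0 phi_out// max_l//.
by rewrite !min_l ?level0_le// subrr.
Qed.

Lemma integrable_gap (g : V -> R) (A : R) j : measurable_fun setT f ->
  measurable_fun setT g -> (forall x, `|g x| <= A) ->
  lam.-integrable setT (EFin \o (fun x => gap f j x * g x)).
Proof.
move=> mf mg gA; apply: (@integrable_bounded_support _ _ _ (2 * A) (r + 2)).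
- by apply: measurable_funM => //; exact: measurable_gap.
- by move=> x; rewrite normrM ler_pM// norm_gap.
- by move=> x /gap_supp ->; rewrite mul0r.
Qed.

End ordered.

Variables (mu : probability (measurableTypeR R) R) (s0 : R).
Hypothesis s0_gt0 : 0 < s0.
Local Notation k := (@levy_kernel R n mu s0).

(** Selects the pairs at which [phi], hence the competitor, equals 1 twice. *)
Definition both (z : V * V) : R :=
  \1_(eball (r + 1)) z.1 * \1_(eball (r + 1)) (z.1 + z.2).

Lemma both_ge0 z : 0 <= both z. Proof. exact: mulr_ge0. Qed.

Lemma measurable_both : measurable_fun setT both.
Proof.
have mi : measurable_fun setT (\1_(eball (r + 1)) : V -> R).
  by apply: measurable_indic; exact: measurable_eball.
by apply: measurable_funM; [exact: (measurableT_comp mi)|exact: measurable_comp_add].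
Qed.

Definition phi_energy : \bar R :=
  (\int[lam \x lam]_z ((phi (z.1 + z.2)%R - phi z.1) ^+ 2 * k z.2)%:E)%E.

(** The integral of [competitor_le] against the kernel. The [j]-th translate of [f] solves the
    translated equation, so its pairing with the [j]-th gap is evaluated by [weak_equation]. *)
Lemma variational_inequality (f g : V -> R) : tame f -> measurable_fun setT f ->
  (forall x, `|f x| <= 1) -> (forall x t, 0 <= t -> f x <= f (x + t *: e)) ->
  (forall y, 2 * \int[lam]_h (sdiff f y h * k h) = - g y) ->
  (\int[lam \x lam]_z (both z * (f (z.1 + z.2)%R - f z.1) ^+ 2 * k z.2)%:E <=
   phi_energy + (\sum_(j < N.+1) \int[lam]_x (gap f j x * g (x + shift_last j)))%:E)%E.
Proof.
move=> f_tame mf f1 f_le f_eq.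
have mk := @measurable_levy_kernel R n mu s0 s0_gt0.
have mk2 : measurable_fun setT (fun p : V * V => k p.2) by exact: (measurableT_comp mk).
have k0 := @levy_kernel_ge0 R n mu s0 s0_gt0.
(* Only the levels [j <= N], which are genuine translates, are paired with gaps; the constant level
   [N.+1] serves only as the end of the last gap. *)
pose Q (j : nat) (z : V * V) := (level f (z.1 + z.2) j - level f z.1 j) *
  (gap f j (z.1 + z.2) - gap f j z.1) * k z.2.
pose P0 (z : V * V) := (phi (z.1 + z.2) - phi z.1) ^+ 2 * k z.2.
(* [phi + 1] has compact support and the same differences as [phi], so the square is a pairing
   covered by [integrable_pairing]. *)
have iP0 : (lam \x lam)%E.-integrable setT (EFin \o P0).
  have [B B0 HB] := phi_lip.
  have B20 : 0 <= B + 2 by rewrite addr_ge0.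
  have phiB x : `|phi x + 1| <= B + 2.
    by have := phi1 x; rewrite ler_norml; lra.
  have phiL (x h : V) : `|phi (x + h) - phi x| <= (B + 2) * min1 h.
    by rewrite (le_trans (HB x h))// ler_wpM2r ?min1_ge0//; lra.
  have phiL1 (x h : V) : `|phi (x + h) + 1 - (phi x + 1)| <= (B + 2) * min1 h.
    by rewrite opprD addrACA subrr addr0.
  have phiS x : r + 2 <= enorm x -> phi x + 1 = 0 by move=> /phi_out ->; rewrite addNr.
  have m1 : measurable_fun setT (fun x => phi x + 1) by exact: measurable_funD.
  have := integrable_pairing mu s0_gt0 m1 B20 phiB phiL1 phiS mphi phiL.
  apply: eq_integrable => // z _; rewrite /P0 /=; congr EFin.
  by rewrite opprD addrACA subrr addr0 expr2.
have f_lip := tame_lip_min1 f_tame.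
have HQ j : (j <= N)%N -> (lam \x lam)%E.-integrable setT (EFin \o Q j) /\
    \int[(lam \x lam)%E]_z Q j z = - 2^-1 * \int[lam]_x (gap f j x * g (x + shift_last j)).
  move=> jN; pose fj (x : V) : R := f (x + shift_last j).
  have mfj : measurable_fun setT fj by apply: (measurableT_comp mf); exact: measurable_rVD.
  have fj_tame : tame fj.
    have [C C0 [t0 t1 t2]] := f_tame; exists C => //; split => [x|x h|x h].
    - exact: t0.
    - by rewrite /fj addrAC.
    - by rewrite /sdiff /fj [x + h + _]addrAC [x - h + _]addrAC; exact: t2.
  have fj_eq y : 2 * \int[lam]_h (sdiff fj y h * k h) = - g (y + shift_last j).
    rewrite -f_eq; congr (_ * _); apply: eq_Rintegral => h _.
    by rewrite /sdiff /fj [y + h + _]addrAC [y - h + _]addrAC.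
  have [B B0 HB] := lip_min1_gap j f_lip.
  have B20 : 0 <= B + 2 by rewrite addr_ge0.
  have mg := measurable_gap j mf.
  have gB x : `|gap f j x| <= B + 2.
    by rewrite (le_trans (norm_gap f1 f_le j x))// lerDr.
  have gL (x h : V) : `|gap f j (x + h) - gap f j x| <= (B + 2) * min1 h.
    by rewrite (le_trans (HB x h))// ler_wpM2r ?min1_ge0// lerDl.
  have gS (x : V) : r + 2 <= enorm x -> gap f j x = 0 by exact: gap_supp.
  have [C C0 HC] := tame_lip_min1 fj_tame.
  have E (z : V * V) : (fj (z.1 + z.2) - fj z.1) *
      (gap f j (z.1 + z.2) - gap f j z.1) * k z.2 = Q j z by rewrite /Q /level jN.
  split.
    have := integrable_pairing mu s0_gt0 mg B20 gB gL gS mfj HC.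
    by apply: eq_integrable => // z _; rewrite /= -E.
  rewrite -(weak_equation s0_gt0 fj_tame mfj fj_eq mg B20 gB gL gS).
  by apply: eq_Rintegral => z _; rewrite -E.
pose S (z : V * V) := \sum_(j < N.+1) Q j z.
have [iS ES] : (lam \x lam)%E.-integrable setT (EFin \o S) /\
    \int[(lam \x lam)%E]_z S z = \sum_(j < N.+1) \int[(lam \x lam)%E]_z Q j z.
  by apply: Rintegral_sum => j; have [] := HQ j (ltn_ord j).
have i2S : (lam \x lam)%E.-integrable setT (EFin \o (fun z => 2 * S z)).
  by have := integrableZl measurableT 2 iS; apply: eq_integrable.
have iP : (lam \x lam)%E.-integrable setT (EFin \o (fun z => P0 z - 2 * S z)).
  by have := integrableB measurableT iP0 i2S; apply: eq_integrable.
have PE : \int[(lam \x lam)%E]_z (P0 z - 2 * S z) = \int[(lam \x lam)%E]_z P0 z +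
    \sum_(j < N.+1) \int[lam]_x (gap f j x * g (x + shift_last j)).
  rewrite RintegralB// RintegralZl// ES; congr (_ + _).
  rewrite mulr_sumr -sumrN; apply: eq_bigr => j _.
  by have [_ ->] := HQ j (ltn_ord j); field.
have pointwise z : both z * (f (z.1 + z.2) - f z.1) ^+ 2 * k z.2 <= P0 z - 2 * S z.
  have -> : P0 z - 2 * S z = ((phi (z.1 + z.2) - phi z.1) ^+ 2 - 2 * \sum_(j < N.+1)
      (level f (z.1 + z.2) j - level f z.1 j) *
      (gap f j (z.1 + z.2) - gap f j z.1)) * k z.2.
    by rewrite mulrBl -[2 * _ * _]mulrA mulr_suml.
  apply: ler_wpM2r; first exact: k0.
  have := @competitor_le R (level f z.1) (level f (z.1 + z.2)) (phi z.1) (phi (z.1 + z.2)) N.+1.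
  rewrite !level0 => /(_ (fun j _ => level_le f1 f_le _ j) (fun j _ => level_le f1 f_le _ j)).
  have l1 x : Num.max (f x) (phi x) <= level f x N.+1.
    by have := level_end f1 x; rewrite level0.
  have f1' x : f x <= 1 by have := f1 x; rewrite ler_norml => /andP[].
  move=> /(_ (l1 _) (l1 _) (f1' _) (f1' _)); apply: le_trans.
  apply: ler_wpM2r; first exact: sqr_ge0.
  rewrite /both !indicE; have [x1|_] := boolP (z.1 \in _); last by rewrite mul0r.
  have [x2|_] := boolP (z.1 + z.2 \in _); last by rewrite mulr0.
  by rewrite mulr1 !phi_in ?eqxx//; [have := set_mem x2|have := set_mem x1].
have -> : (phi_energy + (\sum_(j < N.+1) \int[lam]_x (gap f j x * g (x + shift_last j)))%:E =
    \int[lam \x lam]_z (P0 z - 2 * S z)%:E)%E.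
  have -> : (\int[lam \x lam]_z (P0 z - 2 * S z)%:E = (\int[(lam \x lam)%E]_z (P0 z - 2 * S z)%R)%:E)%E.
    by rewrite /Rintegral fineK//; exact: (integrable_fin_num _ iP).
  rewrite PE EFinD; congr (_ + _)%E.
  by rewrite /phi_energy /Rintegral fineK//; exact: (integrable_fin_num _ iP0).
apply: ge0_le_integral => //.
- move=> z _; rewrite lee_fin mulr_ge0// mulr_ge0 ?both_ge0// sqr_ge0//.
- apply/measurable_EFinP; apply: measurable_funM => //; apply: measurable_funM.
    exact: measurable_both.
  by apply: measurable_funX; exact: measurable_diff2.
- exact: measurable_int iP.
- by move=> z _; rewrite lee_fin.
Qed.

End deformation.

(** * Removing the mollification *)

Section limit_of_mollifications.
Context {R : realType} (n : nat).
Local Notation V := 'rV[R]_n.+1.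
Local Notation lam := (lebesgue_rV n.+1).
Local Notation e := (delta_mx ord0 ord_max : V).

Lemma integral_prod_mul (a b : V -> R) : measurable_fun setT a -> measurable_fun setT b ->
  (forall x, 0 <= a x) -> (forall x, 0 <= b x) ->
  (\int[lam \x lam]_z (a z.1 * b (z.1 + z.2)%R)%:E =
   \int[lam]_x (a x)%:E * \int[lam]_x (b x)%:E)%E.
Proof.
move=> ma mb a0 b0.
have mE : measurable_fun setT (fun z : V * V => (a z.1 * b (z.1 + z.2))%:E).
  apply/measurable_EFinP; apply: measurable_funM; first exact: (measurableT_comp ma).
  exact: measurable_comp_add.
rewrite fubini_tonelli1//; last by move=> z; rewrite lee_fin mulr_ge0.
have I0 : (0 <= \int[lam]_x (b x)%:E)%E by apply: integral_ge0 => x _; rewrite lee_fin.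
rewrite -ge0_integralZr//; last 2 first.
- by apply/measurable_EFinP.
- by move=> x _; rewrite lee_fin.
apply: eq_integral => x _; rewrite /fubini_F /=.
under eq_integral do rewrite EFinM.
have mbx : measurable_fun setT (fun h : V => (b (x + h))%:E).
  apply/measurable_EFinP; apply: (measurableT_comp mb); exact: measurable_rVD.
rewrite ge0_integralZl_EFin//; last by move=> h _; rewrite lee_fin.
congr (_ * _)%E; rewrite -[RHS](ge0_integral_shift x); last 2 first.
- exact/measurable_EFinP.
- by move=> y; rewrite lee_fin.
by apply: eq_integral => h _; rewrite addrC.
Qed.

Lemma L1ball_le_comb rho (f g h : V -> R) (a b p q : R) : measurable_fun setT f ->
  measurable_fun setT g -> measurable_fun setT h -> 0 <= a -> 0 <= b ->
  (forall x, enorm x < rho -> `|f x| <= a * `|g x| + b * `|h x|) ->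
  (L1ball rho g <= p%:E -> L1ball rho h <= q%:E -> L1ball rho f <= (a * p + b * q)%:E)%E.
Proof.
move=> mf mg mh a0 b0 fgh gp hq.
apply: (@le_trans _ _ (L1ball rho (fun x => a * g x)%R + L1ball rho (fun x => b * h x)%R)%E).
  apply: L1ball_le_sum => //; [exact: measurable_funM|exact: measurable_funM|].
  by move=> x /fgh; rewrite !normrM (ger0_norm a0) (ger0_norm b0).
rewrite !L1ballZ// (ger0_norm a0) (ger0_norm b0) EFinD !EFinM.
by apply: leeD; apply: lee_wpmul2l; rewrite ?lee_fin.
Qed.

Lemma L1ball_radius rho rho' (f : V -> R) : measurable_fun setT f -> rho <= rho' ->
  (L1ball rho f <= L1ball rho' f)%E.
Proof.
move=> mf rr; have := @L1ball_shift _ _ rho rho' f 0 mf; rewrite enorm0 addr0 => /(_ rr).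
by under eq_fun do rewrite addr0.
Qed.

Lemma norm_Rintegral_le_L1ball rho (f : V -> R) (B p : R) : measurable_fun setT f ->
  (forall x, `|f x| <= B) -> (forall x, rho <= enorm x -> f x = 0) ->
  (L1ball rho f <= p%:E)%E -> `|\int[lam]_x f x| <= p.
Proof.
move=> mf fB fr fp; have iF := integrable_bounded_support mf fB fr.
apply: (le_trans (le_normr_Rintegral measurableT iF)).
rewrite -lee_fin -EFin_Rintegral; last by have := integrable_norm iF; apply: eq_integrable.
apply: le_trans fp; rewrite le_eqVlt; apply/orP; left; apply/eqP; apply: eq_integral => x _.
rewrite indicE; case: (boolP (x \in _)) => [_|]; first by rewrite mul1r.
rewrite notin_setE /eball/= => /negP; rewrite -leNgt => /fr ->.
by rewrite normr0 mulr0.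
Qed.

Variables (phi : V -> R) (r : R) (N : nat) (delta : R).
Hypothesis mphi : measurable_fun setT phi.
Hypothesis phi1 : forall x, -1 <= phi x <= 1.
Hypothesis phi_lip : lip_min1 phi.
Hypothesis phi_in : forall x, enorm x < r + 1 -> phi x = 1.
Hypothesis phi_out : forall x, r + 2 <= enorm x -> phi x = -1.
Hypothesis delta_ge0 : 0 <= delta.
Variables (mu : probability (measurableTypeR R) R) (s0 : R).
Hypothesis s0_gt0 : 0 < s0.
Local Notation k := (@levy_kernel R n mu s0).
Local Notation level := (level N delta).
Local Notation gap := (gap phi N delta).
Local Notation shift_last := (shift_last n delta).
Local Notation rho := (r + 2 + N%:R * delta).

Variables (u w : V -> R) (A : R).
Hypothesis mu_ : measurable_fun setT u.
Hypothesis u1 : forall x, `|u x| <= 1.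
Hypothesis u_le : forall x t, 0 <= t -> u x <= u (x + t *: e).
Hypothesis mw : measurable_fun setT w.
Hypothesis wA : forall x, `|w x| <= A.
Hypothesis approx : forall eps : R, 0 < eps -> exists f g : V -> R,
  [/\ tame f, measurable_fun setT f, (forall x, `|f x| <= 1) &
   forall x t, 0 <= t -> f x <= f (x + t *: e)] /\
  [/\ measurable_fun setT g, (forall x, `|g x| <= A),
   forall y, 2 * \int[lam]_h (sdiff f y h * k h) = - g y,
   (L1ball rho (fun x => f x - u x)%R <= eps%:E)%E &
   (L1ball rho (fun x => g x - w x)%R <= eps%:E)%E].

Let A0 : 0 <= A. Proof. exact: le_trans (wA 0). Qed.

Section one_approximation.
Variables (f g : V -> R) (eps : R).
Hypothesis eps_gt0 : 0 < eps.
Hypothesis mf : measurable_fun setT f.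
Hypothesis f1 : forall x, `|f x| <= 1.
Hypothesis f_le : forall x t, 0 <= t -> f x <= f (x + t *: e).
Hypothesis mg : measurable_fun setT g.
Hypothesis gA : forall x, `|g x| <= A.
Hypothesis fu : (L1ball rho (fun x => f x - u x)%R <= eps%:E)%E.
Hypothesis gw : (L1ball rho (fun x => g x - w x)%R <= eps%:E)%E.

Let mfu : measurable_fun setT (fun x => f x - u x). Proof. exact: measurable_funB. Qed.

Let L1_shift (a b : V -> R) j : (j <= N)%N -> measurable_fun setT (fun x => a x - b x) ->
  (L1ball rho (fun x => a x - b x)%R <= eps%:E)%E ->
  (L1ball (r + 2) (fun x => a (x + shift_last j) - b (x + shift_last j))%R <= eps%:E)%E.
Proof.
move=> jN mab; apply: le_trans.
apply: (@L1ball_shift _ _ (r + 2) rho (fun x => a x - b x)) => //.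
by rewrite enorm_shift_last// lerD2l ler_wpM2r// ler_nat.
Qed.

Let L1_level j : (L1ball (r + 2) (fun x => level f x j - level u x j)%R <= eps%:E)%E.
Proof.
rewrite /level; case: (leqP j N) => jN; first exact: L1_shift.
rewrite /L1ball; under eq_integral do rewrite subrr normr0 mulr0.
by rewrite integral0 lee_fin ltW.
Qed.

(** Each gap involves two cutoffs and each cutoff two levels, hence the 4. *)
Let L1_gap j : (L1ball (r + 2) (fun x => gap f j x - gap u j x)%R <= (4 * eps)%:E)%E.
Proof.
have ml i : measurable_fun setT (fun x => level f x i - level u x i).
  by apply: measurable_funB; exact: measurable_level.
pose c i x := cutoff (level f x) (phi x) i - cutoff (level u x) (phi x) i.
have mc i : measurable_fun setT (c i) by apply: measurable_funB; exact: measurable_cutoff.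
have Lc i : (L1ball (r + 2) (c i) <= (1 * eps + 1 * eps)%:E)%E.
  apply: (L1ball_le_comb (mc i) (ml 0) (ml i) ler01 ler01 _ (L1_level 0) (L1_level i)).
  move=> x _; rewrite !mul1r /c /cutoff (le_trans (dist_min _ _ _ _))// lerD2r.
  by rewrite (le_trans (dist_max _ _ _ _))// subrr normr0 addr0.
rewrite (_ : 4 * eps = 1 * (1 * eps + 1 * eps) + 1 * (1 * eps + 1 * eps)); last by ring.
apply: (L1ball_le_comb _ (mc j.+1) (mc j) ler01 ler01 _ (Lc j.+1) (Lc j)).
  by apply: measurable_funB; exact: measurable_gap.
by move=> x _; rewrite !mul1r /gap /increment dist_sub.
Qed.

(** The gaps are at most 2 and [g] at most [A], so errors [4 * eps] on the gap and [eps] on [g] give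
    the constant. *)
Lemma gap_pairing_le j : (j <= N)%N ->
  `|\int[lam]_x (gap f j x * g (x + shift_last j)) -
    \int[lam]_x (gap u j x * w (x + shift_last j))| <= (4 * A + 2) * eps.
Proof.
move=> jN.
have mgs (a : V -> R) : measurable_fun setT a -> measurable_fun setT (fun x : V => a (x + shift_last j)).
  by move=> ma; apply: (measurableT_comp ma); exact: measurable_rVD.
have if_ : lam.-integrable setT (EFin \o (fun x => gap f j x * g (x + shift_last j))).
  apply: (@integrable_gap _ _ _ _ _ _ mphi phi_out delta_ge0 _ f1 f_le _ A) => //.
  exact: mgs.
have iu : lam.-integrable setT (EFin \o (fun x => gap u j x * w (x + shift_last j))).
  apply: (@integrable_gap _ _ _ _ _ _ mphi phi_out delta_ge0 _ u1 u_le _ A) => //.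
  exact: mgs.
rewrite -RintegralB//.
have ngf := norm_gap phi N delta_ge0 f1 f_le j.
have ngu := norm_gap phi N delta_ge0 u1 u_le j.
have mgf := measurable_gap N delta mphi j mf.
have mgu := measurable_gap N delta mphi j mu_.
apply: (@norm_Rintegral_le_L1ball (r + 2) _ (2 * A + 2 * A)).
- by apply: measurable_funB; apply: measurable_funM => //; exact: mgs.
- by move=> x; rewrite (le_trans (ler_normB _ _))// !normrM lerD// ler_pM.
- move=> x xr; rewrite (gap_supp _ phi_out delta_ge0 f1 f_le)//.
  by rewrite (gap_supp _ phi_out delta_ge0 u1 u_le)// !mul0r subrr.
rewrite (_ : (4 * A + 2) * eps = A * (4 * eps) + 2 * eps); last by ring.
have mgw : measurable_fun setT (fun x => g x - w x) by exact: measurable_funB.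
apply: (L1ball_le_comb _ _ _ A0 _ _ (L1_gap j) (L1_shift jN mgw gw)) => //.
- by apply: measurable_funB; apply: measurable_funM => //; exact: mgs.
- exact: measurable_funB.
- by apply: measurable_funB; exact: mgs.
move=> x _; rewrite (_ : _ - _ = g (x + shift_last j) * (gap f j x - gap u j x) +
  gap u j x * (g (x + shift_last j) - w (x + shift_last j))); last by ring.
by rewrite (le_trans (ler_normD _ _))// !normrM lerD// ler_wpM2r.
Qed.

(** For functions bounded by 1 the squared difference changes by at most 4 times the errors at the
    two points. An $L^1$ error can be integrated against a kernel capped at [M], but not against
    [k], which may fail to be integrable at the origin. *)
Lemma truncated_energy_le (M : R) : 0 <= M ->
  (\int[lam \x lam]_z (both r z * (u (z.1 + z.2)%R - u z.1) ^+ 2 * Num.min M (k z.2))%:E <=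
   \int[lam \x lam]_z (both r z * (f (z.1 + z.2)%R - f z.1) ^+ 2 * k z.2)%:E +
   (8 * M * fine (lam (eball (r + 1))) * eps)%:E)%E.
Proof.
move=> M0; have k0 := @levy_kernel_ge0 R n mu s0 s0_gt0.
have mk2 : measurable_fun setT (fun p : V * V => k p.2).
  by apply: (measurableT_comp (measurable_levy_kernel mu s0_gt0)).
pose I : V -> R := \1_(eball (r + 1)).
have mI : measurable_fun setT I by apply: measurable_indic; exact: measurable_eball.
pose D x := I x * `|f x - u x|.
have mD : measurable_fun setT D.
  by apply: measurable_funM => //; exact: (measurableT_comp (@normr_measurable R setT) mfu).
have D0 x : 0 <= D x by rewrite mulr_ge0.
have I0 x : 0 <= I x by [].
have ID : (\int[lam]_x (D x)%:E <= eps%:E)%E.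
  apply: le_trans fu; apply: (@L1ball_radius (r + 1) rho _ mfu).
  have : 0 <= N%:R * delta by rewrite mulr_ge0.
  lra.
have II : (\int[lam]_x (I x)%:E = (fine (lam (eball (r + 1))))%:E)%E.
  rewrite integral_indic ?setIT//; last exact: measurable_eball.
  by rewrite fineK// ge0_fin_numE//; exact: lebesgue_eball_fin.
pose L := fine (lam (eball (r + 1))); have L0 : 0 <= L by rewrite fine_ge0.
pose T1 (z : V * V) := D z.1 * I (z.1 + z.2); pose T2 (z : V * V) := I z.1 * D (z.1 + z.2).
have IT1 : (\int[lam \x lam]_z (T1 z)%:E <= (L * eps)%:E)%E.
  apply: (le_trans (_ : _ <= \int[lam]_x (D x)%:E * \int[lam]_x (I x)%:E)%E _).
    by rewrite -integral_prod_mul.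
  by rewrite II mulrC EFinM lee_wpmul2r ?lee_fin.
have IT2 : (\int[lam \x lam]_z (T2 z)%:E <= (L * eps)%:E)%E.
  apply: (le_trans (_ : _ <= \int[lam]_x (I x)%:E * \int[lam]_x (D x)%:E)%E _).
    by rewrite -integral_prod_mul.
  by rewrite II EFinM lee_wpmul2l ?lee_fin.
have mT1 : measurable_fun setT T1.
  by apply: measurable_funM; [exact: (measurableT_comp mD)|exact: measurable_comp_add].
have mT2 : measurable_fun setT T2.
  by apply: measurable_funM; [exact: (measurableT_comp mI)|exact: measurable_comp_add].
have T10 z : 0 <= T1 z by rewrite mulr_ge0.
have T20 z : 0 <= T2 z by rewrite mulr_ge0.
pose G (z : V * V) := both r z * (f (z.1 + z.2) - f z.1) ^+ 2 * k z.2.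
have G0 z : 0 <= G z by apply: mulr_ge0 => //; apply: mulr_ge0; [exact: both_ge0|exact: sqr_ge0].
have mG : measurable_fun setT G.
  apply: measurable_funM => //; apply: measurable_funM; first exact: measurable_both.
  by apply: measurable_funX; exact: measurable_diff2.
have C0 : 0 <= 4 * M by rewrite mulr_ge0.
apply: (@le_trans _ _ (\int[lam \x lam]_z ((G z)%:E + ((4 * M)%:E * (T1 z)%:E +
    (4 * M)%:E * (T2 z)%:E)))%E).
  apply: ge0_le_integral => //.
  - move=> z _; rewrite lee_fin; apply: mulr_ge0; last by rewrite le_min M0 k0.
    by apply: mulr_ge0; [exact: both_ge0|exact: sqr_ge0].
  - apply/measurable_EFinP; apply: measurable_funM; last exact: measurable_minr.
    apply: measurable_funM; first exact: measurable_both.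
    by apply: measurable_funX; exact: measurable_diff2.
  - apply: emeasurable_funD; first exact/measurable_EFinP.
    by apply: emeasurable_funD; apply: measurable_funeM; exact/measurable_EFinP.
  move=> z _; rewrite -!EFinM -!EFinD lee_fin.
  set x := z.1; set y := x + z.2.
  have kM : Num.min M (k z.2) <= k z.2 by rewrite ge_min lexx orbT.
  have kM' : Num.min M (k z.2) <= M by rewrite ge_min lexx.
  have m0 : 0 <= Num.min M (k z.2) by rewrite le_min M0 k0.
  have dd : (u y - u x) ^+ 2 <= (f y - f x) ^+ 2 + 4 * (`|f x - u x| + `|f y - u y|).
    have := f1 x; have := f1 y; have := u1 x; have := u1 y; rewrite !ler_norml.
    move=> u_y u_x f_y f_x.
    have -> : (u y - u x) ^+ 2 = (f y - f x) ^+ 2 +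
      ((f x - u x) - (f y - u y)) * ((f y - f x) + (u y - u x)) by ring.
    rewrite lerD2l; apply: (le_trans (ler_norm _)); rewrite normrM mulrC ler_pM//.
      by rewrite ler_norml; lra.
    exact: ler_normB.
  have -> : G z + (4 * M * T1 z + 4 * M * T2 z) =
      both r z * ((f y - f x) ^+ 2 * k z.2 + 4 * (`|f x - u x| + `|f y - u y|) * M).
    by rewrite /G /T1 /T2 /D /both -/x -/y /I; ring.
  rewrite -mulrA; apply: ler_wpM2l; first exact: both_ge0.
  apply: (@le_trans _ _ (((f y - f x) ^+ 2 + 4 * (`|f x - u x| + `|f y - u y|)) *
    Num.min M (k z.2))); first exact: ler_wpM2r.
  rewrite mulrDl; apply: lerD; first by apply: ler_wpM2l => //; exact: sqr_ge0.
  by apply: ler_wpM2l => //; apply: mulr_ge0 => //; exact: addr_ge0.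
have mE1 : measurable_fun setT (fun z => (4 * M)%:E * (T1 z)%:E)%E.
  by apply: measurable_funeM; exact/measurable_EFinP.
have mE2 : measurable_fun setT (fun z => (4 * M)%:E * (T2 z)%:E)%E.
  by apply: measurable_funeM; exact/measurable_EFinP.
have mEG : measurable_fun setT (fun z => (G z)%:E) by exact/measurable_EFinP.
have E10 z : (0 <= (4 * M)%:E * (T1 z)%:E)%E by rewrite -EFinM lee_fin mulr_ge0.
have E20 z : (0 <= (4 * M)%:E * (T2 z)%:E)%E by rewrite -EFinM lee_fin mulr_ge0.
rewrite ge0_integralD//; last 3 first.
- by move=> z _; rewrite lee_fin.
- by move=> z _; apply: adde_ge0.
- exact: emeasurable_funD.
apply: leeD => //.
rewrite (ge0_integralD _ measurableT (fun z _ => E10 z) mE1 (fun z _ => E20 z) mE2).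
have Z (T : V * V -> R) : measurable_fun setT T -> (forall z, 0 <= T z) ->
    (\int[lam \x lam]_z ((4 * M)%:E * (T z)%:E) = (4 * M)%:E * \int[lam \x lam]_z (T z)%:E)%E.
  move=> mT T0; apply: ge0_integralZl_EFin; [exact: measurableT| |exact/measurable_EFinP|exact: C0].
  by move=> z _; rewrite lee_fin.
rewrite (Z _ mT1 T10) (Z _ mT2 T20).
rewrite (_ : 8 * M * L * eps = 4 * M * (L * eps) + 4 * M * (L * eps)); last by ring.
rewrite EFinD [(4 * M * (L * eps))%:E]EFinM.
by apply: leeD; apply: lee_wpmul2l; rewrite ?lee_fin.
Qed.

End one_approximation.

Lemma truncated_variational (M : R) : 0 <= M ->
  (\int[lam \x lam]_z (both r z * (u (z.1 + z.2)%R - u z.1) ^+ 2 * Num.min M (k z.2))%:E <=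
   phi_energy phi mu s0 +
   (\sum_(j < N.+1) \int[lam]_x (gap u j x * w (x + shift_last j)))%:E)%E.
Proof.
move=> M0; apply/lee_addgt0Pr => eta eta0.
pose L := fine (lam (eball (r + 1))); have L0 : 0 <= L by rewrite fine_ge0.
pose K := 8 * M * L + N.+1%:R * (4 * A + 2).
have K0 : 0 <= K by rewrite addr_ge0// !mulr_ge0// addr_ge0// mulr_ge0.
have K1 : 0 < K + 1 by rewrite ltr_wpDl.
have e0 : 0 < eta / (K + 1) by rewrite divr_gt0.
have [f [g [[f_tame mf f1 f_le] [mg gA f_eq fu gw]]]] := approx e0.
apply: (le_trans (truncated_energy_le mf f1 fu M0)).
have V1 := variational_inequality N mphi phi1 phi_lip phi_in phi_out delta_ge0 s0_gt0
  f_tame mf f1 f_le f_eq.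
apply: (le_trans (leeD V1 (lexx _))).
rewrite -addeA -[in leRHS]addeA; apply: leeD; first exact: lexx.
rewrite -!EFinD lee_fin.
apply: (@le_trans _ _ (\sum_(j < N.+1) \int[lam]_x (gap u j x * w (x + shift_last j)) +
   (N.+1%:R * ((4 * A + 2) * (eta / (K + 1))) + 8 * M * L * (eta / (K + 1))))).
  rewrite addrA lerD2r -lerBlDl -sumrB mulr_natl -[X in _ *+ X]card_ord -sumr_const.
  apply: ler_sum => j _; apply: (le_trans (ler_norm _)).
  exact: (gap_pairing_le e0 mf f1 f_le mg gA fu gw (ltn_ord j)).
rewrite lerD2l (_ : _ + _ = K * (eta / (K + 1))); last by rewrite /K; ring.
by rewrite mulrCA ler_piMr ?(ltW eta0)// ler_pdivrMr// mul1r lerDl.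
Qed.

(** The bound of the truncated inequality does not depend on the cap [M], so monotone convergence
    removes it. *)
Lemma layer_variational :
  (\int[lam \x lam]_z (both r z * (u (z.1 + z.2)%R - u z.1) ^+ 2 * k z.2)%:E <=
   phi_energy phi mu s0 +
   (\sum_(j < N.+1) \int[lam]_x (gap u j x * w (x + shift_last j)))%:E)%E.
Proof.
have k0 := @levy_kernel_ge0 R n mu s0 s0_gt0.
have mk2 : measurable_fun setT (fun p : V * V => k p.2).
  by apply: (measurableT_comp (measurable_levy_kernel mu s0_gt0)).
pose P (z : V * V) := both r z * (u (z.1 + z.2) - u z.1) ^+ 2.
have P0 z : 0 <= P z by apply: mulr_ge0; [exact: both_ge0|exact: sqr_ge0].
have mP : measurable_fun setT P.
  apply: measurable_funM; first exact: measurable_both.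
  by apply: measurable_funX; exact: measurable_diff2.
pose G (M : nat) (z : V * V) := (P z * Num.min M%:R (k z.2))%:E.
have G0 M z : (0 <= G M z)%E by rewrite lee_fin mulr_ge0// le_min k0 ler0n.
have mG M : measurable_fun setT (G M).
  by apply/measurable_EFinP; apply: measurable_funM => //; exact: measurable_minr.
have ndG z : {homo (fun M => G M z) : a b / (a <= b)%N >-> (a <= b)%E}.
  move=> a b ab; rewrite lee_fin ler_wpM2l// le_min ge_min ler_nat ab/=.
  by rewrite ge_min lexx orbT.
have GE z : limn (G^~ z) = (P z * k z.2)%:E.
  apply/cvg_lim => //; apply: cvg_near_cst.
  exists (Num.trunc (k z.2)).+1 => // M /= kM; rewrite /G min_r//.
  by apply: (le_trans (ltW (truncnS_gt _))); rewrite ler_nat.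
under eq_integral do rewrite -GE.
rewrite monotone_convergence//.
apply: lime_le.
  apply: ereal_nondecreasing_is_cvgn => a b ab; apply: ge0_le_integral => // z _.
  exact: ndG.
by near=> M; apply: truncated_variational.
Unshelve. all: by end_near.
Qed.

End limit_of_mollifications.

(** * Refining the deformation *)

Section potential.
Context {R : realType}.

Lemma derivable_continuous (f : R -> R) : (forall x, derivable f x 1) -> continuous f.
Proof. by move=> df x; apply: differentiable_continuous; exact/derivable1_diffP. Qed.

Lemma continuous_bounded11 (f : R -> R) : continuous f ->
  exists2 C : R, 0 <= C & forall t, -1 <= t <= 1 -> `|f t| <= C.
Proof.
move=> cf; have cN : {within `[-1, 1], continuous (fun t => `|f t|)}.
  by apply: continuous_subspaceT => t; apply: continuous_comp; [exact: cf|exact: norm_continuous].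
have N11 : (-1 : R) <= 1 by lra.
have [c _ Hc] := EVT_max N11 cN.
by exists `|f c| => // t t11; apply: Hc; rewrite in_itv.
Qed.

(** The last inequality is a one-sided Taylor estimate, from two applications of the mean value
    theorem and the bound of $W''$ on $[-1,1]$, the only interval where values of [u] and [phi]
    lie. *)
Lemma potential_bounds (W : R -> R) : is_Ck 3 W -> exists2 C : R, 0 <= C &
  [/\ continuous W, continuous (derive1 W),
      forall t, -1 <= t <= 1 -> `|W t| <= C /\ `|derive1 W t| <= C &
      forall a b, -1 <= a -> a <= b -> b <= 1 ->
        derive1 W a * (b - a) <= W b - W a + C * (b - a) ^+ 2].
Proof.
move=> [dW _]; have d0 := dW 0%N isT; have d1 := dW 1%N isT; have d2 := dW 2%N isT.
have c0 := derivable_continuous d0; have c1 := derivable_continuous d1.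
have c2 := derivable_continuous d2.
have [C0 C00 H0] := continuous_bounded11 c0; have [C1 C10 H1] := continuous_bounded11 c1.
have [C2 C20 H2] := continuous_bounded11 c2.
exists (C0 + C1 + C2); first by rewrite !addr_ge0.
split => //.
  by move=> t t11; have := H0 _ t11; have := H1 _ t11 => /= h1 h0; split; lra.
move=> a b a1; rewrite le_eqVlt => /predU1P[->|ab] b1.
  by rewrite !subrr expr0n/= !mulr0 addr0.
have D0 (x : R) : is_derive x 1 W (derive1 W x) by rewrite derive1E; exact/derivableP/d0.
have D1 (x : R) : is_derive x 1 (derive1 W) (derive1n 2 W x).
  by rewrite /= [derive1 (derive1 W) x]derive1E; exact/derivableP/d1.
have [c cab Ec] := MVT ab (fun x _ => D0 x) (continuous_subspaceT c0).
move: cab; rewrite in_itv/= => /andP[ac cb].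
have [d dac Ed] := MVT ac (fun x _ => D1 x) (continuous_subspaceT c1).
move: dac; rewrite in_itv/= => /andP[ad dc].
have /H2 : -1 <= d <= 1 by lra.
rewrite ler_norml => /andP[+ _] => Hd.
have P : - C2 * (c - a) <= derive1 W c - derive1 W a by rewrite Ed ler_wpM2r// subr_ge0 ltW.
have Q : (derive1 W a - C2 * (b - a)) * (b - a) <= derive1 W c * (b - a).
  rewrite ler_wpM2r// ?subr_ge0 ?(ltW ab)//.
  have : C2 * (c - a) <= C2 * (b - a) by rewrite ler_wpM2l// lerD2r ltW.
  lra.
have S : 0 <= (C0 + C1) * (b - a) ^+ 2 by rewrite mulr_ge0 ?sqr_ge0// addr_ge0.
rewrite Ec; move: Q S; rewrite expr2; move: (b - a) (derive1 W a) (derive1 W c) => t p q; nra.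
Qed.

End potential.

Section mesh_refinement.
Context {R : realType} (n : nat).
Local Notation V := 'rV[R]_n.+1.
Local Notation lam := (lebesgue_rV n.+1).
Local Notation e := (delta_mx ord0 ord_max : V).

(** Compactness of the segment of starting points, while [t + h] may leave it. *)
Lemma continuous_equicontinuous_segment (p : R -> R) (T eta : R) : continuous p -> 0 < eta ->
  exists2 d : R, 0 < d & forall t h, 0 <= t <= T -> 0 <= h <= d -> `|p (t + h) - p t| <= eta.
Proof.
move=> cp eta0; have eta2 : 0 < eta / 2 by rewrite divr_gt0.
have /compact_near_coveringP := @segment_compact R 0 T.
move=> /(_ R (nbhs (0 : R)) (fun h t => `|p (t + h) - p t| <= eta) _).
case.
  move=> t _; have /cvgrPdist_le /(_ _ eta2) ct := cp t.
  have c2 : (fun z : R * R => z.1 + z.2) z @[z --> (t, 0 : R)] --> t.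
    have -> : nbhs t = nbhs (t + 0) by rewrite addr0.
    by apply: cvgD; [exact: cvg_fst|exact: cvg_snd].
  have n2 := c2 _ ct.
  have c1 : (fun z : R * R => z.1) z @[z --> (t, 0 : R)] --> t by exact: cvg_fst.
  have n1 := c1 _ ct.
  near=> z => /=.
  have h1 : `|p t - p z.1| <= eta / 2 by near: z.
  have h2 : `|p t - p (z.1 + z.2)| <= eta / 2 by near: z.
  have -> : p (z.1 + z.2) - p z.1 = (p t - p z.1) - (p t - p (z.1 + z.2)) by ring.
  by rewrite (le_trans (ler_normB _ _))//; lra.
move=> d d0 H; exists (d / 2); first by rewrite divr_gt0.
move=> t h t0T /andP[h0 hd]; apply: (H h).
  by rewrite /= sub0r normrN ger0_norm// (le_lt_trans hd)// gtr_pMr// invf_lt1// ltr1n.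
by rewrite /= in_itv.
Unshelve. all: by end_near.
Qed.

(** Up to [T'] uniform continuity bounds the increments. Beyond it the path is within [eta] of its
    supremum 1, so it cannot rise by more. *)
Lemma monotone_path_increments (p : R -> R) (eta : R) : continuous p ->
  {homo p : s t / s <= t} -> (forall t, p t <= 1) -> p t @[t --> +oo] --> (1 : R) ->
  0 < eta -> exists m0 : nat, forall m : nat, (m0 <= m)%N ->
   (forall t, 0 <= t -> p (t + m.+1%:R^-1) - p t <= eta) /\ 1 - p m.+1%:R <= eta.
Proof.
move=> cp pmono p1 pcvg eta0.
have /cvgrPdist_le /(_ _ eta0) := pcvg.
move=> [T [_ HT]].
pose T' := Num.max 0 (T + 1).
have HT' t : T' <= t -> 1 - p t <= eta.
  rewrite ge_max => /andP[_ Tt]; have Tt' : T < t by lra.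
  by have := HT _ Tt'; rewrite ler_norml; lra.
have [d d0 Hd] := @continuous_equicontinuous_segment p T' eta cp eta0.
exists (maxn (Num.trunc T') (Num.trunc d^-1)) => m; rewrite geq_max => /andP[mT md].
have m1 : T' <= m.+1%:R.
  by apply: (le_trans (ltW (truncnS_gt _))); rewrite ler_nat ltnS.
have m2 : m.+1%:R^-1 <= d.
  rewrite -[leRHS]invrK lef_pV2 ?posrE ?invr_gt0//.
  by apply: (le_trans (ltW (truncnS_gt _))); rewrite ler_nat ltnS.
split; last exact: HT'.
move=> t t0; have [tT|Tt] := leP t T'.
  have t0T : 0 <= t <= T' by rewrite t0.
  have h0 : (0 : R) <= m.+1%:R^-1 <= d by rewrite invr_ge0 ler0n.
  exact: le_trans (ler_norm _) (Hd _ _ t0T h0).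
by have := HT' _ (ltW Tt); have := p1 (t + m.+1%:R^-1); lra.
Qed.


Lemma increment_le_step (a : nat -> R) (p : R) j : a j <= a j.+1 ->
  increment a p j <= a j.+1 - a j.
Proof.
move=> aj; rewrite /increment /cutoff; set v := Num.max _ _.
by case: (leP v (a j)) => ?; case: (leP v (a j.+1)) => ?; lra.
Qed.

Lemma increment_eq0_or (a : nat -> R) (p : R) j : a j <= a j.+1 ->
  increment a p j = 0 \/ a j = cutoff a p j.
Proof.
move=> aj; have /eqP := slack_increment p aj.
by rewrite mulf_eq0 subr_eq0 => /orP[/eqP|/eqP]; [right|left].
Qed.

Section main_inequality.
Variables (mu : probability (measurableTypeR R) R) (s0 : R) (W : R -> R) (C : R) (u : V -> R).
Hypothesis s0_gt0 : 0 < s0.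
Hypothesis u_layer : layer_solution mu s0 W u.
Hypothesis C0 : 0 <= C.
Hypothesis cW : continuous W.
Hypothesis cW' : continuous (derive1 W).
Hypothesis WC : forall t, -1 <= t <= 1 -> `|W t| <= C /\ `|derive1 W t| <= C.
Hypothesis W_taylor : forall a b, -1 <= a -> a <= b -> b <= 1 ->
  derive1 W a * (b - a) <= W b - W a + C * (b - a) ^+ 2.
Hypothesis W1 : W 1 = 0.
Hypothesis W_ge0 : forall t, 0 <= W t.
Variables (phi : V -> R) (r : R).
Hypothesis mphi : measurable_fun setT phi.
Hypothesis phi1 : forall x, -1 <= phi x <= 1.
Hypothesis phi_lip : lip_min1 phi.
Hypothesis phi_in : forall x, enorm x < r + 1 -> phi x = 1.
Hypothesis phi_out : forall x, r + 2 <= enorm x -> phi x = -1.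
Local Notation k := (@levy_kernel R n mu s0).

Let mu_ : measurable_fun setT u. Proof. by case: u_layer. Qed.

Let u1 x : `|u x| <= 1. Proof. exact: (layer_bounded u_layer x). Qed.

Let u11 x : -1 <= u x <= 1. Proof. by rewrite -ler_norml. Qed.

Let u_le x t : 0 <= t -> u x <= u (x + t *: e). Proof. by move=> t0; exact: (layer_le u_layer x t0). Qed.

Let w x := derive1 W (u x).

Let mw : measurable_fun setT w.
Proof. by apply: (measurableT_comp _ mu_); exact: continuous_measurable_fun. Qed.

Let wC x : `|w x| <= C. Proof. by have [] := WC (u11 x). Qed.

Lemma layer_approximation rho (eps : R) : 0 < eps -> exists f g : V -> R,
  [/\ tame f, measurable_fun setT f, (forall x, `|f x| <= 1) &
   forall x t, 0 <= t -> f x <= f (x + t *: e)] /\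
  [/\ measurable_fun setT g, (forall x, `|g x| <= C),
   forall y, 2 * \int[lam]_h (sdiff f y h * k h) = - g y,
   (L1ball rho (fun x => f x - u x)%R <= eps%:E)%E &
   (L1ball rho (fun x => g x - w x)%R <= eps%:E)%E].
Proof.
move=> eps0; have [d1 d10 H1] := moll_cvg rho mu_ u1 eps0.
have [d2 d20 H2] := moll_cvg rho mw wC eps0.
pose d : R := Num.min d1 d2; have d0 : 0 < d by rewrite lt_min d10.
exists (moll d u), (moll d w); split; split.
- exact: (tame_moll d0 mu_ u1).
- exact: (measurable_moll d0 mu_ u1).
- exact: (moll_le d0 mu_ u1).
- move=> x t t0; apply: (le_moll d0 mu_ mu_ u1 u1) => z.
  by rewrite addrA; exact: u_le.
- exact: (measurable_moll d0 mw wC).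
- exact: (moll_le d0 mw wC).
- by apply: (moll_equation s0_gt0 mu_ u1 _ d0); case: u_layer.
- by apply: H1 => //; rewrite ge_min lexx.
- by apply: H2 => //; rewrite ge_min lexx orbT.
Qed.

Local Notation ugap N delta := (gap phi N delta u).

(** The Taylor error of the Riemann sum of $W'$ along the deformation. *)
Let error N delta x := C * \sum_(j < N.+1) ugap N delta j x ^+ 2.

Let v x := Num.max (u x) (phi x).

Let ugap_ge0 N delta (d0 : 0 <= delta) j x : 0 <= ugap N delta j x.
Proof. by apply: gap_ge0 => //; exact: u_le. Qed.

Let sum_gap N delta (d0 : 0 <= delta) x : \sum_(j < N.+1) ugap N delta j x = v x - u x.
Proof.
rewrite -(big_mkord xpredT (fun j => ugap N delta j x)) telescope_sumr//.
have := level_end N delta phi1 u1 x; rewrite /cutoff => h; rewrite min_l//.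
by rewrite min_r ?le_max ?lexx// !level0.
Qed.

(** Where a gap is nonzero the translate coincides with the current stage of the deformation, so [w]
    at the shifted point is $W'$ at that stage. The sum is thus a Riemann sum for $W(v) - W(u)$. *)
Let sum_gap_potential N delta (d0 : 0 <= delta) x :
  \sum_(j < N.+1) ugap N delta j x * w (x + shift_last n delta j) <=
  W (v x) - W (u x) + error N delta x.
Proof.
have E : W (v x) - W (u x) = \sum_(j < N.+1)
    (W (cutoff (level N delta u x) (phi x) j.+1) - W (cutoff (level N delta u x) (phi x) j)).
  rewrite -(big_mkord xpredT (fun j => W (cutoff (level N delta u x) (phi x) j.+1) - W (cutoff (level N delta u x) (phi x) j))) telescope_sumr//.
  have := level_end N delta phi1 u1 x; rewrite /cutoff => h; rewrite min_l//.
  by rewrite min_r ?le_max ?lexx// !level0.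
rewrite E /error mulr_sumr -big_split/=; apply: ler_sum => j _.
have aj := level_le N d0 u1 u_le x j.
have [g0|lj] := increment_eq0_or (phi x) aj.
  rewrite /gap g0 mul0r expr0n/= mulr0 addr0.
  move: g0; rewrite /increment => /eqP; rewrite subr_eq0 => /eqP ->.
  by rewrite subrr.
have -> : w (x + shift_last n delta j) = derive1 W (cutoff (level N delta u x) (phi x) j).
  by rewrite -lj /level -ltnS ltn_ord.
rewrite mulrC; apply: W_taylor.
- by have /andP[] := cutoff_bounds phi N delta u1 x j.
- by rewrite -subr_ge0; exact: ugap_ge0.
- by have /andP[] := cutoff_bounds phi N delta u1 x j.+1.
Qed.


Let mv : measurable_fun setT v. Proof. exact: measurable_maxr. Qed.

Let error_ge0 N delta x : 0 <= error N delta x.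
Proof. by apply: mulr_ge0 => //; apply: sumr_ge0 => j _; exact: sqr_ge0. Qed.

Let measurable_error N delta : measurable_fun setT (error N delta).
Proof.
apply: measurable_funM => //; apply: measurable_sum => j; apply: measurable_funX.
exact: measurable_gap.
Qed.

Let v_u_le2 x : 0 <= v x - u x <= 2.
Proof.
have /andP[p1 p2] := phi1 x; have /andP[q1 q2] := u11 x.
by rewrite /v; case: (leP (u x) (phi x)) => ?; lra.
Qed.

(** The gaps are nonnegative with sum $v - u \le 2$, so the sum of their squares is at most twice
    the largest gap. *)
Let error_le N delta (d0 : 0 <= delta) x (eta : R) :
  (forall j, (j < N.+1)%N -> ugap N delta j x <= eta) -> error N delta x <= C * (eta * 2).
Proof.
move=> ge; rewrite /error ler_wpM2l//.
have eta0 : 0 <= eta by apply: le_trans (ge 0%N isT); exact: ugap_ge0.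
apply: (@le_trans _ _ (\sum_(j < N.+1) eta * ugap N delta j x)).
  apply: ler_sum => j _; rewrite expr2 ler_wpM2r//; first exact: ugap_ge0.
  exact: ge.
by rewrite -mulr_sumr sum_gap// ler_wpM2l//; have /andP[] := v_u_le2 x.
Qed.

Let error_bound N delta (d0 : 0 <= delta) x : error N delta x <= 4 * C.
Proof.
rewrite (_ : 4 * C = C * (2 * 2)); last by ring.
apply: error_le => // j _; apply: gap_le2 => //; exact: u_le.
Qed.

Let error_supp N delta (d0 : 0 <= delta) x : r + 2 <= enorm x -> error N delta x = 0.
Proof.
move=> xr; rewrite /error big1 ?mulr0// => j _.
by rewrite (gap_supp N phi_out d0 u1 u_le)// expr0n.
Qed.

(** With steps of size [1 / m.+1] the deformation has length [m.+1], so the step tends to 0 and the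
    length to infinity together. *)
Let steps (m : nat) := (m.+1 * m.+1)%N.

Let mesh (m : nat) : R := m.+1%:R^-1.

Let mesh_ge0 m : 0 <= mesh m. Proof. by rewrite invr_ge0. Qed.

Let error_cvg x : error (steps m) (mesh m) x @[m --> \oo] --> (0 : R).
Proof.
apply/cvgrPdist_le => eta eta0; pose eta' := eta / (2 * C + 1).
have C1 : 0 < 2 * C + 1 by rewrite ltr_wpDl// mulr_ge0.
have eta'0 : 0 < eta' by rewrite divr_gt0.
have up1 t : u (x + t *: e) <= 1 by have /andP[] := u11 (x + t *: e).
have cp : continuous (fun t : R => u (x + t *: e)) by exact: (layer_continuous u_layer).
have pp : {homo (fun t : R => u (x + t *: e)) : s t / s <= t}.
  exact: (layer_nondecreasing u_layer).
have p1 : u (x + t *: e) @[t --> +oo] --> (1 : R) by exact: (layer_cvg u_layer).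
have [m0 Hm] := monotone_path_increments cp pp up1 p1 eta'0.
exists m0 => // m /= /Hm[H1 H2]; rewrite sub0r normrN ger0_norm//.
apply: (@le_trans _ _ (C * (eta' * 2))).
  apply: error_le => // j jN.
  apply: (le_trans (increment_le_step _ (level_le _ (mesh_ge0 m) u1 u_le x j))).
  move: jN; rewrite ltnS leq_eqVlt /level => /predU1P[->|jN].
    (* The last gap jumps from the translate by [m.+1] to the constant 1, and is controlled by the
       limit of the layer rather than by the step. *)
    rewrite ltnn leqnn /shift_last.
    have -> : (steps m)%:R * mesh m = m.+1%:R.
      by rewrite /steps /mesh natrM mulfK// pnatr_eq0.
    exact: H2.
  rewrite jN (ltnW jN) /shift_last -natr1 mulrDl mul1r.
  by apply: H1; rewrite mulr_ge0.
rewrite (_ : C * (eta' * 2) = eta * (2 * C) / (2 * C + 1)); last by rewrite /eta'; ring.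
by rewrite ler_pdivrMr// ler_wpM2l ?(ltW eta0)// lerDl.
Qed.

Let integrable_error m : lam.-integrable setT (EFin \o error (steps m) (mesh m)).
Proof.
apply: (@integrable_bounded_support _ _ _ (4 * C) (r + 2)) => //.
- by move=> x; rewrite ger0_norm// error_bound.
- by move=> x; exact: error_supp.
Qed.

(** The error tends to 0 only pointwise, since no uniform rate is known for the layer; its bound and
    common support allow dominated convergence. *)
Let integral_error_cvg : (\int[lam]_x (error (steps m) (mesh m) x)%:E @[m --> \oo] --> 0)%E.
Proof.
rewrite -(@integral0 _ _ _ lam setT).
apply: (@dominated_cvg _ _ _ lam setT measurableT
  (fun m x => (error (steps m) (mesh m) x)%:E) (fun=> 0%E)
  (fun x => (4 * C * \1_(eball (r + 2)) x)%:E)).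
- by move=> m; exact/measurable_EFinP.
- move=> x _; apply: cvg_EFin; first by near=> m.
  exact: error_cvg.
- by [].
- apply: (@integrable_bounded_support _ _ (fun x => 4 * C * \1_(eball (r + 2)) x) (4 * C) (r + 2)) => //.
  + by apply: measurable_funM => //; apply: measurable_indic; exact: measurable_eball.
  + move=> x; have C4 : 0 <= 4 * C by rewrite mulr_ge0.
    by rewrite ger0_norm ?mulr_ge0// ler_piMr// indicE; case: (_ \in _).
  + move=> x xr; rewrite indicE memNset ?mulr0// /eball/=.
    by apply/negP; rewrite -leNgt.
- move=> m x _; rewrite /= lee_fin ger0_norm// indicE.
  case: (boolP (x \in _)) => [_|]; first by rewrite mulr1 error_bound.
  by rewrite notin_setE /eball/= => /negP; rewrite -leNgt mulr0 => /error_supp ->.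
Unshelve. all: by end_near.
Qed.

Local Notation annulus := (eball (r + 2) `\` eball (r + 1) : set V).

Lemma layer_energy_le : 0 <= r ->
  (\int[lam \x lam]_z (both r z * (u (z.1 + z.2)%R - u z.1) ^+ 2 * k z.2)%:E +
   \int[lam]_(x in eball r) (W (u x))%:E <= phi_energy phi mu s0 + C%:E * lam annulus)%E.
Proof.
move=> r0; have mB := @measurable_eball R n.+1.
have mA : measurable annulus by exact: measurableD.
pose a x : R := C * \1_annulus x; pose b x : R := \1_(eball r) x * W (u x).
have mWu : measurable_fun setT (W \o u).
  by apply: (measurableT_comp _ mu_); exact: continuous_measurable_fun.
have ma : measurable_fun setT a by apply: measurable_funM => //; exact: measurable_indic.
have mb : measurable_fun setT b by apply: measurable_funM => //; exact: measurable_indic.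
have a0 x : 0 <= a x by rewrite mulr_ge0.
have b0 x : 0 <= b x by rewrite mulr_ge0.
have ia : lam.-integrable setT (EFin \o a).
  apply: (@integrable_bounded_support _ _ _ C (r + 2)) => //.
    by move=> x; rewrite ger0_norm// ler_piMr// indicE; case: (_ \in _).
  move=> x xr; rewrite /a indicE memNset ?mulr0// => -[+ _].
  by rewrite /eball/= ltNge xr.
have ib : lam.-integrable setT (EFin \o b).
  apply: (@integrable_bounded_support _ _ _ C r) => //.
    move=> x; rewrite normrM; have [WCx _] := WC (u11 x).
    by rewrite -[leRHS]mul1r ler_pM// indicE; case: (_ \in _); rewrite ?normr1 ?normr0.
  move=> x xr; rewrite /b indicE memNset ?mul0r// /eball/=.
  by apply/negP; rewrite -leNgt.
have IA : (\int[lam]_x (a x)%:E = C%:E * lam annulus)%E.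
  rewrite /a; under eq_integral do rewrite EFinM.
  rewrite ge0_integralZl_EFin//; last by apply/measurable_EFinP; exact: measurable_indic.
  by rewrite integral_indic// setIT.
have IB : (\int[lam]_x (b x)%:E = \int[lam]_(x in eball r) (W (u x))%:E)%E.
  rewrite [RHS]integral_mkcond; apply: eq_integral => x _.
  by rewrite patchE /b indicE; case: ifP => _; rewrite ?mul1r ?mul0r.
(* In the inner ball [v = 1], where [W] vanishes; outside the outer ball [v = u]; only the annulus
   between them costs [C]. *)
have potential_le x : W (v x) - W (u x) <= a x - b x.
  have v11 : -1 <= v x <= 1.
    by have := u11 x; have := phi1 x; rewrite /v; case: (leP (u x) (phi x)); lra.
  have [Wv _] := WC v11; have Wv' := le_trans (ler_norm _) Wv.
  have Wu := W_ge0 (u x); have Wv0 := W_ge0 (v x).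
  have b1 : b x <= W (u x) by rewrite ler_piMl// indicE; case: (_ \in _).
  have [x1|x1] := ltP (enorm x) (r + 1).
    have -> : v x = 1.
      by rewrite /v phi_in// max_r//; have /andP[] := u11 x.
    by rewrite W1; have := a0 x; lra.
  have bx : b x = 0.
    rewrite /b indicE memNset ?mul0r// /eball/=; apply/negP; rewrite -leNgt; lra.
  have [x2|x2] := ltP (enorm x) (r + 2).
    have -> : a x = C.
      rewrite /a indicE mem_set ?mulr1//; split=> //.
      by rewrite /eball/=; apply/negP; rewrite -leNgt.
    by rewrite bx; lra.
  have -> : v x = u x.
    by rewrite /v phi_out// max_l//; have /andP[] := u11 x.
  by rewrite subrr bx subr0.
rewrite -IB -IA.
set K := (\int[lam \x lam]_z _)%E.
have main m : (K <= phi_energy phi mu s0 + (\int[lam]_x (a x)%:E - \int[lam]_x (b x)%:E +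
    \int[lam]_x (error (steps m) (mesh m) x)%:E))%E.
  have ie := integrable_error m.
  have L := layer_variational mphi phi1 phi_lip phi_in phi_out (mesh_ge0 m) s0_gt0
    mu_ u1 u_le mw wC (@layer_approximation _).
  apply: (le_trans (L (steps m))); apply: leeD => //.
  rewrite !EFin_Rintegral// -EFinB -EFinD lee_fin -RintegralB//.
  have iab : lam.-integrable setT (EFin \o (fun x => a x - b x)).
    by have := integrableB measurableT ia ib; apply: eq_integrable.
  rewrite -RintegralD//.
  pose G j x := ugap (steps m) (mesh m) j x * w (x + shift_last n (mesh m) j).
  have iG (j : 'I_(steps m).+1) : lam.-integrable setT (EFin \o G j).
    apply: (@integrable_gap _ _ _ _ _ _ mphi phi_out (mesh_ge0 m) _ u1 u_le _ C) => //.
    by apply: (measurableT_comp mw); exact: measurable_rVD.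
  have [iS <-] := Rintegral_sum (index_enum _) iG.
  apply: le_Rintegral => //.
    by have := integrableD measurableT iab ie; apply: eq_integrable.
  move=> x _; apply: (le_trans (sum_gap_potential _ (mesh_ge0 m) x)).
  by rewrite lerD2r.
(* [K] does not depend on [m], so the error can be made arbitrarily small. *)
have Kab : (K <= phi_energy phi mu s0 + (\int[lam]_x (a x)%:E - \int[lam]_x (b x)%:E))%E.
  apply/lee_addgt0Pr => eta eta0.
  have /fine_cvgP[_ /cvgrPdist_lt /(_ _ eta0) [m _ /(_ m (leqnn m))]] := integral_error_cvg.
  rewrite /= sub0r normrN => Em; apply: (le_trans (main m)); rewrite addeA leeD2l//.
  rewrite EFin_Rintegral// lee_fin ltW//; apply: le_lt_trans Em; exact: ler_norm.
have fb : (\int[lam]_x (b x)%:E)%E \is a fin_num by exact: (integrable_fin_num _ ib).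
by rewrite -leeBrDr// -addeA.
Qed.

End main_inequality.
End mesh_refinement.

(** * The energy of the competitor *)

Section geometry.
Context {R : realType} (n : nat).
Local Notation V := 'rV[R]_n.+1.
Local Notation lam := (lebesgue_rV n.+1).

Section clamp.
Variable r : R.

(** Slope 2 in the radius takes the value from 1 to -1 across an annulus of width 1. *)
Definition clamp (x : V) : R := Num.max (-1) (Num.min 1 (1 - 2 * (enorm x - (r + 1)))).

Lemma clamp_bounds x : -1 <= clamp x <= 1.
Proof. by rewrite /clamp le_max lexx/= ge_max ge_min lexx; lra. Qed.

Lemma clamp_in x : enorm x < r + 1 -> clamp x = 1.
Proof. by move=> xr; rewrite /clamp min_l ?max_r//; lra. Qed.

Lemma clamp_out x : r + 2 <= enorm x -> clamp x = -1.
Proof. by move=> xr; rewrite /clamp min_r ?max_l//; lra. Qed.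

Lemma measurable_clamp : measurable_fun setT clamp.
Proof.
apply: measurable_maxr => //; apply: measurable_minr => //.
apply: measurable_funB => //; apply: measurable_funM => //.
by apply: measurable_funB => //; exact: measurable_enorm.
Qed.

Lemma clamp_lip x h : `|clamp (x + h) - clamp x| <= 2 * min1 h.
Proof.
have := clamp_bounds (x + h); have := clamp_bounds x; rewrite /min1.
have [h1|h1] := leP 1 (enorm h); first by rewrite ler_norml; lra.
move=> _ _; rewrite /clamp (le_trans (dist_max _ _ _ _))// subrr normr0 add0r.
rewrite (le_trans (dist_min _ _ _ _))// subrr normr0 add0r.
have -> : 1 - 2 * (enorm (x + h) - (r + 1)) - (1 - 2 * (enorm x - (r + 1))) =
  2 * (enorm x - enorm (x + h)) by ring.
rewrite normrM normr_nat ler_wpM2l//.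
by rewrite distrC; have := ler_dist_enorm (x + h) x; rewrite addrAC subrr add0r.
Qed.

Lemma lip_min1_clamp : lip_min1 clamp.
Proof. by exists 2 => //; exact: clamp_lip. Qed.

End clamp.

Section shells.
Variables (mu : probability (measurableTypeR R) R) (s0 : R).
Hypothesis s0_gt0 : 0 < s0.
Local Notation k := (@levy_kernel R n mu s0).

Definition shell r (x y : V) : R := \1_(eball (r + 2)) x * \1_(~` eball (r + 1)) y.

(** Both orders of the pair. Pairs inside the annulus count twice, which is harmless for an upper
    bound. *)
Definition shells r (z : V * V) : R := shell r z.1 (z.1 + z.2) + shell r (z.1 + z.2) z.1.

Lemma shell_ge0 r x y : 0 <= shell r x y. Proof. exact: mulr_ge0. Qed.

Lemma shells_ge0 r z : 0 <= shells r z.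
Proof. by rewrite addr_ge0// shell_ge0. Qed.

Lemma measurable_shell r d (T : measurableType d) (f g : T -> V) :
  measurable_fun setT f -> measurable_fun setT g ->
  measurable_fun setT (fun t => shell r (f t) (g t)).
Proof.
move=> mf mg; have mB := @measurable_eball R n.+1.
have m1 : measurable_fun setT (\1_(eball (r + 2)) : V -> R) by exact: measurable_indic.
have m2 : measurable_fun setT (\1_(~` eball (r + 1)) : V -> R).
  by apply: measurable_indic; exact: measurableC.
by apply: measurable_funM; [exact: (measurableT_comp m1)|exact: (measurableT_comp m2)].
Qed.

Lemma measurable_shells r : measurable_fun setT (shells r).
Proof.
by apply: measurable_funD; apply: measurable_shell => //; exact: measurable_rVD.
Qed.

(** The constant of [lebesgue_annulus_le], with $2^n$ from $r + 2 \le 2r$. *)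
Definition vol_cst : R := 2 ^+ n.+1 * n.+1%:R * 2 ^+ n.

Lemma vol_cst_ge0 : 0 <= vol_cst.
Proof. by rewrite !mulr_ge0. Qed.

Lemma annulus_vol r a : 2 <= r -> a <= r + 2 ->
  (lam (eball (r + 2) `\` eball a) <= (vol_cst * r ^+ n * (r + 2 - a))%:E)%E.
Proof.
move=> r2 ar; have r20 : 0 < r + 2 by lra.
apply: (le_trans (lebesgue_annulus_le n r20 ar)).
rewrite lee_fin ler_wpM2r ?subr_ge0//.
rewrite /vol_cst -[leRHS]mulrA ler_wpM2l ?mulr_ge0//.
by rewrite -exprMn lerXn2r ?nnegrE; lra.
Qed.

(** If $|x + h| \ge r + 1$ then $|x| \ge r + 1 - |h|$, so [x] lies in an annulus of width $1 + |h|$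
    inside the outer ball. For long [h] the whole ball is taken, as the annulus of inner radius
    0. *)
Lemma integral_shell_le r h : 2 <= r ->
  (\int[lam]_x (shell r x (x + h)%R)%:E <=
   (vol_cst * r ^+ n * Num.min (1 + enorm h) (r + 2))%:E)%E.
Proof.
move=> r2; have h0 := enorm_ge0 h.
have ms : measurable_fun setT (fun x : V => (shell r x (x + h))%:E).
  by apply/measurable_EFinP; apply: measurable_shell => //; exact: measurable_rVD.
have bound a : a <= r + 2 -> a <= r + 1 - enorm h \/ a <= 0 ->
    (\int[lam]_x (shell r x (x + h)%R)%:E <= (vol_cst * r ^+ n * (r + 2 - a))%:E)%E.
  move=> ar2 Ha; have mA : measurable (eball (r + 2) `\` eball a : set V).
    by apply: measurableD; exact: measurable_eball.
  apply: le_trans (annulus_vol r2 ar2).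
  rewrite -[X in lam X]setIT -integral_indic//; apply: ge0_le_integral => //.
  - by move=> x _; rewrite lee_fin shell_ge0.
  - by apply/measurable_EFinP; exact: measurable_indic.
  move=> x _; rewrite lee_fin /shell !indicE.
  case: (boolP (x \in eball (r + 2))) => [x1|_]; last by rewrite mul0r.
  case: (boolP (x + h \in _)) => [x2|_]; last by rewrite mulr0.
  rewrite mem_set ?mulr1//; split; first exact: set_mem x1.
  move: x2; rewrite inE /eball/= => /negP; rewrite -leNgt => x2.
  apply/negP; rewrite -leNgt.
  have := enormD x h; have := enorm_ge0 x; case: Ha; lra.
have vr : 0 <= vol_cst * r ^+ n by rewrite mulr_ge0 ?vol_cst_ge0// exprn_ge0//; lra.
rewrite minEle; case: ifP => _.
  rewrite (_ : 1 + enorm h = r + 2 - (r + 1 - enorm h)); last by ring.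
  by apply: bound; [lra|left].
rewrite -[r + 2 in X in (_ <= X)%E]subr0; apply: bound; [lra|by right].
Qed.

Lemma integral_shells_le r h : 2 <= r ->
  (\int[lam]_x (shells r (x, h))%:E <=
   (2 * (vol_cst * r ^+ n * Num.min (1 + enorm h) (r + 2)))%:E)%E.
Proof.
move=> r2; rewrite mulr_natl mulr2n EFinD.
have m1 : measurable_fun setT (fun x : V => (shell r x (x + h))%:E).
  by apply/measurable_EFinP; apply: measurable_shell => //; exact: measurable_rVD.
have m2 (g : V) : measurable_fun setT (fun x : V => (shell r (x + g) x)%:E).
  by apply/measurable_EFinP; apply: measurable_shell => //; exact: measurable_rVD.
rewrite /shells /=; under eq_integral do rewrite EFinD.
rewrite ge0_integralD//; last 2 first.
- by move=> x _; rewrite lee_fin shell_ge0.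
- by move=> x _; rewrite lee_fin shell_ge0.
apply: leeD; first exact: integral_shell_le.
rewrite -enormN -(ge0_integral_shift (- h))//; last by move=> x; rewrite lee_fin shell_ge0.
under eq_integral do rewrite subrK.
exact: integral_shell_le.
Qed.

(** The integral in [x] comes first and gives a volume. For $|h| < 1$ the volume is of order $r^n$
    and the near integral is bounded; for $|h| \ge 1$ it carries $\min(1+|h|, r+2)$, at most twice
    $\min(|h|, 4 \cdot 2^m)$ since $r < 2^{m+1}$. The near part is absorbed because the sum is at
    least 1. *)
Lemma shells_energy_le : exists2 K : R, 0 < K &
  forall (mu : probability (measurableTypeR R) R) (r : R) (m : nat), 2 <= r ->
  2 ^+ m <= r < 2 ^+ m.+1 ->
  (\int[lam \x lam]_z (shells r z * min1 z.2 ^+ 2 * @levy_kernel R n mu s0 z.2)%:E <=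
   (K * (r ^+ n * \sum_(j < m) (2 `^ (1 - 2 * s0)) ^+ j))%:E)%E.
Proof.
have [C1 C10 H1] := @integral_levy_near0 R n s0 s0_gt0.
have [C2 C20 H2] := @integral_levy_far R n s0 s0_gt0.
exists (4 * vol_cst * (C1 + C2) + 1).
  by rewrite ltr_wpDl// mulr_ge0// ?mulr_ge0 ?vol_cst_ge0// addr_ge0// ltW.
move=> nu r m r2 /andP[mr rm].
have m0 : (0 < m)%N.
  by rewrite lt0n; apply/eqP => m0; move: rm; rewrite m0 expr1; lra.
have k0 := @levy_kernel_ge0 R n nu s0 s0_gt0.
have mk := @measurable_levy_kernel R n nu s0 s0_gt0.
have r0 : 0 <= r ^+ n by rewrite exprn_ge0//; lra.
pose S := \sum_(j < m) (2 `^ (1 - 2 * s0)) ^+ j.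
have S1 : 1 <= S.
  rewrite /S -(prednK m0) big_ord_recl expr0 lerDl; apply: sumr_ge0 => j _.
  by apply: exprn_ge0; exact: powR_ge0.
pose F (x h : V) := (shells r (x, h) * min1 h ^+ 2 * levy_kernel nu s0 h)%:E.
have mc : measurable_fun setT (fun h : V => min1 h ^+ 2 * levy_kernel nu s0 h).
  by apply: measurable_funM => //; apply: measurable_funX; exact: measurable_min1.
have c0 (h : V) : 0 <= min1 h ^+ 2 * levy_kernel nu s0 h.
  by apply: mulr_ge0; [exact: sqr_ge0|exact: k0].
have F0 (x h : V) : (0 <= F x h)%E.
  by rewrite lee_fin -mulrA; apply: mulr_ge0; [exact: shells_ge0|exact: c0].
have mF : measurable_fun setT (fun z : V * V => F z.1 z.2).
  apply/measurable_EFinP; apply: measurable_funM; last exact: (measurableT_comp mk).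
  apply: measurable_funM; last first.
    by apply: measurable_funX; apply: (measurableT_comp (@measurable_min1 R n)).
  have -> : (fun z : V * V => shells r (z.1, z.2)) = shells r by apply/funext => -[].
  exact: measurable_shells.
have -> : (\int[lam \x lam]_z (shells r z * min1 z.2 ^+ 2 * levy_kernel nu s0 z.2)%:E =
    \int[lam]_h \int[lam]_x F x h)%E.
  transitivity (\int[lam \x lam]_z F z.1 z.2)%E; first exact: eq_integral.
  by apply: (etrans (integral_prodE lam lam mF F0)); exact: integral_exchange.
pose near (h : V) : R := \1_(eball 1) h * enorm h ^+ 2 * levy_kernel nu s0 h.
pose far (h : V) : R := \1_(~` eball 1) h * Num.min (enorm h) (4 * 2 ^+ m) * levy_kernel nu s0 h.
have near0 (h : V) : 0 <= near h.
  by apply: mulr_ge0; [apply: mulr_ge0 => //; exact: sqr_ge0|exact: k0].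
have far0 (h : V) : 0 <= far h.
  by apply: mulr_ge0 => //; apply: mulr_ge0 => //; rewrite le_min enorm_ge0 mulr_ge0// exprn_ge0.
have mB := @measurable_eball R n.+1 1.
have mnear : measurable_fun setT near.
  apply: measurable_funM => //; apply: measurable_funM; first exact: measurable_indic.
  by apply: measurable_funX; exact: measurable_enorm.
have mfar : measurable_fun setT far.
  apply: measurable_funM => //; apply: measurable_funM.
    by apply: measurable_indic; exact: measurableC.
  by apply: measurable_minr => //; exact: measurable_enorm.
pose D : R := 4 * vol_cst * r ^+ n.
have D0 : 0 <= D by rewrite !mulr_ge0// vol_cst_ge0.
apply: (@le_trans _ _ (\int[lam]_h (D%:E * ((near h)%:E + (far h)%:E)))%E).
  apply: ge0_le_integral => //.
  - by move=> h _; exact: integral_ge0.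
  - exact: (@measurable_integrall _ _ _ _ _ lam F).
  - by apply: measurable_funeM; apply: emeasurable_funD; exact/measurable_EFinP.
  move=> h _; rewrite /F; under eq_integral do rewrite -mulrA mulrC EFinM.
  have msh : measurable_fun setT (fun x : V => (shells r (x, h))%:E).
    apply/measurable_EFinP; apply: (measurableT_comp (measurable_shells r)).
    exact: measurable_pair2.
  rewrite ge0_integralZl_EFin//; last by move=> x _; rewrite lee_fin shells_ge0.
  apply: (@le_trans _ _ ((min1 h ^+ 2 * levy_kernel nu s0 h)%:E *
    (2 * (vol_cst * r ^+ n * Num.min (1 + enorm h) (r + 2)))%:E)%E).
    by apply: lee_wpmul2l; rewrite ?lee_fin//; exact: integral_shells_le.
  rewrite -EFinD -!EFinM lee_fin /near /far.
  have -> : min1 h ^+ 2 * levy_kernel nu s0 h *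
    (2 * (vol_cst * r ^+ n * Num.min (1 + enorm h) (r + 2))) =
    2 * vol_cst * r ^+ n * levy_kernel nu s0 h * (min1 h ^+ 2 * Num.min (1 + enorm h) (r + 2)).
    by ring.
  pose Y : R := \1_(eball 1) h * enorm h ^+ 2 +
    \1_(~` eball 1) h * Num.min (enorm h) (4 * 2 ^+ m).
  have -> : D * (\1_(eball 1) h * enorm h ^+ 2 * levy_kernel nu s0 h +
      \1_(~` eball 1) h * Num.min (enorm h) (4 * 2 ^+ m) * levy_kernel nu s0 h) =
      2 * vol_cst * r ^+ n * levy_kernel nu s0 h * (2 * Y) by rewrite /D /Y; ring.
  have P0 : 0 <= 2 * vol_cst * r ^+ n * levy_kernel nu s0 h.
    by apply: mulr_ge0 => //; apply: mulr_ge0 => //; rewrite mulr_ge0// vol_cst_ge0.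
  apply: ler_wpM2l => //; rewrite /Y /min1 !indicE in_setC.
  have h0 := enorm_ge0 h.
  have [h1|h1] := ltP (enorm h) 1.
    rewrite mem_set//= mul1r mul0r addr0 mulrC.
    by apply: ler_wpM2r; rewrite ?sqr_ge0// ge_min; apply/orP; left; lra.
  rewrite memNset/=; last by rewrite /eball/=; apply/negP; rewrite -leNgt.
  rewrite expr1n !mul1r mul0r add0r.
  have rm' : r < 2 * 2 ^+ m by move: rm; rewrite exprS.
  have [_|_] := leP (enorm h) (4 * 2 ^+ m); rewrite ge_min; apply/orP; [left|right]; lra.
rewrite ge0_integralZl_EFin//; last 2 first.
- by move=> h _; rewrite -EFinD lee_fin addr_ge0.
- by apply: emeasurable_funD; exact/measurable_EFinP.
have mEn : measurable_fun setT (fun h => (near h)%:E) by exact/measurable_EFinP.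
have mEf : measurable_fun setT (fun h => (far h)%:E) by exact/measurable_EFinP.
have En h : setT h -> (0 <= (near h)%:E)%E by rewrite lee_fin.
have Ef h : setT h -> (0 <= (far h)%:E)%E by rewrite lee_fin.
rewrite (ge0_integralD _ measurableT En mEn Ef mEf).
apply: (@le_trans _ _ (D%:E * (C1%:E + (C2 * S)%:E))%E).
  by apply: lee_wpmul2l; rewrite ?lee_fin//; apply: leeD; [exact: H1|exact: H2].
rewrite -EFinD -EFinM lee_fin.
apply: (@le_trans _ _ (D * ((C1 + C2) * S))).
  rewrite ler_wpM2l// mulrDl lerD2r ler_peMr// ltW//.
have -> : D * ((C1 + C2) * S) = 4 * vol_cst * (C1 + C2) * (r ^+ n * S) by rewrite /D; ring.
rewrite ler_wpM2r ?lerDl// mulr_ge0//; lra.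
Qed.


Lemma shells_ge1 r (z : V * V) :
  (enorm z.1 < r + 2 /\ r + 1 <= enorm (z.1 + z.2)) \/
  (enorm (z.1 + z.2) < r + 2 /\ r + 1 <= enorm z.1) -> 1 <= shells r z.
Proof.
have E (x y : V) : enorm x < r + 2 -> r + 1 <= enorm y -> shell r x y = 1.
  move=> xr yr; rewrite /shell !indicE mem_set// mem_set ?mul1r//.
  by rewrite /eball/=; apply/negP; rewrite -leNgt.
rewrite /shells; case=> -[h1 h2].
  by rewrite (E _ _ h1 h2) lerDl shell_ge0.
by rewrite (E _ _ h1 h2) lerDr shell_ge0.
Qed.

(** A pair that meets the ball of radius [r] without lying in that of radius [r + 1] has $|h| \ge
    1$, so [min1] is 1 there and the trivial bound 4 suffices. The margin 1 between the two radii
    serves this purpose. *)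
Lemma cross_sqr_diff_le (u : V -> R) (r : R) (z : V * V) : (forall x, `|u x| <= 1) ->
  \1_(cross (eball r)) (z.1, z.1 + z.2) * (u (z.1 + z.2) - u z.1) ^+ 2 <=
  both r z * (u (z.1 + z.2) - u z.1) ^+ 2 + 4 * (shells r z * min1 z.2 ^+ 2).
Proof.
move=> u1.
have d0 := sqr_ge0 (u (z.1 + z.2) - u z.1).
have d4 : (u (z.1 + z.2) - u z.1) ^+ 2 <= 4.
  have := u1 z.1; have := u1 (z.1 + z.2); rewrite !ler_norml => uy ux.
  rewrite (_ : 4 = 2 ^+ 2); last by ring.
  rewrite -[leLHS]real_normK ?num_real// lerXn2r ?nnegrE//.
  by rewrite ler_norml; lra.
have m0 := sqr_ge0 (min1 z.2); have S0 := shells_ge0 r z; have B0 := both_ge0 r z.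
have R0 : 0 <= 4 * (shells r z * min1 z.2 ^+ 2) by apply: mulr_ge0 => //; exact: mulr_ge0.
have hx := enormD z.1 z.2; have hy := enormD (z.1 + z.2) (- z.2).
rewrite addrK enormN in hy.
have c1 : \1_(cross (eball r)) (z.1, z.1 + z.2) * (u (z.1 + z.2) - u z.1) ^+ 2 <=
    (u (z.1 + z.2) - u z.1) ^+ 2 by rewrite ler_piMl// indicE; case: (_ \in _).
have far : 1 <= enorm z.2 -> 1 <= shells r z ->
    4 <= 4 * (shells r z * min1 z.2 ^+ 2).
  by move=> h1 s1; rewrite /min1 min_l// expr1n mulr1; lra.
have BD := mulr_ge0 B0 d0.
have [xr|xr] := ltP (enorm z.1) (r + 1); have [yr|yr] := ltP (enorm (z.1 + z.2)) (r + 1).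
- have -> : both r z = 1 by rewrite /both !indicE !mem_set// mulr1.
  by rewrite mul1r; lra.
- have [xr'|xr'] := ltP (enorm z.1) r.
    have h1 : 1 <= enorm z.2 by lra.
    have s1 : 1 <= shells r z by apply: shells_ge1; left; split => //; lra.
    by have := far h1 s1; lra.
  rewrite [X in X * _ <= _]indicE memNset ?mul0r ?addr_ge0//.
  by rewrite /cross /eball/=; apply; split; apply/negP; rewrite -leNgt; lra.
- have [yr'|yr'] := ltP (enorm (z.1 + z.2)) r.
    have h1 : 1 <= enorm z.2 by lra.
    have s1 : 1 <= shells r z by apply: shells_ge1; right; split => //; lra.
    by have := far h1 s1; lra.
  rewrite [X in X * _ <= _]indicE memNset ?mul0r ?addr_ge0//.
  by rewrite /cross /eball/=; apply; split; apply/negP; rewrite -leNgt; lra.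
- rewrite [X in X * _ <= _]indicE memNset ?mul0r ?addr_ge0//.
  by rewrite /cross /eball/=; apply; split; apply/negP; rewrite -leNgt; lra.
Qed.

(** A pair not counted by [shells] lies entirely in the inner ball or entirely outside the outer
    one, where [clamp] is constant. *)
Lemma clamp_sqr_diff_le (r : R) (z : V * V) :
  (clamp r (z.1 + z.2) - clamp r z.1) ^+ 2 <= 4 * (shells r z * min1 z.2 ^+ 2).
Proof.
have m0 := sqr_ge0 (min1 z.2); have S0 := shells_ge0 r z.
have R0 : 0 <= 4 * (shells r z * min1 z.2 ^+ 2) by apply: mulr_ge0 => //; exact: mulr_ge0.
have c4 : (clamp r (z.1 + z.2) - clamp r z.1) ^+ 2 <= 4 * min1 z.2 ^+ 2.
  rewrite (_ : 4 * _ = (2 * min1 z.2) ^+ 2); last by ring.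
  rewrite -[leLHS]real_normK ?num_real// lerXn2r ?nnegrE ?mulr_ge0 ?min1_ge0//.
  exact: clamp_lip.
have far : 1 <= shells r z ->
    (clamp r (z.1 + z.2) - clamp r z.1) ^+ 2 <= 4 * (shells r z * min1 z.2 ^+ 2).
  by move=> s1; apply: (le_trans c4); rewrite ler_wpM2l// ler_peMl.
have [xr|xr] := ltP (enorm z.1) (r + 1); have [yr|yr] := ltP (enorm (z.1 + z.2)) (r + 1).
- by rewrite !clamp_in// subrr expr0n.
- by apply/far/shells_ge1; left; split => //; lra.
- by apply/far/shells_ge1; right; split => //; lra.
- have [xr'|xr'] := ltP (enorm z.1) (r + 2); first by apply/far/shells_ge1; left.
  have [yr'|yr'] := ltP (enorm (z.1 + z.2)) (r + 2); first by apply/far/shells_ge1; right.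
  by rewrite !clamp_out// subrr expr0n.
Qed.

Let mk2 : measurable_fun setT (fun p : V * V => k p.2).
Proof. by apply: (measurableT_comp (measurable_levy_kernel mu s0_gt0)). Qed.

Let k0 h : 0 <= k h. Proof. exact: levy_kernel_ge0. Qed.

Let sh r (z : V * V) : R := shells r z * min1 z.2 ^+ 2 * k z.2.

Let sh_ge0 r z : (0 <= (sh r z)%:E)%E.
Proof.
rewrite lee_fin; apply: mulr_ge0; last exact: k0.
by apply: mulr_ge0; [exact: shells_ge0|exact: sqr_ge0].
Qed.

Let measurable_sh r : measurable_fun setT (fun z => (sh r z)%:E).
Proof.
apply/measurable_EFinP; apply: measurable_funM => //; apply: measurable_funM.
  exact: measurable_shells.
by apply: measurable_funX; exact: (measurableT_comp (@measurable_min1 R n)).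
Qed.

Let integral_sh4 r : (\int[lam \x lam]_z (4%:E * (sh r z)%:E) =
  4%:E * \int[lam \x lam]_z (sh r z)%:E)%E.
Proof. by apply: ge0_integralZl_EFin => // *; exact: sh_ge0. Qed.

Lemma phi_energy_le (r : R) : (phi_energy (clamp r) mu s0 <=
   4%:E * \int[lam \x lam]_z (shells r z * min1 z.2 ^+ 2 * k z.2)%:E)%E.
Proof.
rewrite -integral_sh4; apply: ge0_le_integral => //.
- by move=> z _; rewrite lee_fin; apply: mulr_ge0; [exact: sqr_ge0|exact: k0].
- apply/measurable_EFinP; apply: measurable_funM => //; apply: measurable_funX.
  by apply: measurable_diff2; exact: measurable_clamp.
- exact: measurable_funeM.
move=> z _; rewrite -EFinM lee_fin /sh [4 * _]mulrA; apply: ler_wpM2r; first exact: k0.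
exact: clamp_sqr_diff_le.
Qed.

Lemma kinetic_le (u : V -> R) (r : R) : measurable_fun setT u -> (forall x, `|u x| <= 1) ->
  (kinetic mu s0 u (eball r) <=
   \int[lam \x lam]_z (both r z * (u (z.1 + z.2)%R - u z.1) ^+ 2 * k z.2)%:E +
   4%:E * \int[lam \x lam]_z (shells r z * min1 z.2 ^+ 2 * k z.2)%:E)%E.
Proof.
move=> mu_ u1; have mB := @measurable_eball R n.+1 r.
have md2 : measurable_fun setT (fun z : V * V => (u (z.1 + z.2) - u z.1) ^+ 2).
  by apply: measurable_funX; exact: measurable_diff2.
have mI : measurable_fun setT
    (fun z : V * V => (both r z * (u (z.1 + z.2) - u z.1) ^+ 2 * k z.2)%:E).
  apply/measurable_EFinP; apply: measurable_funM => //; apply: measurable_funM => //.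
  exact: measurable_both.
have I0 z : setT z -> (0 <= (both r z * (u (z.1 + z.2)%R - u z.1) ^+ 2 * k z.2)%:E)%E.
  move=> _; rewrite lee_fin; apply: mulr_ge0; last exact: k0.
  by apply: mulr_ge0; [exact: both_ge0|exact: sqr_ge0].
have m4 : measurable_fun setT (fun z => 4%:E * (sh r z)%:E)%E by exact: measurable_funeM.
have n4 z : setT z -> (0 <= 4%:E * (sh r z)%:E)%E.
  by move=> _; apply: mule_ge0 => //; rewrite lee_fin.
rewrite (kinetic_coordE mu s0_gt0 mu_ mB) -integral_sh4.
rewrite -(ge0_integralD _ measurableT I0 mI n4 m4); apply: ge0_le_integral => //.
- move=> z _; rewrite lee_fin; apply: mulr_ge0; last exact: k0.
  by apply: mulr_ge0 => //; exact: sqr_ge0.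
- apply/measurable_EFinP; apply: measurable_funM => //; apply: measurable_funM => //.
  have mc : measurable_fun setT (\1_(cross (eball r)) : V * V -> R).
    by apply: measurable_indic; exact: measurable_cross.
  have mp : measurable_fun setT (fun z : V * V => (z.1, z.1 + z.2)).
    by apply: measurable_fun_pair => //; exact: measurable_rVD.
  exact: (measurableT_comp mc mp).
- exact: emeasurable_funD.
move=> z _; rewrite -EFinM -EFinD lee_fin /sh [4 * _]mulrA -mulrDl.
by apply: ler_wpM2r; [exact: k0|exact: cross_sqr_diff_le].
Qed.

End shells.
End geometry.

(* The space is R^(n+1). *)
Theorem proposition1p2 (R : realType) (n : nat) (s0 : R) (W : R -> R)
    (s0_gt0 : 0 < s0) (s0_lt1 : s0 < 1)
    (W_C3 : is_Ck 3 W) (W_1 : W 1 = 0) (W_N1 : W (-1) = 0)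
    (W_gt0 : forall t : R, t != 1 -> t != -1 -> 0 < W t) :
  exists C : R,
    forall mu : probability (measurableTypeR R) R,
      mu `[s0, 1]%classic = 1%E ->
      measure_support mu `<=` `[s0, 1]%classic ->
      (forall s : R, measure_support mu `<=` `[s, 1]%classic -> s <= s0) ->
      mu [set 1] = 0%E ->
      forall u : 'rV[R]_n.+1 -> R, layer_solution mu s0 W u ->
      forall r : R, 2 <= r ->
        (energy mu s0 W u (eball r) <= (C * Phi n.+1 s0 r)%:E)%E.
Proof.
have W_ge0 t : 0 <= W t.
  have [->|t1] := eqVneq t 1; first by rewrite W_1.
  have [->|tN1] := eqVneq t (-1); first by rewrite W_N1.
  exact/ltW/W_gt0.
have [A A0 [cW cW' WA W_taylor]] := potential_bounds W_C3.
have [K K0 HK] := @shells_energy_le R n s0 s0_gt0.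
have [P P0 HP] := @geometric_sum_Phi_le R n s0 s0_gt0.
pose v := @vol_cst R n; have v0 : 0 <= v := @vol_cst_ge0 R n.
(* The shell energy is counted four times in the kinetic energy of [u] and four times in the energy
   of [clamp]; [A * v] is the potential on the annulus, and [P] passes from the geometric sum to
   [Phi]. *)
exists ((8 * K + A * v) * P) => mu _ _ _ _ u u_layer r r2.
have [mu_ _ _ _] := u_layer.
have u1 x : `|u x| <= 1 by exact: (layer_bounded u_layer x).
have r1 : 1 <= r by lra.
have r0 : 0 <= r by lra.
have [m mr] := exists_dyadic_ge1 r1.
have m0 : (0 < m)%N.
  rewrite lt0n; apply/eqP => m0; move: mr; rewrite m0 expr1; lra.
set S := \sum_(j < m) (2 `^ (1 - 2 * s0)) ^+ j : R.
(* The first term of the sum is 1, so the annulus term, of order [r ^+ n], is absorbed by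
   [r ^+ n * S]. *)
have S1 : 1 <= S.
  rewrite /S -(prednK m0) big_ord_recl expr0 lerDl; apply: sumr_ge0 => j _.
  by apply: exprn_ge0; exact: powR_ge0.
have rn0 : 0 <= r ^+ n by exact: exprn_ge0.
have Q0 : 0 <= r ^+ n * S by apply: mulr_ge0 => //; lra.
have Sh := HK mu r m r2 mr.
have Ph := @phi_energy_le R n mu s0 s0_gt0 r.
have Kin := kinetic_le mu s0_gt0 r mu_ u1.
have En := layer_energy_le s0_gt0 u_layer A0 cW cW' WA W_taylor W_1 W_ge0
  (@measurable_clamp R n r) (@clamp_bounds R n r) (@lip_min1_clamp R n r)
  (@clamp_in R n r) (@clamp_out R n r) r0.
have An : (lebesgue_rV n.+1 (eball (r + 2) `\` eball (r + 1)) <= (v * r ^+ n)%:E)%E.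
  have r12 : r + 1 <= r + 2 by lra.
  apply: (le_trans (@annulus_vol R n r (r + 1) r2 r12)).
  by rewrite (_ : r + 2 - (r + 1) = 1) ?mulr1//; ring.
rewrite /energy; move: Sh Ph Kin En.
set I := (\int[_]_z (shells r z * _ * _)%:E)%E => Sh Ph Kin En.
apply: (@le_trans _ _ (4%:E * I + (4%:E * I + A%:E * (v * r ^+ n)%:E))%E).
  apply: (le_trans (leeD Kin (lexx _))); rewrite addeAC addeC; apply: leeD => //.
  apply: (le_trans En); apply: leeD => //.
  by apply: lee_wpmul2l.
apply: (@le_trans _ _ (4 * (K * (r ^+ n * S)) + (4 * (K * (r ^+ n * S)) + A * (v * r ^+ n)))%:E).
  have I4 : (4%:E * I <= (4 * (K * (r ^+ n * S)))%:E)%E.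
    by rewrite EFinM; apply: lee_wpmul2l; [rewrite lee_fin|exact: Sh].
  by rewrite -EFinM !EFinD; apply: leeD => //; apply: leeD.
rewrite lee_fin.
apply: (@le_trans _ _ ((8 * K + A * v) * (r ^+ n * S))).
  have : A * v * r ^+ n <= A * v * (r ^+ n * S).
    by apply: ler_wpM2l; [exact: mulr_ge0|rewrite ler_peMr].
  lra.
rewrite -mulrA; apply: ler_wpM2l; first by apply: addr_ge0; apply: mulr_ge0 => //; exact: ltW.
by have /andP[mr1 _] := mr; exact: HP.
Qed.
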